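(* Let $m=2$ or $m=3$. Let $\alpha,\beta:\mathbb R\to\mathbb R$ be locally integrable, and assume that for every compact interval $[t_1,t_2]\subseteq\mathbb R$ there exist $\beta_1,\beta_2$ such that $0<\beta_1\le(-1)^m\beta(t)\le\beta_2$ for almost every $t\in[t_1,t_2]$. Let $U(t,\tau)$ be the linear process on $X=C([-1,0])$ generated by $\dot x(t)=-\alpha(t)x(t)-\beta(t)x(t-1)$ and let $W(t,\tau)=U(t,\tau)^{\wedge m}$ on $X^{\wedge m}$. Then the linear process $W(t,\tau)$ is $u_m$-positive with respect to the cone $K_m$, where $u_m\in X^{\wedge m}$ is the function defined in the context. Moreover, the quantity $\eta_0$ in the definition of a $u_0$-positive linear process may be taken to be $\eta_0=3$ if $m=2$ and $\eta_0=5$ if $m=3$.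
   Context: $X=C([-1,0])$ is the Banach space of real continuous functions with the sup norm. For $t\ge\tau$, $U(t,\tau)\varphi=x_t$, where $x$ solves the equation (a.e.) for $t\ge\tau$ with $x(\tau+\theta)=\varphi(\theta)$ for $\theta\in[-1,0]$, and $x_t(\theta)=x(t+\theta)$. $X^{\otimes m}$ is identified with $C([-1,0]^m)$, with $\varphi_1\otimes\cdots\otimes\varphi_m$ the function $\varphi_1(\theta_1)\cdots\varphi_m(\theta_m)$; $A^{\otimes m}$ is the unique bounded operator with $A^{\otimes m}(\varphi_1\otimes\cdots\otimes\varphi_m)=(A\varphi_1)\otimes\cdots\otimes(A\varphi_m)$; $X^{\wedge m}$ is the subspace of anti-symmetric functions in $C([-1,0]^m)$ and $A^{\wedge m}=A^{\otimes m}|_{X^{\wedge m}}$. $T_m=\{\theta\in[-1,0]^m : \theta_1\le\cdots\le\theta_m\}$ and $K_m=\{\varphi\in X^{\wedge m} : \varphi\ge0\text{ on }T_m\}$. Under the hypotheses each $W(t,\tau)$ maps $K_m$ into $K_m$. The function $u_m$ is given for $\theta\in T_m$ by $$u_m(\theta)=\Big(\prod_{1\le i<j\le m}(\theta_j-\theta_i)\Big)\Big(\prod_{1\le i<j\le m-1}(1+\theta_i-\theta_j)\Big)$$ (empty products equal $1$) and is extended to $[-1,0]^m$ as an anti-symmetric (continuous) function. Thus on $T_m$: $u_2=\theta_2-\theta_1$ and $u_3=(\theta_2-\theta_1)(\theta_3-\theta_2)(\theta_3-\theta_1)(1+\theta_1-\theta_2)$. Definition ($u_0$-positive linear process). Let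 $U(t,\tau)$, $t\ge\tau$, be a linear process on a Banach space $Y$ all of whose operators are positive with respect to a cone $K\subseteq Y$, and let $u_0\in K\setminus\{0\}$. The process is $u_0$-positive if there exists $\eta_0>0$ such that: for any $u\in K\setminus\{0\}$, any $\tau_1\le\tau_2$ and any $\eta_*\ge\eta_0$, there exist $C_1>0$ and $C_2>0$ with $C_1u_0\le U(\tau+\eta,\tau)u\le C_2u_0$ for every $\tau\in[\tau_1,\tau_2]$ and $\eta\in[\eta_0,\eta_*]$. Here $u\le v$ means $v-u\in K$. *)

(* Defs.v *)
From HB Require Import structures.
From mathcomp Require Import all_boot all_order all_algebra all_fingroup.
From mathcomp Require Import all_classical all_reals all_analysis.
From mathcomp Require Import ring.

Set Implicit Arguments.
Unset Strict Implicit.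
Unset Printing Implicit Defensive.

Import Order.TTheory GRing.Theory Num.Theory.
Import numFieldNormedType.Exports.

Local Open Scope classical_set_scope.
Local Open Scope ring_scope.

Section ContinuousFunctions.
Context {R : realType} {T : topologicalType}.

Definition cts : {pred T -> R^o} := mem [set f : T -> R^o | continuous f].

Lemma ctsP (f : T -> R^o) : reflect (continuous f) (f \in cts).
Proof. by apply: (iffP idP); rewrite inE. Qed.

Lemma cts_submod_closed : submod_closed cts.
Proof.
split; first by apply/ctsP => x; exact: cvg_cst.
move=> a f g /ctsP cf /ctsP cg; apply/ctsP => x.
by apply: cvgD; [apply: cvgZl_tmp; exact: cf|exact: cg].
Qed.

HB.instance Definition _ := GRing.isSubmodClosed.Build R (T -> R^o) cts
  cts_submod_closed.

(* The compactness proof is a parameter of the type so that the sup norm can be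
   attached to it canonically. *)
Record csp (cT : compact [set: T]) :=
  CSp { csp_fun :> T -> R^o ; csp_cts : csp_fun \in cts }.

Variable cT : compact [set: T].

HB.instance Definition _ := [isSub for @csp_fun cT].
HB.instance Definition _ := [Choice of csp cT by <:].
HB.instance Definition _ := [SubChoice_isSubLmodule of csp cT by <:].

Lemma csp_continuous (f : csp cT) : continuous (f : T -> R^o).
Proof. exact/ctsP/csp_cts. Qed.

Definition supnorm (f : T -> R^o) : R := sup [set `|f x| | x in [set: T]].

Lemma csp_has_ubound (f : csp cT) : has_ubound [set `|f x| | x in [set: T]].
Proof.
have : compact [set `|f x| | x in [set: T]].
  apply: (@continuous_compact _ _ (fun x => `|f x|)) => //.
  apply: continuous_subspaceT => x.
  by apply: cvg_norm; exact: csp_continuous.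
move=> /compact_bounded[M [_ Mf]]; exists (M + 1) => _ [x _ <-].
rewrite -[leLHS]normr_id; apply: (Mf (M + 1)); last by exists x.
by rewrite ltrDl.
Qed.

Lemma csp_ge (f : csp cT) x : `|f x| <= supnorm f.
Proof.
apply: sup_upper_bound; last by exists x.
by split; [exists `|f x|, x|exact: csp_has_ubound].
Qed.

Lemma csp_le (f : csp cT) M :
  0 <= M -> (forall x, `|f x| <= M) -> supnorm f <= M.
Proof.
move=> M0 fM; rewrite /supnorm; have [->|/set0P ne] :=
    eqVneq [set `|f x| | x in [set: T]] set0; first by rewrite sup0.
by apply: ge_sup => // _ [x _ <-].
Qed.

Lemma supnorm_ge0 (f : csp cT) : 0 <= supnorm f.
Proof.
rewrite /supnorm; have [->|/set0P[y [x _ _]]] :=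
    eqVneq [set `|f x| | x in [set: T]] set0; first by rewrite sup0.
exact: le_trans (csp_ge f x).
Qed.

Lemma supnormD (f g : csp cT) : supnorm (f + g) <= supnorm f + supnorm g.
Proof.
apply: (@csp_le (f + g)) => [|x]; first by rewrite addr_ge0 ?supnorm_ge0.
by apply: le_trans (ler_normD _ _) _; rewrite lerD ?csp_ge.
Qed.

Lemma supnormZ_le (a : R) (f : csp cT) : supnorm (a *: f) <= `|a| * supnorm f.
Proof.
apply: (@csp_le (a *: f)) => [|x]; first by rewrite mulr_ge0 ?supnorm_ge0.
by rewrite [leLHS]normrM ler_wpM2l ?csp_ge.
Qed.

Lemma supnorm_eq0 (f : csp cT) : supnorm f = 0 -> f = 0.
Proof.
move=> f0; apply/val_inj/funext => x; apply/normr0_eq0/le_anti.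
by rewrite normr_ge0 andbT -f0 csp_ge.
Qed.

Lemma supnormZ (a : R) (f : csp cT) : supnorm (a *: f) = `|a| * supnorm f.
Proof.
have [->|a0] := eqVneq a 0.
  apply/le_anti; rewrite supnormZ_le normr0 mul0r.
  exact: (@supnorm_ge0 (0 *: f)).
apply/le_anti; rewrite supnormZ_le /=.
have := supnormZ_le a^-1 (a *: f); rewrite scalerA mulVf// scale1r.
by rewrite normfV ler_pdivlMl ?normr_gt0.
Qed.

HB.instance Definition _ := Lmodule_isNormed.Build R (csp cT)
  supnormD supnormZ supnorm_eq0.


Lemma csp_norm_ge (f : csp cT) x : `|f x| <= `|f|.
Proof. exact: csp_ge. Qed.

Lemma csp_norm_le (f : csp cT) M :
  0 <= M -> (forall x, `|f x| <= M) -> `|f| <= M.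
Proof. exact: csp_le. Qed.

Lemma csp_cauchy_cvg (F : set_system (csp cT)) :
  ProperFilter F -> cauchy F -> cvg F.
Proof.
move=> FF /cauchy_ballP Fc.
have cx x : cvg (((fun f : csp cT => f x : R^o) @ F)).
  apply: cauchy_cvg; apply/cauchy_ballP => e e0.
  have [[A B] /= [FA FB] AB] := Fc e e0.
  exists ((fun f : csp cT => f x : R^o) @` A,
          (fun f : csp cT => f x : R^o) @` B).
    by split; [apply: filterS FA|apply: filterS FB] => f fA /=; exists f.
  move=> [_ _] /= [[f Af <-] [g Bg <-]].
  have := AB (f, g) (conj Af Bg); rewrite -!ball_normE /=.
  by apply: le_lt_trans; exact: (csp_norm_ge (f - g)).
pose l x : R^o := lim ((fun f : csp cT => f x : R^o) @ F).
have lunif (e : R) : 0 < e -> F [set f : csp cT | forall x, `|l x - f x| <= e].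
  move=> e0; have [[A B] /= [FA FB] AB] := Fc e e0.
  apply: filterS FB => g Bg x.
  have : (fun f : csp cT => `|f x - g x| : R^o) @ F --> `|l x - g x|.
    by apply: cvg_norm; apply: cvgB; [exact: cx|exact: cvg_cst].
  apply: (closed_cvg (fun y : R^o => y <= e)); first exact: closed_le.
  apply: filterS FA => f Af.
  have := AB (f, g) (conj Af Bg); rewrite -ball_normE /= => /ltW.
  by apply: le_trans; exact: (csp_norm_ge (f - g)).
have lc : l \in cts.
  apply/ctsP => x; apply/cvgrPdist_le => e e0.
  have e3 : 0 < e / 3 by rewrite divr_gt0.
  have [g gl] := filter_ex (lunif _ e3).
  have /cvgrPdist_le/(_ _ e3) := @csp_continuous g x.
  apply: filterS => y gxy.
  have -> : l x - l y = (l x - g x) + (g x - g y) + (g y - l y).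
    by rewrite !subrKA.
  have -> : e = e / 3 + e / 3 + e / 3.
    by field.
  apply: le_trans (ler_normD _ _) _; apply: lerD; last by rewrite distrC.
  by apply: le_trans (ler_normD _ _) _; apply: lerD.
apply/cvg_ex; exists (CSp cT lc); apply/cvgrPdist_le => e e0.
apply: filterS (lunif e e0) => f lf.
by apply: csp_norm_le => //; exact: ltW.
Qed.

HB.instance Definition _ := Uniform_isComplete.Build (csp cT) csp_cauchy_cvg.

End ContinuousFunctions.
Arguments csp R {T} cT.

Lemma compact_set_type (T : topologicalType) (A : set T) :
  compact A -> compact [set: A].
Proof.
move=> cA F FF _.
have GA : (set_val @ F) A.
  by apply: (@filterS _ F _ setT _ _ filterT) => x _; exact: set_valP.
have [p [Ap Gp]] := cA _ (fmap_proper_filter set_val FF) GA.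
exists (exist _ p (mem_set Ap)); split => // U V FU [_ [[W oW <-] Wp WV]].
have FU' : (set_val @ F) (set_val @` U) by apply: (@filterS _ F _ U) => // x Ux; exists x.
have [_ [[d Ud <-] Wd]] := Gp _ W FU' (open_nbhs_nbhs (conj oW Wp)).
by exists d; split => //; exact: WV.
Qed.

(* The interval [-1, 0] and its m-th power, as topological spaces. *)
Definition delay_itv (R : realType) : set R := `[-1, 0].
Arguments delay_itv : clear implicits.
Definition seg (R : realType) := set_type (delay_itv R).
Definition cube (R : realType) (m : nat) := {ptws 'I_m -> seg R}.
HB.instance Definition _ (R : realType) (m : nat) :=
  Topological.copy (cube R m) {ptws 'I_m -> seg R}.

Lemma seg_compact (R : realType) : compact [set: seg R].
Proof. by apply: compact_set_type; exact: segment_compact. Qed.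

Lemma cube_compact (R : realType) (m : nat) : compact [set: cube R m].
Proof.
have := @tychonoff 'I_m (fun=> seg R) (fun=> setT) (fun=> @seg_compact R).
by congr compact; apply/seteqP; split.
Qed.

(* C([-1, 0]) and C([-1, 0]^m), the latter standing for the m-fold tensor power
   of the former. *)
Notation Xsp R := (csp R (@seg_compact R)).
Notation Xtens R m := (csp R (@cube_compact R m)).

Section Wedge.
Context {R : realType} {m : nat}.

Definition permute (s : 'S_m) (t : cube R m) : cube R m := fun i => t (s i).

Definition antisym : {pred Xtens R m} :=
  mem [set f : Xtens R m |
    forall (s : 'S_m) (t : cube R m), f (permute s t) = (-1) ^+ s * f t].

Lemma antisymP (f : Xtens R m) :
  reflect (forall (s : 'S_m) (t : cube R m),
             f (permute s t) = (-1) ^+ s * f t)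
          (f \in antisym).
Proof. by apply: (iffP idP); rewrite inE. Qed.

Lemma antisym_submod_closed : submod_closed antisym.
Proof.
split; first by apply/antisymP => s t; rewrite mulr0.
move=> a f g /antisymP af /antisymP ag; apply/antisymP => s t.
rewrite -[LHS]/(a * f (permute s t) + g (permute s t)) af ag.
by rewrite mulrCA -mulrDr.
Qed.

HB.instance Definition _ := GRing.isSubmodClosed.Build R (Xtens R m) antisym
  antisym_submod_closed.

Record wedge := Wedge {
  wedge_val :> Xtens R m ; wedge_antisym : wedge_val \in antisym }.

HB.instance Definition _ := [isSub for wedge_val].
HB.instance Definition _ := [Choice of wedge by <:].
HB.instance Definition _ := [SubChoice_isSubLmodule of wedge by <:].

Let wedge_norm (f : wedge) : R := `|wedge_val f|.

Let wedge_normD f g : wedge_norm (f + g) <= wedge_norm f + wedge_norm g.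
Proof. exact: (ler_normD (wedge_val f)). Qed.

Let wedge_normZ a f : wedge_norm (a *: f) = `|a| * wedge_norm f.
Proof. exact: (normrZ a (wedge_val f)). Qed.

Let wedge_norm_eq0 f : wedge_norm f = 0 -> f = 0.
Proof. by move=> /normr0_eq0 f0; exact/val_inj. Qed.

HB.instance Definition _ := Lmodule_isNormed.Build R wedge
  wedge_normD wedge_normZ wedge_norm_eq0.

Lemma wedge_cauchy_cvg (F : set_system wedge) :
  ProperFilter F -> cauchy F -> cvg F.
Proof.
move=> FF /cauchy_ballP Fc.
have : cvg (wedge_val @ F).
  apply: cauchy_cvg; apply/cauchy_ballP => e e0.
  have [[A B] /= [FA FB] AB] := Fc e e0.
  exists (wedge_val @` A, wedge_val @` B).
    by split; [apply: filterS FA|apply: filterS FB] => f fA /=; exists f.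
  move=> [_ _] /= [[f Af <-] [g Bg <-]].
  by have := AB (f, g) (conj Af Bg); rewrite -!ball_normE.
move=> /cvg_ex[l Fl].
have la : l \in antisym.
  apply/antisymP => s t; apply/eqP; rewrite -subr_eq0 -normr_le0.
  apply/ler_addgt0Pr => e e0; rewrite add0r.
  have e2 : 0 < e / 2 by rewrite divr_gt0.
  move/cvgrPdist_le : Fl => /(_ _ e2) /filter_ex[f lf].
  have /antisymP fa := wedge_antisym f.
  have lft u : `|l u - f u| <= e / 2.
    by apply: le_trans lf; exact: (csp_norm_ge (l - f)).
  have -> : l (permute s t) - (-1) ^+ s * l t =
      (l (permute s t) - f (permute s t)) - (-1) ^+ s * (l t - f t).
    by rewrite fa mulrBr opprB addrA subrK.
  apply: le_trans (ler_normB _ _) _; rewrite normrMsign.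
  by rewrite [leRHS](splitr e) lerD.
apply/cvg_ex; exists (Wedge la); apply/cvgrPdist_le => e e0.
by move/cvgrPdist_le : Fl => /(_ _ e0).
Qed.

HB.instance Definition _ := Uniform_isComplete.Build wedge wedge_cauchy_cvg.

End Wedge.
Arguments wedge : clear implicits.

Section TensorPower.
Context {R : realType} {m : nat}.

Lemma continuous_bigprod (T : topologicalType) (I : Type) (s : seq I)
    (f : I -> T -> R^o) :
  (forall i, continuous (f i)) ->
  continuous (fun t => \prod_(i <- s) f i t : R^o).
Proof.
move=> cf; elim: s => [|i s IHs].
  have -> : (fun t => \prod_(i <- [::]) f i t : R^o) = cst 1.
    by apply/funext => t; rewrite big_nil.
  exact: cst_continuous.
have -> : (fun t => \prod_(j <- i :: s) f j t : R^o) =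
    f i \* (fun t => \prod_(j <- s) f j t).
  by apply/funext => t; rewrite big_cons.
by move=> t; apply: cvgM; [exact: cf|exact: IHs].
Qed.

Lemma tens_cts (phi : 'I_m -> Xsp R) :
  (fun t : cube R m => \prod_i phi i (t i) : R^o) \in cts.
Proof.
apply/ctsP.
apply: (@continuous_bigprod (cube R m) _ _ (fun i t => phi i (t i))) => i t.
exact: (@continuous_comp (cube R m) (seg R) R^o (proj i) (phi i) t
  (@proj_continuous 'I_m (fun=> seg R) i t) (@csp_continuous R _ _ (phi i) _)).
Qed.

Definition tens (phi : 'I_m -> Xsp R) : Xtens R m := CSp _ (tens_cts phi).

Definition bounded_operator (V W : normedModType R) (A : V -> W) : Prop :=
  linear A /\ exists M : R, forall v, `|A v| <= M * `|v|.

Definition is_tensor_power (A : Xsp R -> Xsp R) (B : Xtens R m -> Xtens R m) :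
    Prop :=
  bounded_operator B /\
  forall phi : 'I_m -> Xsp R, B (tens phi) = tens (fun i => A (phi i)).

Definition is_wedge_power (A : Xsp R -> Xsp R) (B : wedge R m -> wedge R m) :
    Prop :=
  exists2 C : Xtens R m -> Xtens R m, is_tensor_power A C &
    forall f : wedge R m, wedge_val (B f) = C (wedge_val f).

End TensorPower.

Section Processes.
Context {R : realType} {Y : completeNormedModType R}.

(* [U t tau] is only meaningful for [tau <= t]; the last field is joint strong
   continuity in (t, tau). *)
Record linear_process (U : R -> R -> Y -> Y) : Prop := LinearProcess {
  process_bounded : forall t tau, tau <= t -> bounded_operator (U t tau) ;
  process_id : forall tau y, U tau tau y = y ;
  process_comp : forall t s tau y, tau <= s -> s <= t ->
    U t s (U s tau y) = U t tau y ;
  process_continuous : forall y,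
    {within [set p : R * R | p.2 <= p.1], continuous (fun p => U p.1 p.2 y)} }.

Definition is_cone (K : set Y) : Prop :=
  [/\ closed K, K 0, forall u v, K u -> K v -> K (u + v),
      forall (a : R) u, 0 <= a -> K u -> K (a *: u) &
      forall u, K u -> K (- u) -> u = 0].

Definition cone_le (K : set Y) (u v : Y) : Prop := K (v - u).

Definition u0_positive_from (K : set Y) (u0 : Y) (U : R -> R -> Y -> Y)
    (eta0 : R) : Prop :=
  forall (u : Y) (tau1 tau2 eta1 : R),
    K u -> u <> 0 -> tau1 <= tau2 -> eta0 <= eta1 ->
  exists C1 C2 : R, [/\ 0 < C1, 0 < C2 &
    forall tau eta, tau1 <= tau <= tau2 -> eta0 <= eta <= eta1 ->
      cone_le K (C1 *: u0) (U (tau + eta) tau u) /\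
      cone_le K (U (tau + eta) tau u) (C2 *: u0)].

(* The cone and linear process conditions are the standing assumptions under
   which u0-positivity is defined; they are recorded here as well. *)
Record u0_positive (K : set Y) (u0 : Y) (U : R -> R -> Y -> Y) : Prop :=
  U0Positive {
    u0_positive_process : linear_process U ;
    u0_positive_cone : is_cone K ;
    u0_positive_pos : forall t tau u, tau <= t -> K u -> K (U t tau u) ;
    u0_positive_u0 : K u0 /\ u0 <> 0 ;
    u0_positive_eta0 : exists2 eta0 : R, 0 < eta0 &
      u0_positive_from K u0 U eta0 }.

End Processes.

Section DelayEquation.
Context {R : realType}.
Notation mu := (@lebesgue_measure R).

(* The library's [locally_integrable] asks for Borel measurability; Lebesgue
   measurable functions are the a.e. modifications of Borel measurable ones. *)
Definition loc_integrable (f : R -> R) : Prop :=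
  exists2 g : R -> R, locally_integrable setT g & {ae mu, forall t, f t = g t}.

Definition abs_continuous (a b : R) (f : R -> R) : Prop :=
  forall e : R, 0 < e -> exists2 d : R, 0 < d &
    forall (n : nat) (p q : 'I_n -> R),
      (forall i, [/\ a <= p i, p i <= q i & q i <= b]) ->
      trivIset setT (fun i => `]p i, q i[%classic) ->
      \sum_i (q i - p i) < d -> \sum_i `|f (q i) - f (p i)| < e.

(* Caratheodory solutions of x'(t) = - alpha(t) x(t) - beta(t) x(t-1) on
   [tau, +oo) with initial condition phi. Values of x below tau - 1 are
   irrelevant. *)
Definition solves (alpha beta : R -> R) (tau : R) (phi : Xsp R) (x : R -> R) :
    Prop :=
  [/\ forall th : seg R, x (tau + \val th) = phi th,
      forall b, tau <= b -> abs_continuous tau b x &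
      {ae mu, forall t, tau <= t ->
        is_derive t 1 x (- alpha t * x t - beta t * x (t - 1))}].

Definition generated_by (alpha beta : R -> R)
    (U : R -> R -> Xsp R -> Xsp R) : Prop :=
  forall (tau : R) (phi : Xsp R),
  exists2 x : R -> R, solves alpha beta tau phi x &
    forall t, tau <= t -> forall th : seg R, U t tau phi th = x (t + \val th).

End DelayEquation.

Section Cone.
Context {R : realType}.
Variable m : nat.

Definition simplex : set (cube R m) :=
  [set t | forall i j : 'I_m, (i <= j)%N -> \val (t i) <= \val (t j)].

Definition Kcone : set (wedge R m) :=
  [set f | forall t, simplex t -> 0 <= f t].

(* Indices start at 0, so that [1 <= i < j <= m - 1] becomes
   [i < j] and [j.+1 < m]. *)
Definition um_on_simplex (t : cube R m) : R :=
  (\prod_(i < m) \prod_(j < m | (i < j)%N) (\val (t j) - \val (t i))) *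
  (\prod_(i < m) \prod_(j < m | (i < j)%N && (j.+1 < m)%N)
     (1 + \val (t i) - \val (t j))).

(* The continuous anti-symmetric extension of [um_on_simplex]; it exists for
   m = 2 and m = 3 by [umE] below. *)
Definition um : wedge R m :=
  get [set u : wedge R m | forall t, simplex t -> u t = um_on_simplex t].

End Cone.
Arguments simplex {R} m.
Arguments Kcone {R} m.
Arguments um {R} m.

Lemma sym_on_simplex (R : realType) (m : nat) (t : cube R m) :
  m = 2%N \/ m = 3%N -> simplex m t ->
  (if m == 3%N then
     1 + 3 *: (\sum_i \val (t i) : R^o) -
     (5 / 2) *: (\sum_i \sum_j Num.max (\val (t i)) (\val (t j)) : R^o) +
     (1 / 2) *: (\sum_i \sum_j \sum_k
       Num.max (Num.max (\val (t i)) (\val (t j))) (\val (t k)) : R^o)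
   else 1) =
  \prod_(i < m) \prod_(j < m | (i < j)%N && (j.+1 < m)%N)
     (1 + \val (t i) - \val (t j)).
Proof.
move=> m23; case: m23 t => -> t st /=.
  apply/esym; apply: big1 => i _; apply: big1 => j.
  by case: j => -[|j] jm; rewrite /= ?andbF ?ltn0 // !ltnS ltn0 andbF.
pose x0 := \val (t ord0); pose x1 := \val (t (lift ord0 ord0)).
pose x2 := \val (t (lift ord0 (lift ord0 ord0))).
have h01 : x0 <= x1 by exact: st.
have h12 : x1 <= x2 by exact: st.
have h02 : x0 <= x2 by exact: le_trans h12.
under [RHS]eq_bigr => i _ do rewrite big_mkcond.
rewrite !big_ord_recl !big_ord0 /= -/x0 -/x1 -/x2.
rewrite !(maxxx, max_r h01, max_r h12, max_r h02,
  max_l h01, max_l h12, max_l h02).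
by rewrite /GRing.scale /=; field.
Qed.

Section UmExists.
Context {R : realType} {m : nat}.

Let crd (t : cube R m) (i : 'I_m) : R^o := \val (t i).

Let crd_continuous i : continuous (crd^~ i).
Proof.
move=> t.
exact: (@continuous_comp (cube R m) (seg R) R^o (proj i) (\val) t
  (@proj_continuous 'I_m (fun=> seg R) i t)
  (@initial_continuous (seg R) R^o set_val (t i))).
Qed.

Let ctsB (T : topologicalType) (f g : T -> R^o) : continuous f ->
  continuous g -> continuous (fun t => f t - g t : R^o).
Proof. by move=> cf cg t; apply: cvgB; [exact: cf|exact: cg]. Qed.

Let ctsD (T : topologicalType) (f g : T -> R^o) : continuous f ->
  continuous g -> continuous (fun t => f t + g t : R^o).
Proof. by move=> cf cg t; apply: cvgD; [exact: cf|exact: cg]. Qed.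

Let ctsM (T : topologicalType) (f g : T -> R^o) : continuous f ->
  continuous g -> continuous (fun t => f t * g t : R^o).
Proof. by move=> cf cg t; apply: cvgM; [exact: cf|exact: cg]. Qed.

Let ctsZ (T : topologicalType) (a : R) (f : T -> R^o) : continuous f ->
  continuous (fun t => a *: f t : R^o).
Proof. by move=> cf t; apply: cvgZl_tmp; exact: cf. Qed.

Let continuous_bigsum (T : topologicalType) (I : Type) (s : seq I)
    (f : I -> T -> R^o) :
  (forall i, continuous (f i)) ->
  continuous (fun t => \sum_(i <- s) f i t : R^o).
Proof.
move=> cf; elim: s => [|i s IHs].
  have -> : (fun t => \sum_(i <- [::]) f i t : R^o) = cst 0.
    by apply/funext => t; rewrite big_nil.
  exact: cst_continuous.
have -> : (fun t => \sum_(j <- i :: s) f j t : R^o) =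
    f i \+ (fun t => \sum_(j <- s) f j t).
  by apply/funext => t; rewrite big_cons.
by move=> t; apply: cvgD; [exact: cf|exact: IHs].
Qed.

Let continuous_maxf (T : topologicalType) (f g : T -> R^o) :
  continuous f -> continuous g ->
  continuous (fun t => Num.max (f t) (g t) : R^o).
Proof.
move=> cf cg.
have -> : (fun t => Num.max (f t) (g t) : R^o) =
    (fun t => 2^-1 *: (f t + g t + `|f t - g t|) : R^o).
  by apply/funext => t; rewrite maxr_absE mulrC.
move=> t; apply: cvgZl_tmp; apply: cvgD.
  by apply: cvgD; [exact: cf|exact: cg].
by apply: cvg_norm; apply: cvgB; [exact: cf|exact: cg].
Qed.

Let vdm (t : cube R m) : R^o := \prod_(i < m) \prod_(j < m | (i < j)%N) (crd t j - crd t i).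

Let vdm_continuous : continuous vdm.
Proof.
apply: (@continuous_bigprod R (cube R m) _ (index_enum 'I_m)
  (fun i t => \prod_(j < m | (i < j)%N) (crd t j - crd t i))) => i.
have -> : (fun t => \prod_(j < m | (i < j)%N) (crd t j - crd t i) : R^o) =
    (fun t => \prod_(j < m) if (i < j)%N then crd t j - crd t i else 1).
  by apply/funext => t; rewrite big_mkcond.
apply: (@continuous_bigprod R (cube R m) _ (index_enum 'I_m)
  (fun j t => if (i < j)%N then crd t j - crd t i else 1)) => j.
case: (i < j)%N; last exact: cst_continuous.
by apply: (@ctsB (cube R m) (crd^~ j) (crd^~ i)); exact: crd_continuous.
Qed.

Let vdm_permute (s : 'S_m) (t : cube R m) : vdm (permute s t) = (-1) ^+ s * vdm t.
Proof.
pose a (t : cube R m) := \row_(j < m) crd t j.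
have vE u : vdm u = \det (Vandermonde m (a u)).
  rewrite det_Vandermonde; apply: eq_bigr => i _; apply: eq_bigr => j _.
  by rewrite !mxE.
rewrite !vE.
have -> : Vandermonde m (a (permute s t)) = col_perm s (Vandermonde m (a t)).
  by apply/matrixP => i j; rewrite !mxE.
by rewrite col_permE det_mulmx det_perm odd_permV mulrC.
Qed.

Let s1 (t : cube R m) : R^o := \sum_i crd t i.
Let s2 (t : cube R m) : R^o := \sum_i \sum_j Num.max (crd t i) (crd t j).
Let s3 (t : cube R m) : R^o :=
  \sum_i \sum_j \sum_k Num.max (Num.max (crd t i) (crd t j)) (crd t k).

(* For m = 3 this is 1 + t_(1) - t_(2), with t_(1) <= t_(2) <= t_(3) the
   coordinates of t in increasing order. *)
Let sym (t : cube R m) : R^o :=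
  if m == 3%N then 1 + 3 *: s1 t - (5 / 2) *: s2 t + (1 / 2) *: s3 t else 1.

Let sym_continuous : continuous sym.
Proof.
rewrite /sym; case: (m == 3); last exact: cst_continuous.
have c1 : continuous s1 by apply: continuous_bigsum.
have c2 : continuous s2.
  apply: (continuous_bigsum (s := index_enum 'I_m) (T := cube R m) (f := fun i t =>
    \sum_j Num.max (crd t i) (crd t j))) => i.
  by apply: continuous_bigsum => j; apply: continuous_maxf.
have c3 : continuous s3.
  apply: (continuous_bigsum (s := index_enum 'I_m) (T := cube R m) (f := fun i t =>
    \sum_j \sum_k Num.max (Num.max (crd t i) (crd t j)) (crd t k))) => i.
  apply: (continuous_bigsum (s := index_enum 'I_m) (T := cube R m) (f := fun j t =>
    \sum_k Num.max (Num.max (crd t i) (crd t j)) (crd t k))) => j.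
  by apply: continuous_bigsum => k; do 2 apply: continuous_maxf => //.
have c0 : continuous (fun _ : cube R m => 1 : R^o) by exact: cst_continuous.
have h := ctsD (ctsB (ctsD c0 (ctsZ (a := 3) c1)) (ctsZ (a := 5 / 2) c2))
  (ctsZ (a := 1 / 2) c3).
exact h.
Qed.

Let sym_permute (s : 'S_m) (t : cube R m) : sym (permute s t) = sym t.
Proof.
have e1 : s1 (permute s t) = s1 t.
  by rewrite /s1 [RHS](reindex_inj (@perm_inj _ s)).
have e2 : s2 (permute s t) = s2 t.
  rewrite /s2 [RHS](reindex_inj (@perm_inj _ s)); apply: eq_bigr => i _.
  by rewrite [RHS](reindex_inj (@perm_inj _ s)).
have e3 : s3 (permute s t) = s3 t.
  rewrite /s3 [RHS](reindex_inj (@perm_inj _ s)); apply: eq_bigr => i _.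
  rewrite [RHS](reindex_inj (@perm_inj _ s)); apply: eq_bigr => j _.
  by rewrite [RHS](reindex_inj (@perm_inj _ s)).
by rewrite /sym e1 e2 e3.
Qed.

Let cand_cts : (fun t => vdm t * sym t : R^o) \in cts.
Proof.
apply/ctsP.
exact: (ctsM vdm_continuous sym_continuous).
Qed.

Let cand_antisym : CSp (@cube_compact R m) cand_cts \in antisym.
Proof. by apply/antisymP => s t /=; rewrite vdm_permute sym_permute mulrA. Qed.

Lemma umE (t : cube R m) : m = 2%N \/ m = 3%N -> simplex m t -> um m t = um_on_simplex t.
Proof.
move=> m23; rewrite /um; case: xgetP => [u _ uE|none]; first exact: uE.
exfalso; apply: (none (Wedge cand_antisym)) => {}t st /=.
rewrite /um_on_simplex; congr (_ * _).
exact: sym_on_simplex.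
Qed.

End UmExists.

(* Main.v *)
(** After multiplication by the integrating factor of [x' = - alpha x], the wedge
    power evaluated at a window of times becomes an anti-symmetric function
    [F(t_1, .., t_m)] of [m] times satisfying, for [t_1 <= .. <= t_m <= t_1 + 1],
    [dF/dt_m (t_1, .., t_m) = b(t_m) F(t_m - 1, t_1, .., t_(m-1))] with [b]
    between positive constants: moving the delayed time to the front is a cyclic
    permutation, whose signature [(-1)^(m-1)] cancels the sign of [- beta].
    Since [F] vanishes when two times coincide, it stays nonnegative, and a
    positive value [F(a, b, c)] makes [F(b, c, t)] positive for
    [a + 1 < t <= b + 1]. Following such chains, [F] is positive at distinct times
    after a few units of time, uniformly on compact sets. Iterating the integrated
    equation near the diagonals and near [t_(m-1) = t_1 + 1] converts constant
    bounds into the products of differences that make up [u_m]. *)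
Require Import Defs.
From HB Require Import structures.
From mathcomp Require Import all_boot all_order all_algebra all_fingroup.
From mathcomp Require Import all_classical all_reals all_analysis.
From mathcomp Require Import ring lra.

Import Order.TTheory GRing.Theory Num.Theory.
Import numFieldNormedType.Exports.

Local Open Scope classical_set_scope.
Local Open Scope ring_scope.

Set Implicit Arguments.
Unset Strict Implicit.
Unset Printing Implicit Defensive.

(** * Absolute continuity and integrating factors *)

(** The operators [W t tau] are known only through elementary tensors, so a general wedge element
    comes with no differential equation. Finite sums of elementary tensors are dense; with all times
    but one frozen, such a sum is a single scalar solution, and its increments pass to the limit as
    inequalities with constant bounds. The arguments in two and three times use only these
    integrated inequalities, the initial sign, the zeros on the diagonal and the openness of
    positivity. The thresholds 3 and 5 are counted as follows. A positive tuple ending at [c] exists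
    for every [c >= tau + 1], and one spanning exactly a unit of time for every [c >= tau + 2]. For
    [m = 2] this gives the two-sided bound once the first time is past [tau + 2], that is, for
    windows ending past [tau + 3]. For [m = 3] one more unit makes the middle time of such a triple
    arbitrary, and near the diagonal the iterated equation reaches back by another unit, so the
    first time must be past [tau + 4] and the end of the window past [tau + 5]. *)

Section AbsoluteContinuity.
Context {R : realType}.
Notation mu := (@lebesgue_measure R).
Implicit Types (f g : R -> R) (a b : R).

(** Continuous induction on the supremum of the good points. The step may start at any [u] slightly
    left of [x], so the supremum need not be known to be good beforehand. *)
Lemma real_local_induction a b (S : R -> Prop) : a <= b -> S a ->
  (forall x, a <= x <= b -> exists2 h, 0 < h & forall u v, a <= u -> u <= x ->
     x <= v -> v <= b -> x - h < u -> v < x + h -> S u -> S v) -> S b.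
Proof.
move=> ab Sa loc.
pose E := [set x | a <= x <= b /\ S x].
have Ea : E a by split=> //; rewrite lexx ab.
have ubE : ubound E b by move=> x [/andP[_ ?] _].
have supE : has_sup E by split; [exists a|exists b].
pose c := sup E.
have ac : a <= c by exact: sup_upper_bound.
have cb : c <= b by apply: ge_sup; [exists a|].
have [|h h0 ch] := loc c; first by rewrite ac cb.
have [u [/andP[au ub] Su] uc] := sup_adherent h0 supE.
have uc' : u <= c by apply: sup_upper_bound => //; split=> //; rewrite au ub.
pose v := Num.min b (c + h / 2).
have cv : c <= v by rewrite le_min cb/=; lra.
have vb : v <= b by rewrite ge_min lexx.
have vch : v < c + h by rewrite gt_min; apply/orP; right; lra.
have Sv : S v by exact: (ch u v).
have vc : v <= c.
  by apply: sup_upper_bound => //; split=> //; rewrite vb (le_trans ac cv).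
have [bc|cb'] := leP b (c + h / 2).
  by move: Sv; rewrite /v (min_l bc).
by move: vc; rewrite /v (min_r (ltW cb')) => ?; exfalso; lra.
Qed.

Lemma is_derive_ge f (x d e : R) : is_derive x 1 f d -> 0 < e ->
  exists2 h, 0 < h & forall u v, u <= x -> x <= v -> x - h < u -> v < x + h ->
    (d - e) * (v - u) <= f v - f u <= (d + e) * (v - u).
Proof.
move=> /is_derive1_caratheodory[g [fg cg gx]] e0.
move/cvgrPdist_le : cg => /(_ _ e0) /nbhs_ballP[h /= h0 hg].
exists h => // u v ux xv hu hv.
have P z : x - h < z -> z < x + h -> d - e <= g z <= d + e.
  move=> z1 z2; have /hg : ball x h z.
    by rewrite -ball_normE /=; rewrite ltr_norml; apply/andP; split; lra.
  by rewrite /= gx ler_norml => /andP[? ?]; apply/andP; split; lra.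
have /andP[gu1 gu2] : d - e <= g u <= d + e by apply: P; lra.
have /andP[gv1 gv2] : d - e <= g v <= d + e by apply: P; lra.
have -> : f v - f u = g v * (v - x) + g u * (x - u).
  by rewrite -(subrKA (f x)) fg -(opprB (f u)) fg; ring.
apply/andP; split; nra.
Qed.

Lemma lebesgue_measure_oo (p q : R) : p <= q ->
  mu (`]p, q[ : set R) = (q - p)%:E.
Proof.
move=> pq; rewrite lebesgue_measure_itv/= lte_fin EFinB.
by case: ltP => // qp; rewrite (le_anti (introT andP (conj pq qp))) -EFinB subrr.
Qed.

Lemma negligible_open_cover (N : set R) (e : R) : mu.-negligible N -> 0 < e ->
  exists U : set R, [/\ open U, N `<=` U & (mu U < e%:E)%E].
Proof.
move=> [B [mB B0 NB]] e0.
have [|U [oU BU Ue]] := @lebesgue_regularity_outer R B e mB _ e0.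
  by apply: (@le_lt_trans _ _ 0%E); rewrite ?ltry//;
    rewrite le_eqVlt; apply/orP; left; apply/eqP/B0.
exists U; split=> //; first exact: subset_trans BU.
have mU := measurable_realfun.open_measurable oU.
rewrite -(setDUK BU).
apply: le_lt_trans (measureU2 _ _ _) _ => //; first exact: measurableD.
apply: le_lt_trans Ue; rewrite -[leRHS]add0e leeD2r//.
by rewrite le_eqVlt; apply/orP; left; apply/eqP/B0.
Qed.

(* Along [[a, x]], the inequality [f a <= f x + e (x - a) + S] is propagated, with
   [S] the oscillation of [f] over disjoint intervals inside a small open cover of
   the exceptional set; absolute continuity makes [S] small. *)
Lemma abs_continuous_nondecreasing f a b : a <= b -> abs_continuous a b f ->
  {ae mu, forall t, a <= t <= b -> exists2 d, 0 <= d & is_derive t 1 f d} ->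
  f a <= f b.
Proof.
move=> ab acf aef.
suff P e : 0 < e -> f a <= f b + e * (b - a) + e.
  apply/ler_addgt0Pr => e e0.
  pose e' := e / (b - a + 1).
  have p : 0 < b - a + 1 by lra.
  have e'0 : 0 < e' by rewrite divr_gt0.
  have := P _ e'0; have -> : f b + e' * (b - a) + e' = f b + e' * (b - a + 1) by ring.
  by rewrite /e' divfK// gt_eqF.
move=> e0.
have [del del0 acd] := acf _ e0.
have [V [oV NV Vdel]] := negligible_open_cover (aef : mu.-negligible _) del0.
pose fam (x : R) (n : nat) (p q : nat -> R) :=
  [/\ forall i, (i < n)%N -> [/\ a <= p i, p i <= q i, q i <= x & `]p i, q i[ `<=` V],
      trivIset `I_n (fun i => `]p i, q i[%classic) &
      f a <= f x + e * (x - a) + \sum_(i < n) `|f (q i) - f (p i)|].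
have [] : exists n p q, fam b n p q.
  apply: (@real_local_induction a b (fun x => exists n p q, fam x n p q)) => //.
    exists 0%N, (fun=> 0), (fun=> 0); split => [//||].
    - by apply/trivIsetP => i j.
    - by rewrite big_ord0 subrr mulr0 !addr0.
  move=> x /andP[ax xb].
  have [[d d0 fd]|nd] := pselect (exists2 d, 0 <= d & is_derive x 1 f d).
    have [h h0 hd] := is_derive_ge fd e0.
    exists h => // u v au ux xv vb hu hv [n [p [q [fam1 fam2 fam3]]]].
    exists n, p, q; split=> // [i /fam1[? ? ? ?]|]; first by split=> //; lra.
    have /andP[+ _] := hd u v ux xv hu hv.
    move: fam3; set s := \sum_(i < n) _; nra.
  have /NV Ox : (~` (fun x => a <= x <= b -> exists2 d, 0 <= d & is_derive x 1 f d)) x.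
    by move=> /=; apply: contra_not nd; apply; rewrite ax xb.
  have [h h0 hO] : exists2 h, 0 < h & ball x h `<=` V.
    by have /nbhs_ballP[h /= h0 ?] := open_nbhs_nbhs (conj oV Ox); exists h.
  exists h => // u v au ux xv vb hu hv [n [p [q [fam1 fam2 fam3]]]].
  exists n.+1, (fun i => if (i < n)%N then p i else u),
    (fun i => if (i < n)%N then q i else v); split.
  - move=> i; rewrite ltnS; case: ltnP => [lin _|nin lin].
      by have [? ? ? ?] := fam1 _ lin; split=> //; lra.
    split=> //; try lra.
    apply: subset_trans hO => z /=; rewrite in_itv/= => /andP[z1 z2].
    by rewrite -ball_normE /= ltr_norml; apply/andP; split; lra.
  - apply/trivIsetP => i j /=; rewrite !ltnS => li lj ij.
    move/trivIsetP : fam2 => fam2.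
    have disj k z : (k < n)%N -> (`]p k, q k[ z -> `]u, v[ z -> False)%classic.
      move=> kn; rewrite /= !in_itv/= => /andP[_ z1] /andP[z2 _].
      by have [? ? ? ?] := fam1 _ kn; lra.
    case: ltnP => lin; case: ltnP => ljn.
    + exact: fam2.
    + by apply/seteqP; split=> // z [/disj h1] /h1; apply.
    + by apply/seteqP; split=> // z [+ /disj h1] => /h1; apply.
    + by move: ij; rewrite (@anti_leq i n) ?li// (@anti_leq j n) ?lj ?eqxx.
  - rewrite big_ord_recr/= ltnn.
    under eq_bigr do rewrite ltn_ord.
    move: fam3; set s := \sum_(i < n) _ => fam3.
    have := ler_norm (f u - f v); rewrite distrC; nra.
move=> n [p [q [fam1 fam2 fam3]]].
apply: le_trans fam3 _; rewrite lerD2l; apply/ltW.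
apply: (acd n (fun i => p i) (fun i => q i)) => [i||].
- by have [] := fam1 i (ltn_ord i).
- move/trivIsetP : fam2 => fam2.
  apply/trivIsetP => i j _ _ ij.
  exact: (fam2 i j (ltn_ord i) (ltn_ord j) ij).
- rewrite -lte_fin; apply: le_lt_trans Vdel.
  have -> : (\sum_(i < n) (q i - p i))%:E =
      mu (\big[setU/set0]_(i < n) `]p i, q i[%classic).
    rewrite measure_bigsetU_ord//; last first.
      move/trivIsetP : fam2 => fam2.
      apply/trivIsetP => i j _ _ ij.
      exact: (fam2 i j (ltn_ord i) (ltn_ord j) ij).
    rewrite -sumEFin; apply: eq_bigr => i _.
    have [_ pq _ _] := fam1 i (ltn_ord i).
    by rewrite -lebesgue_measure_oo.
  apply: le_measure; rewrite ?inE.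
  + by apply: bigsetU_measurable.
  + exact: measurable_realfun.open_measurable.
  + rewrite -(bigcup_mkord n (fun i => `]p i, q i[%classic)) => z [i /= /fam1[_ _ _]]; exact.
Qed.

End AbsoluteContinuity.

Section Primitive.
Context {R : realType}.
Notation mu := (@lebesgue_measure R).

Lemma locally_integrable_itv (g : R -> R) (a b : R) :
  locally_integrable setT g -> mu.-integrable `[a, b] (EFin \o g).
Proof.
move=> [mg _ ig]; apply/integrableP; split.
  by apply/measurable_realfun.measurable_EFinP; exact: measurable_funS mg.
by apply: ig => //; exact: segment_compact.
Qed.

(** Each increment is at most the integral of [|g|] over its interval, so their sum is at most the
    integral over the union, which is small with the measure of the union. *)
Lemma abs_continuous_integral (g : R -> R) (a b : R) :
  locally_integrable setT g ->
  abs_continuous a b (fun x => \int[mu]_(t in `[a, x]) g t).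
Proof.
move=> lg e e0; have ig c d := locally_integrable_itv c d lg.
have /integrable_mkcond : mu.-integrable `[a, b] (EFin \o g) by [].
rewrite restrict_EFin => /(_ (measurable_itv _)) ih.
have [d [d0 dP]] := integral_normr_continuous ih e0.
exists d => // n p q pq triv sumd.
pose D := \big[setU/set0]_(i < n) `]p i, q i[%classic.
have mD : measurable D by apply: bigsetU_measurable.
have Dd : (mu D < d%:E)%E.
  rewrite measure_bigsetU_ord//.
  apply: le_lt_trans (_ : ((\sum_i (q i - p i))%:E < _)%E); last by rewrite lte_fin.
  rewrite -sumEFin; apply: lee_sum => i _.
  by have [_ ? _] := pq i; rewrite -lebesgue_measure_oo.
apply: le_lt_trans (dP D mD Dd).
have inc i : `|\int[mu]_(t in `[a, q i]) g t - \int[mu]_(t in `[a, p i]) g t| <=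
    \int[mu]_(t in `]p i, q i[) `|(g \_ `[a, b]) t|.
  have [api piqi qib] := pq i.
  have sub : `]p i, q i] `<=` `[a, b].
    by move=> x /=; rewrite !in_itv/= => /andP[? ?]; apply/andP; split; lra.
  have ii : mu.-integrable `]p i, q i] (EFin \o g).
    exact: integrableS (ig a b).
  have iin : mu.-integrable `]p i, q i] (EFin \o (fun t => `|g t|)).
    exact: (integrable_norm ii).
  rewrite (Rintegral_itvB (ig a (q i)))//; try by rewrite bnd_simp.
  apply: le_trans (le_normr_Rintegral _ ii) _ => //.
  rewrite (@Rintegral_itv_bndo_bndc _ _ _ (fun t => `|(g \_ `[a, b]) t|)); last first.
    apply: (@integrableS _ _ _ _ setT) => //.
    exact: (integrable_norm ih).
  rewrite le_eqVlt; apply/orP; left; apply/eqP.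
  by apply: eq_Rintegral => x /set_mem xi; rewrite patchE mem_set//; exact: sub.
apply: le_trans (ler_sum _ (fun i _ => inc i)) _.
have inD : mu.-integrable D (EFin \o (fun t => `|(g \_ `[a, b]) t|)).
  apply: (@integrableS _ _ _ _ setT) => //; exact: (integrable_norm ih).
rewrite -lee_fin -sumEFin [leRHS]fineK; last exact: integrable_fin_num.
rewrite ge0_integral_bigsetU//.
- apply: lee_sum => i _; rewrite fineK//; apply: integrable_fin_num => //.
  apply: (@integrableS _ _ _ _ setT) => //; exact: (integrable_norm ih).
- exact: index_enum_uniq.
- by apply/trivIsetP => i j _ _ ij; move/trivIsetP : triv; apply.
- by case/integrableP : inD.
Qed.

Lemma is_derive_derive1 (f : R -> R) (t d : R) : derivable f t 1 ->
  f^`()%classic t = d -> is_derive t 1 f d.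
Proof. by move=> df fd; apply: DeriveDef => //; rewrite -derive1E. Qed.

(** The Borel representative of [alpha] is integrated; the derivative is [alpha t] at almost every
    [t], where the fundamental theorem applies and both functions agree. *)
Lemma loc_integrable_primitive (alpha : R -> R) (a : R) : loc_integrable alpha ->
  exists2 A : R -> R, forall b, abs_continuous a b A &
    {ae mu, forall t, a < t -> is_derive t 1 A (alpha t)}.
Proof.
move=> [g lg ae_g]; exists (fun x => \int[mu]_(t in `[a, x]) g t).
  by move=> b; exact: abs_continuous_integral.
have := @FTC1 R g (BLeft a) (fun y => locally_integrable_itv a y lg) lg.
move: ae_g; apply: filterS2; first exact: (ae_filter_ringOfSetsType mu).
move=> t -> + at'.
rewrite /= lte_fin => /(_ at')[d1 d2].
exact: is_derive_derive1.
Qed.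

End Primitive.

Section AbsContinuousAlgebra.
Context {R : realType}.
Implicit Types (f g : R -> R) (a b : R).

Lemma abs_continuous_sub f a b c d : a <= c -> d <= b ->
  abs_continuous a b f -> abs_continuous c d f.
Proof.
move=> ac db acf e /acf[del del0 P]; exists del => // n p q pq.
by apply: P => i; have [? ? ?] := pq i; split => //; lra.
Qed.

(** Common source of the closure properties below: products, exponentials, linear perturbations and
    opposites all have increments dominated by those of their ingredients. *)
Lemma abs_continuous_dom2 f1 f2 g a b L1 L2 : 0 <= L1 -> 0 <= L2 ->
  abs_continuous a b f1 -> abs_continuous a b f2 ->
  (forall u v, a <= u <= b -> a <= v <= b ->
    `|g u - g v| <= L1 * `|f1 u - f1 v| + L2 * `|f2 u - f2 v|) ->
  abs_continuous a b g.
Proof.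
move=> L10 L20 ac1 ac2 dom e e0.
pose e' := e / (L1 + L2 + 1).
have p : 0 < L1 + L2 + 1 by lra.
have e'0 : 0 < e' by rewrite divr_gt0.
have [d1 d10 P1] := ac1 _ e'0; have [d2 d20 P2] := ac2 _ e'0.
exists (Num.min d1 d2) => [|n p' q' pq triv]; first by rewrite lt_min d10.
rewrite lt_min => /andP[/(P1 _ _ _ pq triv) s1 /(P2 _ _ _ pq triv) s2].
apply: le_lt_trans (_ : L1 * e' + L2 * e' < e); last first.
  by rewrite -mulrDl mulrC /e' mulrAC ltr_pdivrMr// ltr_pM2l//; lra.
apply: le_trans (_ : L1 * \sum_i `|f1 (q' i) - f1 (p' i)| +
  L2 * \sum_i `|f2 (q' i) - f2 (p' i)| <= _); last first.
  by apply: lerD; apply: ler_wpM2l => //; exact: ltW.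
rewrite !mulr_sumr -big_split/=; apply: ler_sum => i _.
by have [? ? ?] := pq i; apply: dom; apply/andP; split; lra.
Qed.

(** Over a length below the [d] attached to the tolerance [1], the function moves by less than [1],
    so each step of the local induction adds [1] to the bound. *)
Lemma abs_continuous_bounded f a b : abs_continuous a b f ->
  exists2 M, 0 <= M & forall t, a <= t <= b -> `|f t| <= M.
Proof.
have [ab|ba] := leP a b; last first.
  by exists 0 => // t /andP[? ?]; exfalso; lra.
move=> acf.
have [d d0 dP] := acf _ (ltr01).
have step u v : a <= u -> u <= v -> v <= b -> v - u < d -> `|f v - f u| < 1.
  move=> au uv vb vu.
  have := dP 1%N (fun=> u) (fun=> v); rewrite !big_ord1; apply => //.
  by apply/trivIsetP => i j _ _; rewrite !ord1 eqxx.
apply: (@real_local_induction _ a b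
    (fun x => exists2 M, 0 <= M & forall t, a <= t <= x -> `|f t| <= M)) => //.
  by exists `|f a| => // t at'; rewrite (@le_anti _ _ t a)// andbC.
move=> x axb; exists (d / 2); first by rewrite divr_gt0.
move=> u v au ux xv vb hu hv [M M0 MP].
exists (M + 1) => [|t /andP[at' tv]]; first by lra.
have [tu|ut] := leP t u; first by apply: le_trans (MP t _) _; [rewrite at'|lra].
have := step u t au (ltW ut); rewrite (le_trans tv vb) => /(_ isT).
have lt_d : t - u < d by lra.
move=> /(_ lt_d) h; have := MP u; rewrite au lexx => /(_ isT) h'.
by rewrite -(subrK (f u) (f t)); apply: le_trans (ler_normD _ _) _; lra.
Qed.

Lemma abs_continuousM f g a b : abs_continuous a b f -> abs_continuous a b g ->
  abs_continuous a b (fun t => f t * g t).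
Proof.
move=> acf acg.
have [M M0 fM] := abs_continuous_bounded acf.
have [N N0 gN] := abs_continuous_bounded acg.
apply: (abs_continuous_dom2 N0 M0 acf acg) => u v /fM fu /gN gv.
have -> : f u * g u - f v * g v = (f u - f v) * g v + f u * (g u - g v) by ring.
apply: le_trans (ler_normD _ _) _; rewrite !normrM.
by apply: lerD; [rewrite mulrC|]; apply: ler_wpM2r.
Qed.

Lemma expR_dist_le (M x y : R) : x <= M -> y <= M ->
  `|expR x - expR y| <= expR M * `|x - y|.
Proof.
wlog yx : x y / y <= x => [H xM yM|xM yM].
  have [/H|/ltW/H] := leP y x; first exact.
  by rewrite distrC (distrC x); exact.
rewrite !ger0_norm ?subr_ge0 ?ler_expR//.
have := expR_ge1Dx (y - x) => h.
have -> : expR x - expR y = expR x * (1 - expR (y - x)).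
  by rewrite mulrBr mulr1 -expRD (addrC x) subrK.
have : expR x <= expR M by rewrite ler_expR.
have := expR_gt0 x.
have : 1 - expR (y - x) <= x - y by lra.
move: (expR x) (expR M) (1 - expR (y - x)) => A B C; nra.
Qed.

Lemma abs_continuous_expR f a b : abs_continuous a b f ->
  abs_continuous a b (expR \o f).
Proof.
move=> acf; have [M M0 fM] := abs_continuous_bounded acf.
apply: (abs_continuous_dom2 (ltW (expR_gt0 M)) (lexx 0) acf acf) => u v /fM fu /fM fv.
rewrite mul0r addr0; apply: expR_dist_le.
  exact: le_trans (ler_norm _) fu.
exact: le_trans (ler_norm _) fv.
Qed.

Lemma abs_continuousB_linear f a b k : abs_continuous a b f ->
  abs_continuous a b (fun t => f t - k * t).
Proof.
move=> acf; have acid : abs_continuous a b (fun t : R => t).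
  move=> e e0; exists e => // n p q pq _; apply: le_lt_trans.
  apply: ler_sum => i _.
  by have [_ pqi _] := pq i; rewrite ger0_norm// subr_ge0.
apply: (abs_continuous_dom2 ler01 (normr_ge0 k) acf acid) => u v _ _.
have -> : f u - k * u - (f v - k * v) = (f u - f v) + (- k) * (u - v) by ring.
by apply: le_trans (ler_normD _ _) _; rewrite normrM normrN mul1r.
Qed.

Lemma abs_continuousN f a b : abs_continuous a b f ->
  abs_continuous a b (fun t => - f t).
Proof.
move=> acf; apply: (abs_continuous_dom2 ler01 (lexx 0) acf acf) => u v _ _.
by rewrite -opprD normrN mul1r mul0r addr0.
Qed.

End AbsContinuousAlgebra.

Section Gauge.
Context {R : realType}.
Notation mu := (@lebesgue_measure R).

(* Integrating factors of [x' = - alpha x] on [a, +oo). *)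
Record gauge (alpha : R -> R) (a : R) (E : R -> R) : Prop := Gauge {
  gauge_gt0 : forall t, 0 < E t ;
  gauge_abs_continuous : forall b, abs_continuous a b E ;
  gauge_bounds : forall b, exists e1 e2, 0 < e1 /\
    forall t, a <= t <= b -> e1 <= E t <= e2 ;
  gauge_derive : {ae mu, forall t, a < t -> is_derive t 1 E (E t * alpha t)} }.

Lemma gauge_exists (alpha : R -> R) (a : R) : loc_integrable alpha ->
  exists E, gauge alpha a E.
Proof.
move=> /(loc_integrable_primitive a)[A acA dA].
exists (expR \o A); split.
- by move=> t; exact: expR_gt0.
- by move=> b; exact: abs_continuous_expR.
- move=> b; have [M M0 AM] := abs_continuous_bounded (acA b).
  exists (expR (- M)), (expR M); split; first exact: expR_gt0.
  by move=> t /AM; rewrite ler_norml !ler_expR.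
- move: dA; apply: filterS; first exact: (ae_filter_ringOfSetsType mu).
  by move=> t + at' => /(_ at') dA; exact: is_derive1_comp.
Qed.

Context {alpha beta : R -> R} {a : R} {E : R -> R}.
Hypothesis gE : gauge alpha a E.
Context {tau : R} {phi : Xsp R} {x : R -> R}.
Hypothesis sx : solves alpha beta tau phi x.
Context {sigma b1 b2 e1 e2 b : R}.
Hypotheses (sigma2 : sigma * sigma = 1) (b10 : 0 < b1) (e10 : 0 < e1).
Hypothesis betab : {ae mu, forall t, a <= t <= b -> b1 <= sigma * beta t <= b2}.
Hypothesis Eb : forall t, a <= t <= b -> e1 <= E t <= e2.

Let acy t0 t k : tau <= t0 -> a <= tau -> t0 <= t ->
  abs_continuous t0 t (fun r => E r * x r - k * r).
Proof.
move=> tt at' t0t; apply: abs_continuousB_linear; apply: abs_continuousM.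
  apply: abs_continuous_sub (gauge_abs_continuous gE t) => //; lra.
have [_ acx _] := sx; apply: abs_continuous_sub (acx t _) => //; lra.
Qed.

(** The gauge cancels the [alpha] term. Since [sigma * sigma = 1], what remains is the delayed
    gauged value with sign [- sigma], times the positive weight
    [w = sigma * beta r * (E r / E (r - 1))]. Subtracting [k * r] prepares the comparison with a
    line of slope [k]. *)
Let derive_y t0 t k : a + 1 <= t0 -> tau <= t0 -> t0 <= t -> t <= b ->
  {ae mu, forall r, t0 <= r <= t ->
    exists2 w, b1 * (e1 / e2) <= w <= b2 * (e2 / e1) &
      is_derive r 1 (fun r => E r * x r - k * r)
        (w * (- sigma * (E (r - 1) * x (r - 1))) - k)}.
Proof.
move=> at0 tt0 t0t tb; have [_ _ dx] := sx; have dE := gauge_derive gE.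
move: betab; apply: filterS2 (filterI dx dE);
  try exact: (ae_filter_ringOfSetsType mu).
move=> r [dxr dEr] br /andP[t0r rt].
have {}dxr := dxr (le_trans tt0 t0r).
have ar : a < r by lra.
have {}dEr := dEr ar.
have /andP[br1 br2] : b1 <= sigma * beta r <= b2 by apply: br; apply/andP; split; lra.
have /andP[Er1 Er2] : e1 <= E r <= e2 by apply: Eb; apply/andP; split; lra.
have /andP[Es1 Es2] : e1 <= E (r - 1) <= e2 by apply: Eb; apply/andP; split; lra.
have e20 : 0 < e2 := lt_le_trans (lt_le_trans e10 Er1) Er2.
have Es0 : 0 < E (r - 1) := lt_le_trans e10 Es1.
have Er0 : 0 < E r := lt_le_trans e10 Er1.
exists (sigma * beta r * (E r / E (r - 1))).
  have h1 : e1 / e2 <= E r / E (r - 1).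
    by apply: ler_pM; rewrite ?invr_ge0 ?lef_pV2 ?posrE// ltW.
  have h2 : E r / E (r - 1) <= e2 / e1.
    by apply: ler_pM; rewrite ?invr_ge0 ?lef_pV2 ?posrE// ltW.
  have h3 : 0 < e1 / e2 by rewrite divr_gt0.
  have b0 := le_trans (ltW b10) br1.
  have h4 := le_trans (ltW h3) h1.
  by apply/andP; split; apply: ler_pM => //; exact: ltW.
have -> : sigma * beta r * (E r / E (r - 1)) * (- sigma * (E (r - 1) * x (r - 1))) - k =
    (E r * (- alpha r * x r - beta r * x (r - 1)) + x r * (E r * alpha r)) - k * 1.
  have -> : sigma * beta r * (E r / E (r - 1)) * (- sigma * (E (r - 1) * x (r - 1))) =
    - (sigma * sigma) * beta r * E r * x (r - 1) * (E (r - 1) / E (r - 1)) by ring.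
  rewrite sigma2 divff ?gt_eqF//; ring.
apply: is_deriveB.
Qed.

(** The lower bound of the weight multiplies [c] and its upper bound multiplies [eps], so the
    estimate holds whatever the sign of [c - eps]. The slack [eps] will absorb the error of
    replacing a wedge value by a finite sum of products; in the upper estimate that error is simply
    added to [c]. *)
Lemma solves_increment_ge t0 t c eps : a + 1 <= tau -> tau <= t0 -> t0 <= t -> t <= b ->
  0 <= c -> 0 <= eps ->
  (forall r, t0 <= r <= t -> c - eps <= - sigma * (E (r - 1) * x (r - 1))) ->
  (b1 * (e1 / e2) * c - b2 * (e2 / e1) * eps) * (t - t0) <= E t * x t - E t0 * x t0.
Proof.
move=> at' tt0 t0t tb c0 eps0 low.
set k := _ - _ * eps.
suff : E t0 * x t0 - k * t0 <= E t * x t - k * t by lra.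
have at1 : a <= tau by lra.
apply: (abs_continuous_nondecreasing t0t (acy k tt0 at1 t0t)).
have at0 : a + 1 <= t0 by lra.
move: (derive_y k at0 tt0 t0t tb).
apply: filterS; first exact: (ae_filter_ringOfSetsType mu).
move=> r D /[dup]tr /D[w /andP[w1 w2] dy]; eexists; last exact: dy.
have := low r tr; set v := - sigma * _ => v1.
have e20 : 0 < e2.
  have /andP[? ?] : e1 <= E t0 <= e2 by apply: Eb; apply/andP; split; lra.
  by apply: (lt_le_trans e10); exact: (@le_trans _ _ (E t0)).
have w0 : 0 <= w by apply: le_trans w1; rewrite mulr_ge0 ?divr_ge0// ltW.
rewrite /k; nra.
Qed.

Lemma solves_increment_le t0 t c : a + 1 <= tau -> tau <= t0 -> t0 <= t -> t <= b ->
  0 <= c ->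
  (forall r, t0 <= r <= t -> - sigma * (E (r - 1) * x (r - 1)) <= c) ->
  E t * x t - E t0 * x t0 <= b2 * (e2 / e1) * c * (t - t0).
Proof.
move=> at' tt0 t0t tb c0 up.
set k := b2 * _ * c.
suff : - (E t0 * x t0 - k * t0) <= - (E t * x t - k * t) by lra.
have at1 : a <= tau by lra.
apply: (abs_continuous_nondecreasing t0t (abs_continuousN (acy k tt0 at1 t0t))).
have at0 : a + 1 <= t0 by lra.
move: (derive_y k at0 tt0 t0t tb).
apply: filterS; first exact: (ae_filter_ringOfSetsType mu).
move=> r D /[dup]tr /D[w /andP[w1 w2] dy]; eexists; last first.
  exact: (is_deriveN dy).
have := up r tr; set v := - sigma * _ => v1.
have e20 : 0 < e2.
  have /andP[? ?] : e1 <= E t0 <= e2 by apply: Eb; apply/andP; split; lra.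
  by apply: (lt_le_trans e10); exact: (@le_trans _ _ (E t0)).
have w0 : 0 <= w by apply: le_trans w1; rewrite mulr_ge0 ?divr_ge0// ltW.
rewrite /k oppr_ge0; nra.
Qed.

End Gauge.

(** * Tensor powers of an operator *)

Section Cube.
Context {R : realType}.

(** Retraction of the line onto [[-1, 0]]. It makes evaluation at a tuple of times total and
    continuous, even when the times leave the window. *)
Definition clamp (x : R) : R := Num.max (-1) (Num.min 0 x).

Lemma clamp_delay (x : R) : clamp x \in delay_itv R.
Proof.
rewrite inE /delay_itv/= in_itv/= /clamp le_max lexx/= ge_max ge_min lexx/= andbT.
by rewrite oppr_le0 ler01.
Qed.

Definition seg_of (x : R) : seg R := exist _ (clamp x) (clamp_delay x).

Lemma val_seg_of (x : R) : \val (seg_of x) = clamp x.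
Proof. by []. Qed.

Lemma clamp_id (x : R) : -1 <= x <= 0 -> clamp x = x.
Proof. by move=> /andP[x1 x0]; rewrite /clamp min_r// max_r. Qed.

Lemma seg_bounds (t : seg R) : -1 <= \val t <= 0.
Proof. by have := set_valP t; rewrite /delay_itv/= in_itv. Qed.

Lemma seg_of_val (t : seg R) : seg_of (\val t) = t.
Proof. by apply/val_inj; rewrite /= clamp_id// seg_bounds. Qed.

Lemma clamp_dist (x y : R) : `|clamp x - clamp y| <= `|x - y|.
Proof.
wlog xy : x y / x <= y => [H|].
  have [/H//|/ltW/H] := leP x y; by rewrite distrC (distrC y).
rewrite [leRHS]distrC [leRHS]ger0_norm ?subr_ge0//.
rewrite ler_norml /clamp /Order.max /Order.min.
case: (ltP 0 x) => ?; case: (ltP 0 y) => ?; rewrite ?ltrN10;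
  by case: (ltP (-1) x) => ?; case: (ltP (-1) y) => ?; apply/andP; split; lra.
Qed.

Context {m : nat}.

(** The topology of the cube is a supremum of initial topologies, not given by a distance; this
    reduces convergence to real coordinates. *)
Lemma cube_cvgP (F : set_system (cube R m)) (t : cube R m) : Filter F ->
  (forall i, (fun u : cube R m => \val (u i) : R) @ F --> (\val (t i) : R)) ->
  F --> t.
Proof.
move=> FF Fi.
apply: (iffRL (@cvg_sup _ _ (fun i : 'I_m => Topological.class (initial_topology
  (fun f : (forall _ : 'I_m, seg R) => f i))) F t FF)) => i A.
rewrite nbhsE /= => -[B [[V oV VB] Bt] BA].
apply: filterS BA _; rewrite -VB.
move: oV => [W oW WV].
have : nbhs (\val (t i)) W.
  by apply: open_nbhs_nbhs; split => //; move: Bt; rewrite -VB -WV.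
move=> /(Fi i) FW.
apply: (@filterS _ F _ ((fun u : cube R m => \val (u i)) @^-1` W)) => // u.
by rewrite /= -WV.
Qed.

Lemma cube_coord_cvg (t : cube R m) i :
  (fun u : cube R m => \val (u i) : R) @ t --> (\val (t i) : R).
Proof.
exact: (@continuous_comp (cube R m) (seg R) R^o (proj i) (\val) t
  (@proj_continuous 'I_m (fun=> seg R) i t)
  (@initial_continuous (seg R) R^o set_val (t i))).
Qed.

(** The boxes around [t] generate a filter that converges to [t] coordinatewise, hence converges,
    hence contains every neighbourhood. *)
Lemma cube_nbhsP (t : cube R m) (A : set (cube R m)) : nbhs t A ->
  exists2 d, 0 < d & forall u : cube R m,
    (forall i, `|\val (t i) - \val (u i)| < d) -> A u.
Proof.
move=> tA.
pose box (d : R) := [set u : cube R m | forall i, `|\val (t i) - \val (u i)| < d].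
pose F := filter_from [set d : R | 0 < d] box.
have FF : Filter F.
  apply: filter_from_filter; first by exists 1 => /=.
  move=> i j /= i0 j0; exists (Num.min i j); first by rewrite /= lt_min i0.
  by move=> u ui; split=> k; have := ui k; rewrite lt_min => /andP[].
have : F A.
  apply: (@cube_cvgP F t) => // i.
  by apply/cvgrPdist_lt => e e0; exists e => // u ue; exact: ue.
by move=> [d d0 dA]; exists d.
Qed.

(** Heine-Cantor, by the near-covering form of compactness, with boxes in the role of balls. *)
Lemma unif_continuous_cube (f : Xtens R m) (e : R) : 0 < e ->
  exists2 d, 0 < d & forall u v : cube R m,
    (forall i, `|\val (u i) - \val (v i)| < d) -> `|f u - f v| < e.
Proof.
move=> e0; have e2 : 0 < e / 2 by rewrite divr_gt0.
pose P (d : R) (u : cube R m) := forall v : cube R m,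
  (forall i, `|\val (u i) - \val (v i)| < d) -> `|f u - f v| < e.
have : \forall d \near (0 : R)^'+, [set: cube R m] `<=` P d.
  apply: (iffLR (compact_near_coveringP _) (@cube_compact R m)) => t _.
  have /cvgrPdist_lt/(_ _ e2)/cube_nbhsP[d d0 dP] := @csp_continuous R _ _ f t.
  have d2 : 0 < d / 2 by rewrite divr_gt0.
  near=> u d'.
  have tu : forall i, `|\val (t i) - \val (u i)| < d / 2.
    near: u; apply: filter_forall => i.
    by have /cvgrPdist_lt/(_ _ d2) := @cube_coord_cvg t i.
  have d'd : d' < d / 2 by near: d'; exact: nbhs_right_lt.
  move=> v /= uv.
  have fu : `|f t - f u| < e / 2.
    by apply: dP => i; apply: lt_trans (tu i) _; lra.
  have fv : `|f t - f v| < e / 2.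
    apply: dP => i; rewrite -(subrKA (\val (u i))).
    apply: le_lt_trans (ler_normD _ _) _.
    by have := tu i; have := uv i; lra.
  rewrite -(subrKA (f t)); apply: le_lt_trans (ler_normD _ _) _.
  by rewrite (distrC (f u)); lra.
move=> [d /= d0 dP]; exists (d / 2); first by rewrite divr_gt0.
move=> u v; apply: (dP (d / 2)) => //=.
  by rewrite sub0r normrN gtr0_norm ?divr_gt0//; lra.
by rewrite divr_gt0.
Unshelve. all: by end_near. Qed.

End Cube.

Section ContinuousAlgebra.
Context {R : realType} {T : topologicalType}.
Implicit Types f g : T -> R^o.

Lemma csp_ctsD f g : continuous f -> continuous g ->
  continuous (fun t => f t + g t : R^o).
Proof. by move=> cf cg t; apply: cvgD; [exact: cf|exact: cg]. Qed.

Lemma csp_ctsB f g : continuous f -> continuous g ->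
  continuous (fun t => f t - g t : R^o).
Proof. by move=> cf cg t; apply: cvgB; [exact: cf|exact: cg]. Qed.

Lemma csp_ctsM f g : continuous f -> continuous g ->
  continuous (fun t => f t * g t : R^o).
Proof. by move=> cf cg t; apply: cvgM; [exact: cf|exact: cg]. Qed.

Lemma csp_cts_norm f : continuous f -> continuous (fun t => `|f t| : R^o).
Proof. by move=> cf t; apply: cvg_norm; exact: cf. Qed.

End ContinuousAlgebra.

Section TensorSums.
Context {R : realType} {m : nat}.
Implicit Types (s : seq (R * ('I_m -> Xsp R))) (A : Xsp R -> Xsp R).
Implicit Types (C : Xtens R m -> Xtens R m) (t : cube R m).

Definition tsum s : Xtens R m := \sum_(p <- s) p.1 *: tens p.2.

Definition tmap A s := [seq (p.1, fun i => A (p.2 i)) | p <- s].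

Lemma csp_sumE (T : topologicalType) (cT : compact [set: T]) (I : Type)
    (r : seq I) (f : I -> csp R cT) (x : T) :
  (\sum_(i <- r) f i) x = \sum_(i <- r) f i x.
Proof.
elim: r => [|i r IH]; first by rewrite !big_nil.
by rewrite !big_cons -IH.
Qed.

Lemma tsumE s t : tsum s t = \sum_(p <- s) p.1 * \prod_i p.2 i (t i).
Proof. by rewrite /tsum csp_sumE. Qed.

Section Linear.
Context {V W : normedModType R} (A : V -> W) (lA : linear A).

Lemma linear_fun0 : A 0 = 0.
Proof. by have := lA (-1) 0 0; rewrite !scaleN1r addr0 oppr0 addNr. Qed.

Lemma linear_funB u v : A (u - v) = A u - A v.
Proof. by rewrite -(scaleN1r v) addrC lA scaleN1r addrC. Qed.

Lemma linear_fun_sum (I : Type) (r : seq I) (a : I -> R) (f : I -> V) :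
  A (\sum_(i <- r) a i *: f i) = \sum_(i <- r) a i *: A (f i).
Proof.
elim: r => [|i r IH]; first by rewrite !big_nil linear_fun0.
by rewrite !big_cons lA IH.
Qed.

End Linear.

Lemma tensor_power_tsum A C s : is_tensor_power A C -> C (tsum s) = tsum (tmap A s).
Proof.
move=> [[lC _] CA]; rewrite /tsum linear_fun_sum// big_map.
by apply: eq_bigr => p _; rewrite CA.
Qed.

Definition upd (t : cube R m) (k : 'I_m) (x : seg R) : cube R m :=
  fun i => if i == k then x else t i.

(* The tensor sum as a function of its k-th variable only. *)
Definition slice s (k : 'I_m) (t : cube R m) : Xsp R :=
  \sum_(p <- s) (p.1 * \prod_(i | i != k) p.2 i (t i)) *: p.2 k.

Lemma sliceE s k t x : slice s k t x = tsum s (upd t k x).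
Proof.
rewrite csp_sumE tsumE; apply: eq_bigr => p _.
rewrite [RHS](_ : _ = p.1 * (p.2 k x * \prod_(i | i != k) p.2 i (t i))).
  by rewrite -[LHS]/(p.1 * _ * p.2 k x) -mulrA (mulrC (p.2 k x)).
congr (_ * _); rewrite (bigD1 k)//= /upd eqxx; congr (_ * _).
by apply: eq_bigr => i /negbTE ->.
Qed.

Lemma upd_id t k : upd t k (t k) = t.
Proof. by apply/funext => i; rewrite /upd; case: eqP => // ->. Qed.

(** Interpolates between [s] and [tmap A s] by transforming only the first [k] factors. *)
Definition tmapk A (k : nat) s :=
  [seq (p.1, fun i : 'I_m => if (i < k)%N then A (p.2 i) else p.2 i) | p <- s].

Lemma tmapk_step A s (k : 'I_m) t : linear A ->
  tsum (tmapk A k.+1 s) t = A (slice (tmapk A k s) k t) (t k).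
Proof.
move=> lA; rewrite -{1}(upd_id t k) -sliceE /slice linear_fun_sum// !big_map !csp_sumE.
apply: eq_bigr => p _ /=; rewrite ltnS leqnn ltnn.
congr (_ * _); congr (_ * _); apply: eq_bigr => i ik.
by rewrite ltnS leq_eqVlt -val_eqE in ik *; rewrite (negbTE ik).
Qed.

(** The factors are transformed one at a time. A slice of a sum has norm at most that of the sum, so
    each of the [m] replacements costs one factor [M], whatever the representation [s]. *)
Lemma tsum_tmap_norm A M s : linear A -> 0 <= M ->
  (forall f, `|A f| <= M * `|f|) -> `|tsum (tmap A s)| <= M ^+ m * `|tsum s|.
Proof.
move=> lA M0 AM.
suff H k : (k <= m)%N -> `|tsum (tmapk A k s)| <= M ^+ k * `|tsum s|.
  have := H m (leqnn m); congr (`| tsum _ | <= _).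
  by apply: eq_map => p; congr pair; apply/funext => i; rewrite ltn_ord.
elim: k => [_|k IH km].
  rewrite expr0 mul1r; have -> : tmapk A 0 s = s => //.
  by rewrite -[RHS]map_id; apply: eq_map => -[].
apply: csp_norm_le => [|t]; first by rewrite mulr_ge0 ?exprn_ge0.
rewrite (tmapk_step s (Ordinal km))//= exprS -mulrA.
apply: le_trans (csp_norm_ge _ _) _; apply: le_trans (AM _) _.
apply: ler_wpM2l => //; apply: le_trans (IH (ltnW km)).
apply: csp_norm_le => // x; rewrite sliceE; exact: csp_norm_ge.
Qed.

(** Tent functions centred at [N + 1] equidistant nodes, divided by their sum, form a partition of
    unity [psi] of the segment; products of them form one of the cube, indexed by the maps [J]. The
    approximant takes the value of [f] at the node of [J], and only nodes within [d] of [t]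
    contribute. *)
Lemma tsum_dense (f : Xtens R m) (e : R) : 0 < e ->
  exists s, `|f - tsum s| <= e.
Proof.
move=> e0; have [d d0 dP] := unif_continuous_cube f e0.
pose N := (Num.truncn d^-1).+1.
have N0 : 0 < N%:R :> R by rewrite ltr0n.
have Nd : N%:R^-1 < d by rewrite invf_plt ?posrE// truncnS_gt.
pose y (x : seg R) : R := N%:R * (\val x + 1).
pose h (j : nat) (x : seg R) : R^o := Num.max 0 (1 - `|y x - j%:R|).
have hge0 j x : 0 <= h j x by rewrite /h le_max lexx.
have hsupp j x : h j x != 0 -> `|\val x - (j%:R / N%:R - 1)| < d.
  move=> hj; have {hj} h1 : `|y x - j%:R| < 1.
    by rewrite ltNge; apply: contra hj => h1; rewrite /h max_l// subr_le0.
  rewrite (_ : _ - _ = N%:R^-1 * (y x - j%:R)); last first.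
    by rewrite /y; field; rewrite gt_eqF.
  rewrite normrM gtr0_norm ?invr_gt0//; apply: lt_trans Nd.
  by rewrite gtr_pMr ?invr_gt0//; lra.
pose S x : R^o := \sum_(j < N.+1) h j x.
have S0 x : 0 < S x.
  have /andP[x1 x2] := seg_bounds x.
  have y0 : 0 <= y x by apply: mulr_ge0; [exact: ltW|lra].
  have yN : y x <= N%:R by rewrite /y ger_pMr//; lra.
  (* The tent at the node just left of [x] is positive at [x], so the denominator [S x] does not
     vanish. *)
  have jN : (Num.truncn (y x) < N.+1)%N by rewrite ltnS truncn_le_nat -natr1; lra.
  rewrite /S (bigD1 (Ordinal jN))//=; rewrite ltr_pwDl//;
    last by apply: sumr_ge0 => j _; exact: hge0.
  rewrite /h lt_max; apply/orP; right; rewrite subr_gt0.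
  have /andP[h1 h2] := truncn_itv y0; rewrite -natr1 in h2.
  by rewrite ger0_norm ?subr_ge0//; lra.
have cval : continuous (fun x : seg R => \val x : R^o).
  by move=> x; exact: initial_continuous.
have cc (a : R) : continuous (fun _ : seg R => a : R^o) by exact: cst_continuous.
have hc j : continuous (h j).
  have -> : h j = fun x => 2^-1 * (1 - `|y x - j%:R| + `|1 - `|y x - j%:R| |).
    by apply/funext => x; rewrite /h maxr_absE mulrC add0r sub0r normrN.
  have c1 := csp_ctsB (cc 1) (csp_cts_norm (csp_ctsB
    (csp_ctsM (cc N%:R) (csp_ctsD cval (cc 1))) (cc j%:R))).
  exact (csp_ctsM (cc 2^-1) (csp_ctsD c1 (csp_cts_norm c1))).
have Sc : continuous S.
  rewrite /S; elim: (index_enum _) => [|j r IH].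
    have -> : (fun x => \sum_(j <- [::]) h (j : 'I_N.+1) x : R^o) = cst 0.
      by apply/funext => x; rewrite big_nil.
    exact: cst_continuous.
  have -> : (fun x => \sum_(j <- j :: r) h j x : R^o) =
      fun x => h j x + \sum_(j <- r) h j x.
    by apply/funext => x; rewrite big_cons.
  exact (csp_ctsD (hc j) IH).
have psic (j : 'I_N.+1) : (fun x => h j x / S x : R^o) \in cts.
  apply/ctsP; have SVc : continuous (fun x => (S x)^-1 : R^o).
    by move=> x; apply: (cvgV (lt0r_neq0 (S0 x)) (Sc x)).
  exact (csp_ctsM (hc j) SVc).
pose psi j : Xsp R := CSp _ (psic j).
have psi1 x : \sum_j psi j x = 1.
  transitivity ((S x : R) / S x); first by rewrite [RHS]mulr_suml.
  by rewrite divff// lt0r_neq0.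
pose node (J : {ffun 'I_m -> 'I_N.+1}) : cube R m :=
  fun i => seg_of ((J i)%:R / N%:R - 1).
exists [seq (f (node J), fun i => psi (J i)) | J <- index_enum {ffun 'I_m -> 'I_N.+1}].
apply: csp_norm_le => [|t]; first exact: ltW.
rewrite -[X in `|X|]/(f t - tsum _ t) tsumE big_map.
have sum1 : \sum_(J : {ffun 'I_m -> 'I_N.+1}) \prod_i psi (J i) (t i) = 1.
  rewrite -(bigA_distr_bigA (fun (i : 'I_m) j => psi j (t i))).
  by apply: big1 => i _.
have spread (a : R) : a = \sum_(J : {ffun 'I_m -> 'I_N.+1}) a * \prod_i psi (J i) (t i).
  by rewrite -mulr_sumr sum1 mulr1.
rewrite (spread (f t)) -sumrB.
apply: le_trans (ler_norm_sum _ _ _) _.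
rewrite [leRHS]spread; apply: ler_sum => J _.
rewrite -[X in `|_ - X|]/(f (node J) * \prod_i psi (J i) (t i)) -mulrBl normrM.
have p0 : 0 <= \prod_i psi (J i) (t i).
  by apply: prodr_ge0 => i _; rewrite /= divr_ge0// ltW.
rewrite (ger0_norm p0).
have [->|pn0] := eqVneq (\prod_i psi (J i) (t i)) 0; first by rewrite !mulr0.
apply: ler_wpM2r => //; apply/ltW/dP => i.
have : psi (J i) (t i) != 0 by move/prodf_neq0 : pn0 => /(_ i isT).
rewrite /= mulf_eq0 negb_or => /andP[/hsupp + _].
rewrite clamp_id//; have jN := ltn_ord (J i).
have j0 : 0 <= (J i)%:R / N%:R :> R by rewrite divr_ge0.
have j1 : (J i)%:R / N%:R <= 1 :> R by rewrite ler_pdivrMr// mul1r ler_nat.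
by apply/andP; split; lra.
Qed.

End TensorSums.

(** Telescoping, one factor exchanged at a time; [1 <= K] allows the shorter products to be bounded
    by the same power of [K]. *)
Lemma prod_dist_le (R : realType) (I : Type) (r : seq I) (a b : I -> R) (K d : R) :
  1 <= K -> 0 <= d -> (forall i, `|a i| <= K) -> (forall i, `|b i| <= K) ->
  (forall i, `|a i - b i| <= d) ->
  `|\prod_(i <- r) a i - \prod_(i <- r) b i| <= (size r)%:R * K ^+ size r * d.
Proof.
move=> K1 d0 aK bK ab.
have K0 : 0 <= K by lra.
have prodK (c : I -> R) (s : seq I) : (forall i, `|c i| <= K) ->
    `|\prod_(i <- s) c i| <= K ^+ size s.
  move=> cK; elim: s => [|i s IH]; first by rewrite big_nil expr0 normr1.
  by rewrite big_cons normrM exprS; apply: ler_pM.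
elim: r => [|i r IH]; first by rewrite !big_nil subrr normr0 !mul0r.
rewrite !big_cons /=.
set p := \prod_(j <- r) a j; set q := \prod_(j <- r) b j.
have -> : a i * p - b i * q = (a i - b i) * p + b i * (p - q) by ring.
apply: le_trans (ler_normD _ _) _; rewrite !normrM.
have h1 : `|a i - b i| * `|p| <= d * K ^+ size r by apply: ler_pM => //; exact: prodK.
have h2 : `|b i| * `|p - q| <= K * ((size r)%:R * K ^+ size r * d) by apply: ler_pM.
apply: le_trans (lerD h1 h2) _.
rewrite exprS -natr1.
have : K ^+ size r <= K * K ^+ size r by rewrite ler_peMl// exprn_ge0.
move: (K ^+ size r) ((size r)%:R) => Ks n KKs; nra.
Qed.

Section TensorPowerTheory.
Context {R : realType} {m : nat}.
Implicit Types (s : seq (R * ('I_m -> Xsp R))) (A : Xsp R -> Xsp R).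
Implicit Types (C : Xtens R m -> Xtens R m).

Lemma bounded_operator_bound (V W : normedModType R) (A : V -> W) :
  bounded_operator A -> exists2 M, 1 <= M & forall v, `|A v| <= M * `|v|.
Proof.
move=> [_ [M AM]]; exists (Num.max 1 M); first by rewrite le_max lexx.
move=> v; apply: le_trans (AM v) _; apply: ler_wpM2r => //.
by rewrite le_max lexx orbT.
Qed.

(** Being a tensor power only provides some bound for [C]. This one depends on the bound of [A]
    alone, which yields bounds uniform in the two times of a process. The estimate holds on finite
    sums, and the a priori bound [K] carries it to their limits. *)
Lemma tensor_power_norm A C M : is_tensor_power A C -> linear A -> 0 <= M ->
  (forall f, `|A f| <= M * `|f|) -> forall f, `|C f| <= M ^+ m * `|f|.
Proof.
move=> hAC lA M0 AM f; have [bC _] := hAC; have [lC _] := bC.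
have [K K1 CK] := bounded_operator_bound bC.
apply/ler_addgt0Pr => e e0.
have Mm := exprn_ge0 m M0.
(* The approximation error [d] enters twice: through [C] with factor [K], and through the norm of
   the finite sum with factor [M ^+ m]. *)
pose d := e / (K + M ^+ m).
have p : 0 < K + M ^+ m by lra.
have d0 : 0 < d by rewrite divr_gt0.
have [s fs] := tsum_dense f d0.
have -> : C f = C (f - tsum s) + C (tsum s) by rewrite (linear_funB lC) subrK.
apply: le_trans (ler_normD _ _) _.
have h1 : `|C (f - tsum s)| <= K * d by apply: le_trans (CK _) _; apply: ler_wpM2l => //; lra.
have h2 : `|C (tsum s)| <= M ^+ m * `|tsum s|.
  by rewrite (tensor_power_tsum _ hAC); exact: tsum_tmap_norm.
have h3 : `|tsum s| <= `|f| + d.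
  rewrite -[tsum s](subKr f); apply: le_trans (ler_normB _ _) _; lra.
have h4 : M ^+ m * `|tsum s| <= M ^+ m * (`|f| + d) by exact: ler_wpM2l.
have h5 : (K + M ^+ m) * d = e by rewrite /d mulrC divfK// gt_eqF.
move: (M ^+ m) h2 h4 h5 => Mm'; nra.
Qed.

Lemma bounded_operator_ext C C' : bounded_operator C -> bounded_operator C' ->
  (forall s, C (tsum s) = C' (tsum s)) -> forall f, C f = C' f.
Proof.
move=> bC bC' CC' f; have [lC _] := bC; have [lC' _] := bC'.
have [K K1 CK] := bounded_operator_bound bC.
have [K' K'1 CK'] := bounded_operator_bound bC'.
apply/eqP; rewrite -subr_eq0 -normr_le0; apply/ler_addgt0Pr => e e0.
have p : 0 < K + K' by lra.
have [s fs] := tsum_dense f (divr_gt0 e0 p).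
have -> : C f - C' f = C (f - tsum s) - C' (f - tsum s).
  by rewrite (linear_funB lC) (linear_funB lC') CC' opprB addrA subrK.
apply: le_trans (ler_normB _ _) _; apply: le_trans (lerD (CK _) (CK' _)) _.
rewrite -mulrDl add0r; apply: le_trans (ler_wpM2l (ltW p) fs) _.
by rewrite mulrC divfK// gt_eqF.
Qed.

Lemma tensor_power_id : is_tensor_power (m := m) (fun f : Xsp R => f) (fun f => f).
Proof.
by split => //; split; [move=> ? ? ?|exists 1 => f; rewrite mul1r].
Qed.

Lemma tensor_power_comp A B C D : is_tensor_power A C -> is_tensor_power B D ->
  is_tensor_power (A \o B) (C \o D).
Proof.
move=> [[lC [K CK]] hAC] [[lD [L DL]] hBD]; split; last by move=> phi /=; rewrite hBD hAC.
split; first by move=> a u v /=; rewrite lD lC.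
have [K' K'1 CK'] := bounded_operator_bound (conj lC (ex_intro _ K CK)).
have [L' L'1 DL'] := bounded_operator_bound (conj lD (ex_intro _ L DL)).
exists (K' * L') => f /=; apply: le_trans (CK' _) _.
by rewrite -mulrA; apply: ler_wpM2l (DL' _); lra.
Qed.

(** Two bounded operators that agree on the dense finite sums agree. This transfers the process laws
    from [U] to [W]. *)
Lemma tensor_power_uniq A B C D : is_tensor_power A C -> is_tensor_power B D ->
  A =1 B -> C =1 D.
Proof.
move=> hAC hBD AB; apply: bounded_operator_ext; [exact: hAC.1|exact: hBD.1|].
move=> s; rewrite (tensor_power_tsum _ hAC) (tensor_power_tsum _ hBD).
by congr tsum; apply: eq_map => p; congr pair; apply/funext => i.
Qed.

Section Convergence.
Context {I : Type} {F : set_system I} {FF : Filter F}.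
Context {A_ : I -> Xsp R -> Xsp R} {A : Xsp R -> Xsp R}.
Context {C_ : I -> Xtens R m -> Xtens R m} {C : Xtens R m -> Xtens R m}.
Hypothesis cA : forall f, A_ i f @[i --> F] --> A f.

Lemma tens_cvg (phi : 'I_m -> Xsp R) :
  tens (fun k => A_ i (phi k)) @[i --> F] --> tens (fun k => A (phi k)).
Proof.
(* [K] bounds the factors of the limit with room [1] to spare, so it also bounds all factors at
   distance at most [1] from them. *)
pose K := 1 + \sum_k (`|A (phi k)| + 1).
have K1 : 1 <= K by rewrite lerDl; apply: sumr_ge0 => k _; rewrite addr_ge0.
have AK k : `|A (phi k)| + 1 <= K.
  rewrite /K (bigD1 k)//= [leRHS]addrCA lerDl addr_ge0//.
  by apply: sumr_ge0 => j _; rewrite addr_ge0.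
apply/cvgrPdist_le => e e0.
pose c := m%:R * K ^+ m + 1.
have c0 : 0 < c by rewrite ltr_pwDr// mulr_ge0// exprn_ge0//; lra.
pose d := Num.min 1 (e / c).
have d0 : 0 < d by rewrite lt_min ltr01 divr_gt0.
have : \forall i \near F, forall k, `|A (phi k) - A_ i (phi k)| <= d.
  apply: filter_forall => k.
  by have /cvgrPdist_le := @cA (phi k); apply.
apply: filterS => i dk.
have K0 k : `|A (phi k)| <= K by have := AK k; lra.
have Ki k : `|A_ i (phi k)| <= K.
  rewrite -(subKr (A (phi k)) (A_ i (phi k))); apply: le_trans (ler_normB _ _) _.
  have := AK k; have := dk k; have : d <= 1 by rewrite ge_min lexx.
  lra.
apply: csp_norm_le => [|t]; first exact: ltW.
have := @prod_dist_le R 'I_m (index_enum _) (fun k => A (phi k) (t k))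
  (fun k => A_ i (phi k) (t k)) K d K1 (ltW d0).
move=> /(_ (fun k => le_trans (csp_norm_ge _ _) (K0 k))).
move=> /(_ (fun k => le_trans (csp_norm_ge _ _) (Ki k))).
move=> /(_ (fun k => le_trans (csp_norm_ge (A (phi k) - A_ i (phi k)) _) (dk k))).
move/le_trans; apply.
have -> : size (index_enum 'I_m) = m by rewrite /index_enum -enumT size_enum_ord.
have de : d <= e / c by rewrite ge_min lexx orbT.
have mK : 0 <= m%:R * K ^+ m by rewrite mulr_ge0// exprn_ge0//; lra.
apply: le_trans (ler_wpM2l mK de) _.
rewrite mulrCA ger_pMr// ler_pdivrMr// mul1r /c; lra.
Qed.

Lemma tsum_cvg s : tsum (tmap (A_ i) s) @[i --> F] --> tsum (tmap A s).
Proof.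
elim: s => [|p s IH].
  rewrite /tmap /tsum /= big_nil.
  exact: cvg_cst.
rewrite /tmap /tsum /= big_cons; under eq_fun do rewrite big_cons.
by apply: cvgD => //; apply: cvgZl_tmp; exact: tens_cvg.
Qed.

(** Strong convergence on a dense set, together with the uniform bound [M ^+ m], is strong
    convergence everywhere. *)
Lemma tensor_power_cvg M : 0 <= M -> is_tensor_power A C ->
  (\forall i \near F, is_tensor_power (A_ i) (C_ i) /\ linear (A_ i) /\
     forall f, `|A_ i f| <= M * `|f|) ->
  forall f, C_ i f @[i --> F] --> C f.
Proof.
move=> M0 hAC AM f; have [bC _] := hAC; have [lC _] := bC.
have [K K1 CK] := bounded_operator_bound bC.
have Mm := exprn_ge0 m M0.
apply/cvgrPdist_le => e e0.
have p : 0 < K + M ^+ m by lra.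
have e2 : 0 < e / 2 by rewrite divr_gt0.
have [s fs] := tsum_dense f (divr_gt0 e2 p).
have /cvgrPdist_le/(_ _ e2) := @tsum_cvg s.
apply: filterS2 AM => i [ACi [lAi AMi]] As.
have [[lCi _] _] := ACi.
have CMi := tensor_power_norm ACi lAi M0 AMi.
have -> : C f - C_ i f = C (f - tsum s) - C_ i (f - tsum s) + (C (tsum s) - C_ i (tsum s)).
  rewrite (linear_funB lC) (linear_funB lCi).
  by rewrite [RHS]addrAC subrKA opprB subrKA.
apply: le_trans (ler_normD _ _) _.
rewrite [leRHS]splitr; apply: lerD; last first.
  by rewrite (tensor_power_tsum _ hAC) (tensor_power_tsum _ ACi).
apply: le_trans (ler_normB _ _) _; apply: le_trans (lerD (CK _) (CMi _)) _.
rewrite -mulrDl; apply: le_trans (ler_wpM2l (ltW p) fs) _.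
by rewrite mulrC divfK// gt_eqF.
Qed.

End Convergence.

End TensorPowerTheory.

(** * Continuity in time of the wedge process *)

Section ProcessContinuity.
Context {R : realType} {Y : completeNormedModType R}.
Context {V : R -> R -> Y -> Y}.
Hypothesis pV : linear_process V.

(** Composition with the retraction [(t, tau) -> (max t tau, tau)] onto the half-plane where the
    process is meaningful turns relative continuity into continuity on the whole plane. *)
Lemma process_clamp_continuous (y : Y) :
  continuous (fun p : R * R => V (Num.max p.1 p.2) p.2 y).
Proof.
move=> p A /= nA.
pose rho (q : R * R) : R * R := (Num.max q.1 q.2, q.2).
have Drho q : (rho q).2 <= (rho q).1 by rewrite /= le_max lexx orbT.
have crho : rho @ p --> rho p.
  have c1 : (fun q : R * R => q.1 : R^o) @ p --> p.1 by exact: cvg_fst.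
  have c2 : (fun q : R * R => q.2 : R^o) @ p --> p.2 by exact: cvg_snd.
  have c3 : (fun q : R * R => Num.max q.1 q.2 : R^o) @ p --> Num.max p.1 p.2.
    exact: (@continuous_max R (R * R)%type (fun q => q.1) (fun q => q.2) p c1 c2).
  exact: (cvg_pair c3 c2).
have /subspace_continuousP/(_ (rho p) (Drho p)) := @process_continuous _ _ _ pV y.
move=> /(_ A nA) /crho; apply: (@filterS _ (nbhs p)) => q /=; apply; exact: Drho.
Qed.

(** Banach-Steinhaus over a compact box around [p0]: for fixed [y] the values form a compact, hence
    bounded, set. *)
Lemma process_locally_bounded (p0 : R * R) :
  exists2 M, 1 <= M & \forall p \near p0, p.2 <= p.1 ->
    forall f, `|V p.1 p.2 f| <= M * `|f|.
Proof.
pose B : set (R * R) := `[p0.1 - 1, p0.1 + 1]%classic `*` `[p0.2 - 1, p0.2 + 1]%classic.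
have cB : compact B by apply: compact_setX; exact: segment_compact.
pose G := [set V (Num.max p.1 p.2) p.2 | p in B].
have [||M GM] := @Banach_Steinhauss R Y Y G _ _ 1.
- move=> _ [p Bp <-].
  have /(process_bounded pV)[lV [M VM]] : p.2 <= Num.max p.1 p.2.
    by rewrite le_max lexx orbT.
  split=> // r; exists (`|M| * `|r|) => y yr; apply: le_trans (VM y) _.
  apply: le_trans (ler_wpM2r (normr_ge0 y) (ler_norm M)) _.
  by apply: ler_wpM2l => //; apply: le_trans yr (ler_norm _).
- move=> y.
  have /compact_bounded[M [_ MP]] : compact [set V (Num.max p.1 p.2) p.2 y | p in B].
    apply: (@continuous_compact _ _ (fun p : R * R => V (Num.max p.1 p.2) p.2 y)) => //.
    exact/continuous_subspaceT/process_clamp_continuous.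
  exists (M + 1) => _ [p Bp <-]; apply: (MP (M + 1)); first by rewrite ltrDl.
  by exists p.
exists (Num.max 1 M); first by rewrite le_max lexx.
have : \forall p \near p0, B p.
  near=> p; split; rewrite /= in_itv/=.
    suff : `|p0.1 - p.1| < 1 by rewrite ltr_norml => /andP[? ?]; apply/andP; split; lra.
    near: p; have /cvgrPdist_lt : (fun q : R * R => q.1 : R^o) @ p0 --> p0.1.
      exact: cvg_fst.
    by apply.
  suff : `|p0.2 - p.2| < 1 by rewrite ltr_norml => /andP[? ?]; apply/andP; split; lra.
  near: p; have /cvgrPdist_lt : (fun q : R * R => q.2 : R^o) @ p0 --> p0.2.
    exact: cvg_snd.
  by apply.
apply: filterS => p Bp pD f.
have [lV _] := process_bounded pV pD.
have [->|f0] := eqVneq f 0; first by rewrite (linear_fun0 lV) !normr0 mulr0.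
have nf0 : 0 < `|f| by rewrite normr_gt0.
have := GM (V p.1 p.2) _ (`|f|^-1 *: f).
rewrite -[V p.1 p.2 (_ *: _)]addr0 -(linear_fun0 lV).
have -> : V p.1 p.2 (`|f|^-1 *: f) + V p.1 p.2 0 = `|f|^-1 *: V p.1 p.2 f.
  by rewrite (linear_fun0 lV) addr0 -[_ *: f]addr0 lV (linear_fun0 lV) addr0.
rewrite !normrZ normfV normr_id mulVf ?gt_eqF// lexx => /(_ _ isT) h.
rewrite -ler_pdivrMr// mulrC; apply: le_trans (h _) _; last by rewrite le_max lexx orbT.
by exists p => //; rewrite max_l.
Unshelve. all: by end_near. Qed.

End ProcessContinuity.

Section WedgeProcess.
Context {R : realType} {m : nat}.
Context {U : R -> R -> Xsp R -> Xsp R} {W : R -> R -> wedge R m -> wedge R m}.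
Hypothesis pU : linear_process U.
Hypothesis UW : forall t tau : R, tau <= t -> is_wedge_power (U t tau) (W t tau).

Lemma process_linear t tau : tau <= t -> linear (U t tau).
Proof. by move=> /(process_bounded pU)[]. Qed.

Lemma wedge_normE (f : wedge R m) : `|f| = `|wedge_val f|.
Proof. by []. Qed.

(** The identity and composition laws follow from uniqueness of tensor powers, joint continuity from
    the local bound on [U] and strong convergence of tensor powers. *)
Lemma wedge_linear_process : linear_process W.
Proof.
split.
- move=> t tau /UW[C [[lC [M CM]] _] WC]; split.
    by move=> a u v; apply/val_inj; rewrite /= !WC /= lC.
  by exists M => f; rewrite !wedge_normE WC.
- move=> tau f; have [C tC WC] := UW (lexx tau); apply/val_inj; rewrite /= WC.
  apply: (tensor_power_uniq tC tensor_power_id) => phi; exact: (process_id pU).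
- move=> t s tau f taus st; have [C tC WC] := UW st; have [D tD WD] := UW taus.
  have [E tE WE] := UW (le_trans taus st); apply/val_inj; rewrite /= WC WD WE.
  apply: (tensor_power_uniq (tensor_power_comp tC tD) tE) => phi /=.
  exact: (process_comp pU).
- move=> f; apply/subspace_continuousP => p0 p0D.
  (* A tensor power is chosen at every pair of times, with the dummy value [id] where the pair is
     not admissible. *)
  have ex (p : R * R) : exists C : Xtens R m -> Xtens R m, p.2 <= p.1 ->
      is_tensor_power (U p.1 p.2) C /\
      forall g : wedge R m, wedge_val (W p.1 p.2 g) = C (wedge_val g).
    have [/UW[C tC WC]|pD] := leP p.2 p.1; first by exists C.
    by exists id => h; exfalso; lra.
  have [C CP] := choice ex.
  have [M M1 bM] := process_locally_bounded pU p0.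
  pose F := within [set p : R * R | p.2 <= p.1] (nbhs p0).
  have cU phi : U p.1 p.2 phi @[p --> F] --> U p0.1 p0.2 phi.
    by have /subspace_continuousP := @process_continuous _ _ _ pU phi; apply.
  have M0 : 0 <= M by lra.
  have := @tensor_power_cvg R m _ F _ (fun p => U p.1 p.2) (U p0.1 p0.2) C (C p0)
    cU M M0 (CP p0 p0D).1.
  have near : \forall p \near F, is_tensor_power (U p.1 p.2) (C p) /\
      linear (U p.1 p.2) /\ forall g, `|U p.1 p.2 g| <= M * `|g|.
    apply: filterS bM => p bMp pD; split; first exact: (CP p pD).1.
    by split; [exact: process_linear|exact: bMp].
  have FF : Filter F by exact: within_filter.
  move=> /(_ FF near (wedge_val f)) /cvgrPdist_le cC.
  have FD : F [set p : R * R | p.2 <= p.1] by exact: withinT.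
  apply/cvgrPdist_le => e /cC h; apply: (@filterS2 _ F FF _ _ _ _ h FD) => p H pD.
  move: H; by rewrite wedge_normE /= (CP p0 p0D).2 (CP p pD).2.
Qed.

End WedgeProcess.

(** * The wedge process as a function of several times *)

Section TimeValues.
Context {R : realType} {m : nat} {alpha beta : R -> R}.
Context {U : R -> R -> Xsp R -> Xsp R} {W : R -> R -> wedge R m -> wedge R m}.
Hypothesis pU : linear_process U.
Hypothesis genU : generated_by alpha beta U.
Hypothesis UW : forall t tau : R, tau <= t -> is_wedge_power (U t tau) (W t tau).
Implicit Types (v : 'I_m -> R) (s : seq (R * ('I_m -> Xsp R))).

Definition time_point (T : R) v : cube R m := fun i => seg_of (v i - T).

Definition window (T : R) v := forall i, T - 1 <= v i <= T.

Definition updr v (i : 'I_m) (r : R) : 'I_m -> R := fun j => if j == i then r else v j.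

Context {tau : R}.

Section Solutions.
Context {X : Xsp R -> R -> R}.
Hypothesis XU : forall phi t, tau <= t -> forall th : seg R,
  U t tau phi th = X phi (t + \val th).

Definition time_sum s v := \sum_(p <- s) p.1 * \prod_i X (p.2 i) (v i).

Lemma time_sumE s T v : tau <= T -> window T v ->
  tsum (tmap (U T tau) s) (time_point T v) = time_sum s v.
Proof.
move=> tT wv; rewrite tsumE big_map; apply: eq_bigr => p _ /=; congr (_ * _).
apply: eq_bigr => i _; rewrite XU// val_seg_of clamp_id; last first.
  by have /andP[? ?] := wv i; apply/andP; split; lra.
by rewrite addrC subrK.
Qed.

(** Linearity is inherited from [U]: every [r >= tau - 1] lies in the window ending at
    [max tau r]. *)
Lemma solution_sum (I : Type) (q : seq I) (c : I -> R) (phi : I -> Xsp R) (r : R) :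
  tau - 1 <= r -> X (\sum_(p <- q) c p *: phi p) r = \sum_(p <- q) c p * X (phi p) r.
Proof.
move=> tr; pose t := Num.max tau r.
have tt : tau <= t by rewrite le_max lexx.
have rt : r <= t by rewrite le_max lexx orbT.
have tr1 : t <= r + 1 by rewrite ge_max; apply/andP; split; lra.
have XE phi' : X phi' r = U t tau phi' (seg_of (r - t)).
  rewrite XU// val_seg_of clamp_id ?[t + _]addrC ?subrK//.
  by apply/andP; split; lra.
rewrite XE linear_fun_sum; last exact: (process_linear pU).
by rewrite csp_sumE; apply: eq_bigr => p _; rewrite XE.
Qed.

Definition time_slice s v (i : 'I_m) : Xsp R :=
  \sum_(p <- s) (p.1 * \prod_(j | j != i) X (p.2 j) (v j)) *: p.2 i.

(** With all times but the [i]-th frozen, a sum of products is a linear combination of solutions,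
    hence the solution started from the combined initial function. This is the link to the scalar
    equation. *)
Lemma time_sliceE s v i (r : R) : tau - 1 <= r ->
  time_sum s (updr v i r) = X (time_slice s v i) r.
Proof.
move=> tr; rewrite /time_slice solution_sum//; apply: eq_bigr => p _.
rewrite (bigD1 i)//= /updr eqxx mulrA -mulrA (mulrC (X _ _)) mulrA.
congr (_ * _); congr (_ * _).
by apply: eq_bigr => j /negbTE ->.
Qed.

End Solutions.

Context {f : wedge R m}.

(* For a solution started at [tau], this depends only on the times [v], not on the
   end [T] of the window containing them; see [wval_window]. *)
Definition wval (T : R) v : R := W T tau f (time_point T v).

Lemma solution_family : exists X : Xsp R -> R -> R, forall phi,
  solves alpha beta tau phi (X phi) /\ forall t, tau <= t -> forall th : seg R,
  U t tau phi th = X phi (t + \val th).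
Proof.
have ex phi : exists x, solves alpha beta tau phi x /\
    forall t, tau <= t -> forall th : seg R, U t tau phi th = x (t + \val th).
  by have [x sx Ux] := genU tau phi; exists x.
by have [X XP] := choice ex; exists X.
Qed.

(** The list [s] approximates the initial element [f], before any evolution, so one [s] serves two
    end times at once. It makes values in different windows comparable, in particular a value and
    its delayed counterpart. *)
Lemma wval_approx X (T T' e : R) :
  (forall phi t, tau <= t -> forall th : seg R, U t tau phi th = X phi (t + \val th)) ->
  tau <= T -> tau <= T' -> 0 < e ->
  exists s, forall v, (window T v -> `|wval T v - time_sum (X := X) s v| <= e) /\
    (window T' v -> `|wval T' v - time_sum (X := X) s v| <= e).
Proof.
move=> XU tT tT' e0.
have [C tC WC] := UW tT; have [C' tC' WC'] := UW tT'.
have [K K1 CK] := bounded_operator_bound tC.1.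
have [K' K'1 CK'] := bounded_operator_bound tC'.1.
have p : 0 < K + K' by lra.
have [s fs] := tsum_dense (wedge_val f) (divr_gt0 e0 p).
have De (D : Xtens R m -> Xtens R m) (L : R) : bounded_operator D ->
    (forall g, `|D g| <= L * `|g|) -> 0 <= L ->
    L <= K + K' -> forall x, `|D (wedge_val f) x - D (tsum s) x| <= e.
  move=> [lD _] DL L0 LK x.
  apply: le_trans (csp_norm_ge (D (wedge_val f) - D (tsum s)) x) _.
  rewrite -(linear_funB lD); apply: le_trans (DL _) _.
  apply: le_trans (ler_wpM2l L0 fs) _.
  by rewrite mulrCA ger_pMr// ler_pdivrMr// mul1r.
exists s => v; split => wv; rewrite -(time_sumE XU _ _ wv)//.
- rewrite -(tensor_power_tsum _ tC) /wval WC.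
  by apply: (De C K tC.1 CK); lra.
- rewrite -(tensor_power_tsum _ tC') /wval WC'.
  by apply: (De C' K' tC'.1 CK'); lra.
Qed.

Lemma wval_window (T T' : R) v : tau <= T -> tau <= T' -> window T v -> window T' v ->
  wval T v = wval T' v.
Proof.
move=> tT tT' wT wT'; have [X XP] := solution_family.
have XU phi := (XP phi).2.
apply/eqP; rewrite -subr_eq0 -normr_le0; apply/ler_addgt0Pr => e e0.
have [s sP] := wval_approx XU tT tT' (divr_gt0 e0 (ltr0n _ 2)).
have [/(_ wT) h1 /(_ wT') h2] := sP v.
rewrite add0r -(subrKA (time_sum (X := X) s v)).
by apply: le_trans (ler_normD _ _) _; rewrite (distrC (time_sum _ _)); lra.
Qed.

Context {a : R} {E : R -> R} {sigma b1 b2 e1 e2 b : R}.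
Hypothesis gE : gauge alpha a E.
Hypotheses (sigma2 : sigma * sigma = 1) (b10 : 0 < b1) (b12 : b1 <= b2)
  (e10 : 0 < e1).
Hypothesis betab : {ae lebesgue_measure, forall t, a <= t <= b ->
  b1 <= sigma * beta t <= b2}.
Hypothesis Eb : forall t, a <= t <= b -> e1 <= E t <= e2.
Hypothesis a_tau : a + 1 <= tau.

Let normM_sigma x : `|sigma * x| = `|x|.
Proof.
suff -> : `|sigma * x| = `|sigma| * `|x|.
  have /eqP : `|sigma| ^+ 2 = 1 by rewrite -normrX expr2 sigma2 normr1.
  by rewrite sqrp_eq1// => /eqP ->; rewrite mul1r.
exact: normrM.
Qed.

Section Increment.
Context {T T' t0 t : R} {v : 'I_m -> R} {i : 'I_m}.
Hypotheses (tau_T : tau <= T) (tau_T' : tau <= T').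
Hypotheses (tau_t0 : tau <= t0) (t0_t : t0 <= t) (t_b : t <= b).
Hypothesis window_T : forall r : R, t0 <= r <= t -> window T (updr v i r).
Hypothesis window_T' : forall r : R, t0 <= r <= t -> window T' (updr v i (r - 1)).

(** A single scalar solution follows the wedge value in its [i]-th time, both at [r] in the window
    ending at [T] and at [r - 1] in the window ending at [T']. *)
Let approx (e : R) : 0 < e -> exists x phi, [/\ solves alpha beta tau phi x,
  forall r : R, t0 <= r <= t -> `|wval T (updr v i r) - x r| <= e &
  forall r : R, t0 <= r <= t -> `|wval T' (updr v i (r - 1)) - x (r - 1)| <= e].
Proof.
move=> e0; have [X XP] := solution_family.
have XU phi := (XP phi).2.
have [s sP] := wval_approx XU tau_T tau_T' e0.
exists (X (time_slice (X := X) s v i)), (time_slice (X := X) s v i).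
split; first exact: (XP _).1.
- move=> r /[dup]tr /andP[tr1 tr2]; rewrite -(time_sliceE XU); last by move: tau_t0 => ?; lra.
  by apply: (sP _).1; exact: window_T.
- move=> r /[dup]tr /andP[tr1 tr2]; rewrite -(time_sliceE XU); last by move: tau_t0 => ?; lra.
  by apply: (sP _).2; exact: window_T'.
Qed.

Let E_bounds (r : R) : t0 <= r -> r <= t -> e1 <= E r /\ E r <= e2.
Proof. by move: a_tau tau_t0 t_b => *; apply/andP/Eb/andP; split; lra. Qed.

Let E_bounds1 (r : R) : t0 <= r <= t -> e1 <= E (r - 1) /\ E (r - 1) <= e2.
Proof. by move=> /andP[? ?]; move: a_tau tau_t0 t_b => *; apply/andP/Eb/andP; split; lra. Qed.

Let coef2_ge0 : 0 <= b2 * (e2 / e1).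
Proof.
have [Et1 Et2] := E_bounds t0_t (lexx t).
have e20 : 0 < e2 := lt_le_trans (lt_le_trans e10 Et1) Et2.
apply: mulr_ge0; last by rewrite ltW// divr_gt0.
exact: le_trans (ltW b10) b12.
Qed.

Let E_dist' (u y y' d : R) : 0 <= u -> u <= e2 -> `|y - y'| <= d ->
  `|u * y - u * y'| <= e2 * d.
Proof. by move=> u0 ue yd; rewrite -mulrBr normrM ger0_norm// ler_pM. Qed.

Let E_dist (u y y' d : R) : 0 <= u -> u <= e2 -> `|y - y'| <= d ->
  `|sigma * (u * y) - sigma * (u * y')| <= e2 * d.
Proof. by move=> u0 ue yd; rewrite -mulrBr normM_sigma; exact: E_dist'. Qed.

(** Limit of the scalar estimate along approximating solutions. All constants are independent of the
    approximation, so the inequality survives although the wedge value itself satisfies no scalar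
    equation. *)
Lemma wval_increment_ge (c : R) : 0 <= c ->
  (forall r : R, t0 <= r <= t -> c <= - sigma * (E (r - 1) * wval T' (updr v i (r - 1)))) ->
  b1 * (e1 / e2) * c * (t - t0) <=
    E t * wval T (updr v i t) - E t0 * wval T (updr v i t0).
Proof.
move=> c0 low; apply/ler_addgt0Pr => e e0.
have [Et1 Et2] := E_bounds t0_t (lexx t).
have [Es1 Es2] := E_bounds (lexx t0) t0_t.
have e20 : 0 < e2 := lt_le_trans (lt_le_trans e10 Et1) Et2.
have b2b := coef2_ge0.
(* Total effect of an error [d]: the slack [e2 * d] integrated over [[t0, t]], plus [e2 * d] at each
   of the two ends. *)
pose N := b2 * (e2 / e1) * e2 * (t - t0) + (e2 + e2).
have N0 : 0 < N.
  apply: ltr_wpDl; last exact: addr_gt0.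
  by apply: mulr_ge0; [exact: mulr_ge0 (ltW e20)|rewrite subr_ge0].
have d0 : 0 < e / N by rewrite divr_gt0.
have dN : e / N * N = e by rewrite divfK// gt_eqF.
move: (e / N) d0 dN => d d0 dN.
have [x [phi [sx xT xT']]] := approx d0.
have ed : 0 <= e2 * d by rewrite mulr_ge0 ?ltW.
have := solves_increment_ge gE sx sigma2 b10 e10 betab Eb a_tau tau_t0 t0_t t_b c0 ed.
have low' r : t0 <= r <= t -> c - e2 * d <= - sigma * (E (r - 1) * x (r - 1)).
  move=> /[dup]tr /low; have := xT' r tr; have [Er1 Er2] := E_bounds1 tr.
  move=> /(E_dist (le_trans (ltW e10) Er1) Er2); rewrite ler_norml => /andP[+ _].
  by rewrite !mulNr; lra.
move=> /(_ low').
have := E_dist' (le_trans (ltW e10) Et1) Et2 (xT t _); rewrite lexx t0_t => /(_ isT).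
have := E_dist' (le_trans (ltW e10) Es1) Es2 (xT t0 _); rewrite lexx t0_t => /(_ isT).
rewrite !ler_norml => /andP[h1 h2] /andP[h3 h4] h5.
move: dN; rewrite /N; lra.
Qed.

Lemma wval_increment_le (c : R) : 0 <= c ->
  (forall r : R, t0 <= r <= t -> - sigma * (E (r - 1) * wval T' (updr v i (r - 1))) <= c) ->
  E t * wval T (updr v i t) - E t0 * wval T (updr v i t0) <=
    b2 * (e2 / e1) * c * (t - t0).
Proof.
move=> c0 up; apply/ler_addgt0Pr => e e0.
have [Et1 Et2] := E_bounds t0_t (lexx t).
have [Es1 Es2] := E_bounds (lexx t0) t0_t.
have e20 : 0 < e2 := lt_le_trans (lt_le_trans e10 Et1) Et2.
have b2b := coef2_ge0.
pose N := b2 * (e2 / e1) * e2 * (t - t0) + (e2 + e2).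
have N0 : 0 < N.
  apply: ltr_wpDl; last exact: addr_gt0.
  by apply: mulr_ge0; [exact: mulr_ge0 (ltW e20)|rewrite subr_ge0].
have d0 : 0 < e / N by rewrite divr_gt0.
have dN : e / N * N = e by rewrite divfK// gt_eqF.
move: (e / N) d0 dN => d d0 dN.
have [x [phi [sx xT xT']]] := approx d0.
have ed : 0 <= c + e2 * d by rewrite addr_ge0// mulr_ge0 ?ltW.
have := solves_increment_le gE sx sigma2 b10 e10 betab Eb a_tau tau_t0 t0_t t_b ed.
have up' r : t0 <= r <= t -> - sigma * (E (r - 1) * x (r - 1)) <= c + e2 * d.
  move=> /[dup]tr /up; have := xT' r tr; have [Er1 Er2] := E_bounds1 tr.
  move=> /(E_dist (le_trans (ltW e10) Er1) Er2); rewrite ler_norml => /andP[_ +].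
  by rewrite !mulNr; lra.
move=> /(_ up').
have := E_dist' (le_trans (ltW e10) Et1) Et2 (xT t _); rewrite lexx t0_t => /(_ isT).
have := E_dist' (le_trans (ltW e10) Es1) Es2 (xT t0 _); rewrite lexx t0_t => /(_ isT).
rewrite !ler_norml => /andP[h1 h2] /andP[h3 h4] h5.
move: dN; rewrite /N; lra.
Qed.

End Increment.

End TimeValues.

(** * Joint continuity of the values in the times and the starting time *)

Section ValueContinuity.
Context {R : realType} {m : nat} {W : R -> R -> wedge R m -> wedge R m}.
Hypothesis pW : linear_process W.

Lemma clamp_cvg (Z : topologicalType) (h : Z -> R) (z : Z) :
  h @ z --> h z -> (fun y => clamp (h y)) @ z --> clamp (h z).
Proof.
move=> /cvgrPdist_le hz; apply/cvgrPdist_le => e e0.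
by apply: filterS (hz e e0) => y; apply: le_trans; exact: clamp_dist.
Qed.

(** The error splits into a fixed function evaluated at a moving point and the sup-norm distance of
    the moving function to it. The maximum with the starting time keeps the process admissible for
    every parameter. *)
Lemma wval_continuous (Z : topologicalType) (u : wedge R m) (T tau : Z -> R)
    (v : Z -> 'I_m -> R) :
  continuous T -> continuous tau -> (forall i, continuous (v^~ i)) ->
  continuous (fun z => wval (W := W) (tau := tau z) (f := u)
    (Num.max (T z) (tau z)) (v z)).
Proof.
move=> cT ctau cv z.
have cmax : (fun z => Num.max (T z) (tau z) : R^o) @ z --> Num.max (T z) (tau z).
  exact: (@continuous_max R Z T tau z (cT z) (ctau z)).
pose g (y : Z) := W (Num.max (T y) (tau y)) (tau y) u.
have cg : g @ z --> g z.
  apply: (@continuous_comp Z (R * R)%type _ (fun y => (T y, tau y))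
    (fun p => W (Num.max p.1 p.2) p.2 u)).
    exact: (cvg_pair (cT z) (ctau z)).
  exact: (process_clamp_continuous pW).
pose th (y : Z) := time_point (Num.max (T y) (tau y)) (v y).
have cth : th @ z --> th z.
  apply: cube_cvgP => i; apply: (@clamp_cvg Z (fun y => v y i - Num.max (T y) (tau y)) z).
  by apply: cvgB; [exact: cv|exact: cmax].
apply/cvgrPdist_le => e e0.
have e2 : 0 < e / 2 by rewrite divr_gt0.
have /cvgrPdist_le/(_ _ e2) := cg.
have /cvgrPdist_le/(_ _ e2) : (fun y => (g z (th y) : R^o)) @ z --> (g z (th z) : R^o).
  exact: (@continuous_comp Z (cube R m) R^o th (wedge_val (g z)) z cth
    (@csp_continuous R _ _ (wedge_val (g z)) (th z))).
apply: filterS2 => y h1 h2.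
rewrite /wval -/(g z) -/(g y) -/(th z) -/(th y) -(subrKA (g z (th y))).
apply: le_trans (ler_normD _ _) _; rewrite [leRHS]splitr; apply: lerD => //.
apply: le_trans h2; rewrite wedge_normE.
exact: (csp_norm_ge (wedge_val (g z) - wedge_val (g y))).
Qed.

End ValueContinuity.

(** * The cone of anti-symmetric functions nonnegative on the simplex *)

Section Cone.
Context {R : realType} {m : nat}.

Lemma simplex_sort (t : cube R m) : exists s : 'S_m, simplex m (permute s t).
Proof.
pose r := sort (fun i j => \val (t i) <= \val (t j)) (enum 'I_m).
have sz : size r = m by rewrite size_sort size_enum_ord.
have szP : size r == m by apply/eqP.
have : perm_eq (Tuple szP) (ord_tuple m) by rewrite /= perm_sort; exact: perm_refl.
case/tuple_permP => s sE; exists s => i j ij.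
have rs k : tnth (Tuple szP) k = s k.
  have /val_inj -> : \val (Tuple szP) = [tuple tnth (ord_tuple m) (s i) | i < m] := sE.
  by rewrite tnth_mktuple tnth_ord_tuple.
rewrite /permute -!rs !(tnth_nth i) /=.
apply: (sorted_leq_nth (leT := fun i j => \val (t i) <= \val (t j))) => //.
- by move=> a b c; exact: le_trans.
- by apply: sort_sorted => a b; exact: le_total.
- by rewrite inE sz.
- by rewrite inE sz.
Qed.

(** Sorting the coordinates moves any point into the simplex at the cost of a sign. This makes the
    cone pointed and locates a nonzero value of a nonzero element on the simplex. *)
Lemma wedge_eq0 (f : wedge R m) : (forall t, simplex m t -> f t = 0) -> f = 0.
Proof.
move=> f0; apply/val_inj/val_inj/funext => t /=.
have [s st] := simplex_sort t.
have /antisymP/(_ s t) := wedge_antisym f; rewrite f0// => /esym/eqP.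
by rewrite mulf_eq0 signr_eq0 /= => /eqP.
Qed.

Lemma wedge_eval_continuous (t : cube R m) :
  continuous (fun f : wedge R m => f t : R^o).
Proof.
move=> f; have FF : Filter (nbhs f) := nbhs_filter f.
apply/(cvgrPdist_le (FF := FF)) => e e0.
have cf : (fun g : wedge R m => g) @ f --> f by exact: cvg_id.
have fg := iffLR (cvgrPdist_le (FF := FF) _ _) cf e e0.
apply: (@filterS _ (nbhs f) FF _ _ _ fg) => g; apply: le_trans; rewrite wedge_normE.
exact: (csp_norm_ge (wedge_val f - wedge_val g)).
Qed.

Lemma Kcone_is_cone : is_cone (Kcone (R := R) m).
Proof.
split.
- have -> : Kcone (R := R) m = \bigcap_(t in simplex m) [set f : wedge R m | 0 <= f t].
    by apply/seteqP; split => f fK t; exact: fK.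
  apply: closed_bigI => t _.
  apply: (@preimage_closed (wedge R m) R^o (fun f => f t) [set x | 0 <= x]); last exact: closed_ge.
  by move=> f _; exact: wedge_eval_continuous.
- by move=> t _.
- by move=> u v uK vK t st; change (0 <= u t + v t); rewrite addr_ge0 ?uK ?vK.
- by move=> a u a0 uK t st; change (0 <= a * u t); rewrite mulr_ge0 ?uK.
- move=> u uK nuK; apply: wedge_eq0 => t st; apply/le_anti; rewrite uK// andbT.
  by have : 0 <= - u t := nuK t st; rewrite oppr_ge0.
Qed.

End Cone.

(** * Three times *)

(** Open on the left and closed on the right, because a chain step needs its new time strictly
    beyond the left end. *)
Lemma nat_floor_open (R : realType) (x : R) : 0 < x ->
  exists k : nat, k%:R < x <= k%:R + 1.
Proof.
move=> x0; have /andP[k1 k2] := truncn_itv (ltW x0).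
move: k1; rewrite le_eqVlt => /orP[/eqP xk|xk]; last first.
  by exists (Num.truncn x); rewrite xk natr1 ltW.
exists (Num.truncn x).-1; rewrite natr1.
case: (Num.truncn x) xk {k2} => [|k] xk; first by move: x0; rewrite -xk ltxx.
by rewrite /= -xk ltr_nat ltnSn lexx.
Qed.

(* [F p s t] stands for the value at the three times [p <= s <= t <= p + 1] of
   an anti-symmetric solution in three times, made positive on the initial
   simplex and multiplied by integrating factors; [F_lower] is the inequality
   form of [d/dt F p s t = b(t) F (t - 1) p s]. *)
Section ThreeTimes.
Context {R : realType} {tau B b1 : R} {F : R -> R -> R -> R}.
Hypothesis b10 : 0 < b1.
Hypothesis F_init : forall p s t, tau - 1 <= p -> p <= s -> s <= t -> t <= tau ->
  0 <= F p s t.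
Hypothesis F_diag : forall p s, tau - 1 <= p -> p <= s -> s <= p + 1 -> s <= B ->
  F p s s = 0.
Hypothesis F_lower : forall p s t0 t c, tau - 1 <= p -> p <= s -> s <= t0 ->
  tau <= t0 -> t0 <= t -> t <= p + 1 -> t <= B -> 0 <= c ->
  (forall r, t0 <= r -> r <= t -> c <= F (r - 1) p s) ->
  b1 * c * (t - t0) <= F p s t - F p s t0.

Lemma three_mono p s t0 t : tau - 1 <= p -> p <= s -> s <= t0 ->
  tau <= t0 -> t0 <= t -> t <= p + 1 -> t <= B ->
  (forall r, t0 <= r -> r <= t -> 0 <= F (r - 1) p s) -> F p s t0 <= F p s t.
Proof.
move=> h1 h2 h3 h4 h5 h6 h7 h8.
have := F_lower h1 h2 h3 h4 h5 h6 h7 (lexx 0) h8; lra.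
Qed.

(** Induction on unit intervals past [tau], and within one of them on the number of times beyond its
    left end [tau']: one in [P1], two in [P2], three at the end. A delay moves the last time back to
    at most [tau'] and to the front, which lowers that number. Integration starts at [tau'], or at
    the diagonal, where the value is zero. *)
Lemma three_ge0 p s t : tau - 1 <= p -> p <= s -> s <= t -> t <= p + 1 ->
  t <= B -> 0 <= F p s t.
Proof.
suff H n : forall p s t, tau - 1 <= p -> p <= s -> s <= t -> t <= p + 1 ->
    t <= B -> t <= tau + n%:R -> 0 <= F p s t.
  move=> h1 h2 h3 h4 h5; apply: (H (Num.truncn (t - tau)).+1) => //.
  by have := truncnS_gt (t - tau); lra.
elim: n => [|n IH] {}p {}s {}t h1 h2 h3 h4 h5 h6.
  by apply: F_init => //; move: h6; rewrite addr0.
have n0 : 0 <= n%:R :> R by [].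
rewrite -natr1 in h6; pose tau' := tau + n%:R.
have tau'E : tau' = tau + n%:R by [].
have [tt'|t't] := leP t tau'; first exact: IH.
have P1 p' s' t' : tau - 1 <= p' -> p' <= s' -> s' <= tau' -> tau' <= t' ->
    t' <= p' + 1 -> t' <= t -> 0 <= F p' s' t'.
  move=> k1 k2 k3 k4 k5 k6.
  apply: le_trans (three_mono (t0 := tau') _ _ _ _ _ _ _ _) => //; try lra.
    by apply: IH => //; lra.
  by move=> r r1 r2; apply: IH; lra.
have P2 p' s' t' : tau - 1 <= p' -> p' <= tau' -> tau' <= s' -> s' <= t' ->
    t' <= p' + 1 -> t' <= t -> 0 <= F p' s' t'.
  move=> k1 k2 k3 k4 k5 k6.
  apply: le_trans (three_mono (t0 := s') _ _ _ _ _ _ _ _) => //; try lra.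
    by rewrite F_diag//; lra.
  move=> r r1 r2; apply: P1; lra.
have [st'|t's] := leP s tau'; first by apply: P1 => //; lra.
have [pt'|t'p] := leP p tau'; first by apply: P2 => //; lra.
apply: le_trans (three_mono (t0 := s) _ _ _ _ _ _ _ _) => //; try lra.
  by rewrite F_diag//; lra.
move=> r r1 r2; apply: P2; lra.
Qed.

Hypothesis F_open : forall p s t, tau - 1 <= p -> p <= s -> s <= t -> t <= p + 1 ->
  t <= B -> 0 < F p s t -> exists2 d, 0 < d & forall p' s' t',
  tau - 1 <= p' -> p' <= s' -> s' <= t' -> t' <= p' + 1 -> t' <= B ->
  `|p' - p| < d -> `|s' - s| < d -> `|t' - t| < d -> d <= F p' s' t'.

(* [F b c] does not decrease, and its derivative at [r] is at least
   [b1 * F (r - 1) b c], which is positive for [r] near [a + 1]. *)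
Lemma three_chain a b c t : tau - 1 <= a -> a <= b -> b <= c -> c <= a + 1 ->
  0 < F a b c -> a + 1 < t -> t <= b + 1 -> t <= B -> 0 < F b c t.
Proof.
move=> h1 h2 h3 h4 Fabc h5 h6 h7.
have [||||||d d0 dP] := @F_open a b c => //; try lra.
pose t1 := Num.min t (a + 1 + d / 2).
have t1t : t1 <= t by rewrite ge_min lexx.
have t1a : a + 1 < t1 by rewrite lt_min h5 /=; lra.
have t1d : t1 <= a + 1 + d / 2 by rewrite ge_min lexx orbT.
have ge0 r : a + 1 <= r -> r <= t -> 0 <= F (r - 1) b c.
  by move=> r1 r2; apply: three_ge0; lra.
have : F b c t1 <= F b c t.
  by apply: three_mono; try lra; move=> r r1 r2; apply: ge0; lra.
have : b1 * d * (t1 - (a + 1)) <= F b c t1 - F b c (a + 1).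
  apply: F_lower; try lra; move=> r r1 r2; apply: dP; try lra.
  - by rewrite ger0_norm; lra.
  - by rewrite subrr normr0.
  - by rewrite subrr normr0.
have : 0 <= F b c (a + 1) by apply: three_ge0; lra.
have : 0 < b1 * d * (t1 - (a + 1)) by rewrite !mulr_gt0//; lra.
lra.
Qed.

(* Chains started at [F w z y] pass through the times [z + k] and [y + k]. *)
Lemma three_exists w z y c : tau - 1 <= w -> w < z -> z < y -> y <= tau ->
  0 < F w z y -> tau + 1 <= c -> c <= B -> exists a b,
  [/\ c - 1 <= a, a < b, b < c & 0 < F a b c].
Proof.
move=> h1 h2 h3 h4 Fwzy yc cB.
have pat k : z + k%:R + 1 <= B -> 0 < F (z + k%:R) (y + k%:R) (z + k%:R + 1) /\
    (y + k%:R + 1 <= B -> 0 < F (y + k%:R) (z + k%:R + 1) (y + k%:R + 1)).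
  elim: k => [|k IH].
    rewrite !addr0 => zB; have F1 : 0 < F z y (z + 1).
      by apply: (three_chain (a := w)) => //; lra.
    split=> // yB; apply: (three_chain (a := z)) => //; lra.
  rewrite -natr1 => zB; have [|_ F2] := IH; first lra.
  have k0 : 0 <= k%:R :> R by [].
  have {}F2 : 0 < F (y + k%:R) (z + k%:R + 1) (y + k%:R + 1) by apply: F2; lra.
  have F3 : 0 < F (z + (k%:R + 1)) (y + (k%:R + 1)) (z + (k%:R + 1) + 1).
    rewrite !addrA; rewrite (addrAC z) in F2 *; rewrite !(addrAC _ 1) in F2 *.
    apply: (three_chain (a := y + k%:R)) => //; lra.
  split=> // yB; apply: (three_chain (a := z + (k%:R + 1))) => //; lra.
have cy : 0 < c - y by lra.
(* The last chain step ends at [c] instead of a time of the pattern. With [y + k < c <= y + k + 1],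
   the comparison of [c] with [z + k + 1] decides which triple precedes it. *)
have [k /andP[k1 k2]] := nat_floor_open cy.
have k0 : 0 <= k%:R :> R by [].
have [cz|zc] := leP c (z + k%:R + 1); last first.
  have [|F1 _] := pat k; first lra.
  exists (y + k%:R), (z + k%:R + 1); split; try lra.
  apply: (three_chain (a := z + k%:R)) => //; lra.
exists (z + k%:R), (y + k%:R); split; try lra.
case: k k1 k2 k0 cz => [|k] k1 k2 k0 cz.
  by rewrite !addr0 in k1 k2 cz *; apply: (three_chain (a := w)) => //; lra.
rewrite -natr1 in k1 k2 k0 cz *; have k0' : 0 <= k%:R :> R by [].
have [|_ F2] := pat k; first lra.
have {}F2 : 0 < F (y + k%:R) (z + k%:R + 1) (y + k%:R + 1) by apply: F2; lra.
rewrite !addrA; apply: (three_chain (a := y + k%:R)) => //; lra.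
Qed.

Section Full.
Hypothesis F_exists : forall c, tau + 1 <= c -> c <= B -> exists a b,
  [/\ c - 1 <= a, a < b, b < c & 0 < F a b c].

(** Two chain steps from a positive triple [(a, b, c - 1)]: first to [(b, c - 1, b + 1)], then to
    [(c - 1, b + 1, c)]. *)
Lemma three_end_exists c : tau + 2 <= c -> c <= B ->
  exists2 b, c - 1 < b < c & 0 < F (c - 1) b c.
Proof.
move=> h1 h2; have [||a [b [k1 k2 k3 Fabc]]] := @F_exists (c - 1); try lra.
have F1 : 0 < F b (c - 1) (b + 1) by apply: (three_chain (a := a)) => //; lra.
exists (b + 1); first by apply/andP; split; lra.
by apply: (three_chain (a := b)) => //; lra.
Qed.

(** Chains from a positive triple [(c - 2, b0, c - 1)] reach the middle time [b] directly when
    [b <= b0 + 1]. For larger [b] the triple is moved slightly to the left, to [(y - 1, b0, y)] with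
    [y < c - 1], which leaves room for the additional step through [(b0, y, c - 1)] and
    [(y, c - 1, b)]. *)
Lemma three_end c b : tau + 3 <= c -> c <= B -> c - 1 < b -> b < c ->
  0 < F (c - 1) b c.
Proof.
move=> h1 h2 h3 h4.
have [||b0 /andP[k1 k2] F0] := @three_end_exists (c - 1); try lra.
have [bb0|b0b] := leP b (b0 + 1).
  have F1 : 0 < F b0 (c - 1) b by apply: (three_chain (a := c - 1 - 1)) => //; lra.
  by apply: (three_chain (a := b0)) => //; lra.
have [|||||d d0 dP] := F_open _ _ _ _ _ F0; try lra.
(* The three terms keep the moved triple in the radius of positivity, keep [b0 < y], and ensure
   [b <= y + 1]. *)
pose d' := Num.min (d / 2) (Num.min ((c - 1 - b0) / 2) (c - b)).
have d'0 : 0 < d' by rewrite !lt_min; apply/and3P; split; lra.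
have d'1 : d' <= d / 2 by rewrite ge_min lexx.
have d'2 : d' <= (c - 1 - b0) / 2 by rewrite !ge_min lexx orbT.
have d'3 : d' <= c - b by rewrite !ge_min lexx !orbT.
pose y := c - 1 - d'; have yE : y = c - 1 - d' by [].
have F1 : 0 < F (y - 1) b0 y.
  apply: (lt_le_trans d0); apply: dP; try lra.
  - by rewrite ler0_norm; lra.
  - by rewrite subrr normr0.
  - by rewrite ler0_norm; lra.
have F2 : 0 < F b0 y (c - 1) by apply: (three_chain (a := y - 1)) => //; lra.
have F3 : 0 < F y (c - 1) b by apply: (three_chain (a := b0)) => //; lra.
by apply: (three_chain (a := y)) => //; lra.
Qed.

Lemma three_gt0 p s t : tau + 3 <= s -> s - 1 < p -> p < s -> s < t -> t <= p + 1 ->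
  t <= B -> 0 < F p s t.
Proof.
move=> h1 h2 h3 h4 h5 h6.
by apply: (three_chain (a := s - 1)); try lra; apply: three_end; lra.
Qed.

End Full.

End ThreeTimes.

(* The three terms come from [t - p] small, from [s - p >= 9 / 10], and from the
   remaining times, where the weight [u_3] is comparable to [(t - s) (s - p)]. *)
Definition three_const {R : realType} (b kappa : R) : R :=
  Num.min (b ^+ 4 * kappa * (1 / 40))
    (Num.min (b ^+ 3 * kappa * (1 / 20)) (b ^+ 2 * kappa * (1 / 800))).

Lemma three_const_factors (R : realType) (b kappa : R) : 0 < b -> 0 < kappa ->
  [/\ 0 < b ^+ 4 * kappa * (1 / 40), 0 < b ^+ 3 * kappa * (1 / 20) &
    0 < b ^+ 2 * kappa * (1 / 800)].
Proof.
move=> b0 k0; have bk n : 0 < b ^+ n * kappa by rewrite mulr_gt0 ?exprn_gt0.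
by split; apply: mulr_gt0 => [//|]; lra.
Qed.

Lemma three_const_gt0 (R : realType) (b kappa : R) : 0 < b -> 0 < kappa ->
  0 < three_const b kappa.
Proof. by move=> b0 /(three_const_factors b0)[? ? ?]; rewrite !lt_min; apply/and3P. Qed.

(** * Comparison with the weight in three times *)

Section ThreeTimesBounds.
Context {R : realType} {tau B b1 : R} {F : R -> R -> R -> R}.
Hypothesis b10 : 0 < b1.
Hypothesis F_ge0 : forall p s t, tau - 1 <= p -> p <= s -> s <= t -> t <= p + 1 ->
  t <= B -> 0 <= F p s t.
Hypothesis F_diag : forall p s, tau - 1 <= p -> p <= s -> s <= p + 1 -> s <= B ->
  F p s s = 0.
Hypothesis F_lower : forall p s t0 t c, tau - 1 <= p -> p <= s -> s <= t0 ->
  tau <= t0 -> t0 <= t -> t <= p + 1 -> t <= B -> 0 <= c ->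
  (forall r, t0 <= r -> r <= t -> c <= F (r - 1) p s) ->
  b1 * c * (t - t0) <= F p s t - F p s t0.

(** One integration in the last time, restricted to [[t0, t1]]; the rest of the range contributes
    nonnegatively. *)
Let sub_lower p s t0 t1 t c : tau - 1 <= p -> p <= s -> s <= t0 -> tau <= t0 ->
  t0 <= t1 -> t1 <= t -> t <= p + 1 -> t <= B -> 0 <= c ->
  (forall r, t0 <= r -> r <= t1 -> c <= F (r - 1) p s) ->
  b1 * c * (t1 - t0) <= F p s t.
Proof.
move=> h1 h2 h3 h4 h5 h6 h7 h8 c0 h9.
have : b1 * c * (t1 - t0) <= F p s t1 - F p s t0 by apply: F_lower => //; lra.
have : 0 <= F p s t0 by apply: F_ge0; lra.
have : F p s t1 <= F p s t.
  have : b1 * 0 * (t - t1) <= F p s t - F p s t1; last by lra.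
  apply: F_lower => //; try lra; move=> r r1 r2; apply: F_ge0; lra.
lra.
Qed.

(** Two nested integrations: [r] replaces [t] and is delayed to the front, then [r'] replaces [s],
    leaving [F (r' - 1) (r - 1) p]. The freedom to choose both subranges is what the cases below
    exploit. *)
Let sub_lower2 p s s0 s1 t t0 t1 c : tau <= p -> p <= s0 -> s0 <= s1 -> s1 <= s ->
  s <= t0 -> t0 <= t1 -> t1 <= t -> t <= p + 1 -> t <= B -> 0 <= c ->
  (forall r r', t0 <= r -> r <= t1 -> s0 <= r' -> r' <= s1 ->
    c <= F (r' - 1) (r - 1) p) ->
  b1 * (b1 * c * (s1 - s0)) * (t1 - t0) <= F p s t.
Proof.
move=> h1 h2 h3 h4 h5 h6 h7 h8 h9 c0 H.
have c1 : 0 <= b1 * c * (s1 - s0).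
  by apply: mulr_ge0; [apply: mulr_ge0; [exact: ltW|]|rewrite subr_ge0].
apply: (sub_lower _ _ _ _ _ _ _ _ c1); [lra..|]; clear c1.
move=> r r1 r2.
apply: (sub_lower _ _ _ _ _ _ _ _ c0); [lra..|] => r' r'1 r'2.
exact: H.
Qed.

Section Lower.
Context {kappa D : R} (k0 : 0 < kappa) (D0 : 0 < D) (D1 : D <= 1 / 10).
Hypothesis kF : forall a b c, tau + 3 <= b -> c - 1 <= a -> a + D / 40 <= b ->
  b + D / 40 <= c -> c <= B -> kappa <= F a b c.
Hypothesis kF_end : forall a b c, tau + 3 <= c -> c <= B -> c - 1 <= a ->
  a <= c - 1 + D -> c - 2 / 3 <= b -> b <= c - 1 / 3 -> kappa <= F a b c.

(** Here [x] and [y] are both close to [p - 1]. Moving the last time in the middle of the unit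
    interval and the second over [[x, y]] leads to triples ending at [x], of length nearly one and
    with a central middle time, where [kF_end] applies. The factor [1 / 5] is the length of the
    central range. *)
Let near_diag x y p : tau + 4 <= p -> p <= B -> p - 1 <= x -> x <= y ->
  y <= p - 1 + D -> b1 * (b1 * kappa) * (1 / 5) * (y - x) <= F x y p.
Proof.
move=> h1 h2 h3 h4 h5; move: (D0) (D1) => D0' D1'.
have -> : b1 * (b1 * kappa) * (1 / 5) * (y - x) =
    b1 * (b1 * kappa * (y - x)) * ((x + 6 / 10) - (x + 4 / 10)) by field.
apply: (sub_lower2 _ _ _ _ _ _ _ _ _ (ltW k0)); [lra..|].
by move=> r r' r1 r2 r'1 r'2; apply: kF_end; lra.
Qed.

Let near_end x y p : tau + 4 <= p -> p <= B -> p - 6 / 10 <= x -> x <= p - 4 / 10 ->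
  p - 1 / 10 <= y -> y <= p -> b1 * kappa * (p - y) <= F x y p.
Proof.
move=> h1 h2 h3 h4 h5 h6; move: (D1) => D1'.
apply: (sub_lower _ _ _ _ _ _ _ _ (ltW k0)); [lra..|].
by move=> r r1 r2; apply: kF; lra.
Qed.

(** With [r'] in the first half of [[p, s]] and [r] in the second half of [[s, t]], the delayed
    times stay at distance at least [(t - p) / 2], and the near-diagonal bound supplies the third
    small factor. The constant is [1 / 5] times three halves. *)
Let lower_diag p s t : tau + 4 <= p -> t <= B -> t <= p + 1 -> p <= s -> s <= t ->
  t - p <= D ->
  b1 ^+ 4 * kappa * (1 / 40) * ((t - s) * (s - p) * (t - p)) <= F p s t.
Proof.
move=> h1 h2 h3 h4 h5 h6; move: (D0) (D1) => D0' D1'.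
have bk : 0 <= b1 * (b1 * kappa) * (1 / 5).
  by rewrite !mulr_ge0// ltW.
pose c := b1 * (b1 * kappa) * (1 / 5) * ((t - p) / 2).
have -> : b1 ^+ 4 * kappa * (1 / 40) * ((t - s) * (s - p) * (t - p)) =
    b1 * (b1 * c * ((p + s) / 2 - p)) * (t - (s + t) / 2) by rewrite /c; field.
have c0 : 0 <= c by apply: mulr_ge0 => //; clear bk; lra.
have cP : b1 * (b1 * kappa) * (1 / 5) * ((t - p) / 2) = c by [].
clearbody c.
apply: (sub_lower2 _ _ _ _ _ _ _ _ _ c0); [lra..|].
move=> r r' r1 r2 r'1 r'2; apply: le_trans (near_diag _ _ _ _ _); [|lra..].
by rewrite -cP; apply: ler_wpM2l => //; clear bk cP c0; lra.
Qed.

(** When [s - p] is near one, [r] in the first half of [[s, t]] leaves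
    [p - (r - 1) >= (1 + p - s) / 2], which supplies the factor vanishing at [s = p + 1]. The
    central range of [r'] has length [1 / 5], and two halvings give [1 / 20]. *)
Let lower_end p s t : tau + 4 <= p -> t <= B -> t <= p + 1 -> p <= s -> s <= t ->
  9 / 10 <= s - p ->
  b1 ^+ 3 * kappa * (1 / 20) * ((t - s) * (1 + p - s)) <= F p s t.
Proof.
move=> h1 h2 h3 h4 h5 h6.
have bk : 0 <= b1 * kappa by rewrite mulr_ge0// ltW.
pose c := b1 * kappa * ((1 + p - s) / 2).
have -> : b1 ^+ 3 * kappa * (1 / 20) * ((t - s) * (1 + p - s)) =
    b1 * (b1 * c * ((p + 6 / 10) - (p + 4 / 10))) * ((s + t) / 2 - s).
  by rewrite /c; field.
have c0 : 0 <= c by apply: mulr_ge0 => //; clear bk; lra.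
have cP : b1 * kappa * ((1 + p - s) / 2) = c by [].
clearbody c.
apply: (sub_lower2 _ _ _ _ _ _ _ _ _ c0); [lra..|].
move=> r r' r1 r2 r'1 r'2; apply: le_trans (near_end _ _ _ _ _ _); [|lra..].
by rewrite -cP; apply: ler_wpM2l => //; clear bk cP c0; lra.
Qed.

(** A short range of [r] around [(s + t) / 2] and of [r'] just after [p] keeps [r' - 1], [r - 1] and
    [p] separated by [D / 40]. The range lengths [(t - s) / 20] and [(s - p) / 40] give
    [1 / 800]. *)
Let lower_bulk p s t : tau + 4 <= p -> t <= B -> t <= p + 1 -> p <= s -> s <= t ->
  D <= t - p -> s - p <= 9 / 10 ->
  b1 ^+ 2 * kappa * (1 / 800) * ((t - s) * (s - p)) <= F p s t.
Proof.
move=> h1 h2 h3 h4 h5 h6 h7; move: (D0) (D1) => D0' D1'.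
have -> : b1 ^+ 2 * kappa * (1 / 800) * ((t - s) * (s - p)) =
    b1 * (b1 * kappa * ((p + (s - p) / 40) - p)) *
      (((s + t) / 2 + (t - s) / 40) - ((s + t) / 2 - (t - s) / 40)) by field.
apply: (sub_lower2 _ _ _ _ _ _ _ _ _ (ltW k0)); [lra..|].
by move=> r r' r1 r2 r'1 r'2; apply: kF; lra.
Qed.

Lemma three_lower_bound (p s t : R) :
  tau + 4 <= p -> t <= B -> t <= p + 1 -> p <= s -> s <= t ->
  three_const b1 kappa * ((t - s) * (s - p) * (t - p) * (1 + p - s)) <= F p s t.
Proof.
have [K10 K20 K30] := three_const_factors b10 k0; rewrite /three_const.
move: lower_diag lower_end lower_bulk K10 K20 K30.
move: (_ * (1 / 40)) (_ * (1 / 20)) (_ * (1 / 800)) => K1 K2 K3 L1 L2 L3 K10 K20 K30.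
move=> h1 h2 h3 h4 h5.
have ts : 0 <= t - s by rewrite subr_ge0.
have sp : 0 <= s - p by rewrite subr_ge0.
have tp : 0 <= t - p by lra.
have ps : 0 <= 1 + p - s by lra.
have tp1 : t - p <= 1 by lra.
have sp1 : s - p <= 1 by lra.
have ps1 : 1 + p - s <= 1 by lra.
have u0 : 0 <= (t - s) * (s - p) * (t - p) * (1 + p - s) by rewrite !mulr_ge0.
have [tps|pts] := leP (t - p) D.
  apply: le_trans (L1 _ _ _ h1 h2 h3 h4 h5 tps); apply: ler_pM => //.
  - by rewrite !le_min !ltW.
  - by rewrite ge_min lexx.
  - by rewrite ler_piMr// !mulr_ge0.
have [psp|sps] := leP (9 / 10) (s - p).
  apply: le_trans (L2 _ _ _ h1 h2 h3 h4 h5 psp); apply: ler_pM => //.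
  - by rewrite !le_min !ltW.
  - by rewrite !ge_min lexx !orbT.
  - apply: ler_wpM2r => //; rewrite -mulrA ler_piMr//.
    by rewrite mulr_ile1.
apply: le_trans (L3 _ _ _ h1 h2 h3 h4 h5 (ltW pts) (ltW sps)); apply: ler_pM => //.
- by rewrite !le_min !ltW.
- by rewrite !ge_min lexx !orbT.
- by rewrite -mulrA ler_piMr ?mulr_ge0// mulr_ile1.
Qed.

End Lower.

(** Four integrations, each starting from the diagonal, over ranges of lengths at most [t - s],
    [s - p], [1 + p - s] and [t - p]: exactly the factors of the weight. The innermost value is
    bounded by [M]. *)
Lemma three_upper_bound b2 M : 0 <= b2 -> 0 <= M ->
  (forall p s t0 t c, tau - 1 <= p -> p <= s -> s <= t0 ->
    tau <= t0 -> t0 <= t -> t <= p + 1 -> t <= B -> 0 <= c ->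
    (forall r, t0 <= r -> r <= t -> F (r - 1) p s <= c) ->
    F p s t - F p s t0 <= b2 * c * (t - t0)) ->
  (forall p s t, tau - 1 <= p -> p <= s -> s <= t -> t <= p + 1 -> t <= B ->
    F p s t <= M) ->
  forall p s t, tau + 4 <= p -> t <= B -> t <= p + 1 -> p <= s -> s <= t ->
    F p s t <= b2 ^+ 4 * M * ((t - s) * (s - p) * (t - p) * (1 + p - s)).
Proof.
move=> b20 M0 F_upper FM p s t h1 h2 h3 h4 h5.
have up p' s' t' c d : tau <= p' -> p' <= s' -> s' <= t' -> t' <= p' + 1 ->
    t' <= B -> 0 <= c -> t' - s' <= d ->
    (forall r, s' <= r -> r <= t' -> F (r - 1) p' s' <= c) ->
    F p' s' t' <= b2 * c * d.
  move=> k1 k2 k3 k4 k5 c0 td kc.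
  apply: (@le_trans _ _ (b2 * c * (t' - s'))); last first.
    by rewrite ler_wpM2l// mulr_ge0.
  have : F p' s' t' - F p' s' s' <= b2 * c * (t' - s').
    by apply: F_upper (c0) kc => //; lra.
  by rewrite F_diag ?subr0//; lra.
have -> : b2 ^+ 4 * M * ((t - s) * (s - p) * (t - p) * (1 + p - s)) =
    b2 * (b2 * (b2 * (b2 * M * (t - p)) * (1 + p - s)) * (s - p)) * (t - s) by ring.
have ge0 c d : 0 <= c -> 0 <= d -> 0 <= b2 * c * d by move=> *; rewrite !mulr_ge0.
have tp0 : 0 <= t - p by lra.
have ps0 : 0 <= 1 + p - s by lra.
have sp0 : 0 <= s - p by lra.
have c1 := ge0 _ _ M0 tp0.
have c2 := ge0 _ _ c1 ps0.
have c3 := ge0 _ _ c2 sp0.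
move: c1 c2 c3; set m1 := _ * (t - p); set m2 := b2 * m1 * _; set m3 := b2 * m2 * _.
have m1P : m1 = b2 * M * (t - p) by [].
have m2P : m2 = b2 * m1 * (1 + p - s) by [].
have m3P : m3 = b2 * m2 * (s - p) by [].
clearbody m3 m2 m1 => c1 c2 c3.
apply: (up _ _ _ _ _ _ _ _ _ _ c3) => //; [lra..|] => r r1 r2; rewrite m3P.
apply: (up _ _ _ _ _ _ _ _ _ _ c2); [lra..|] => r' r'1 r'2; rewrite m2P.
apply: (up _ _ _ _ _ _ _ _ _ _ c1); [lra..|] => r'' r''1 r''2; rewrite m1P.
apply: (up _ _ _ _ _ _ _ _ _ _ M0); [lra..|] => z z1 z2.
by apply: FM; lra.
Qed.

End ThreeTimesBounds.

(** * Two times *)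

Section TwoTimes.
Context {R : realType} {tau B b1 : R} {F : R -> R -> R}.
Hypothesis b10 : 0 < b1.
Hypothesis F_init : forall s t, tau - 1 <= s -> s <= t -> t <= tau -> 0 <= F s t.
Hypothesis F_diag : forall s, tau - 1 <= s -> s <= B -> F s s = 0.
Hypothesis F_lower : forall s t0 t c, tau - 1 <= s -> s <= t0 ->
  tau <= t0 -> t0 <= t -> t <= s + 1 -> t <= B -> 0 <= c ->
  (forall r, t0 <= r -> r <= t -> c <= F (r - 1) s) ->
  b1 * c * (t - t0) <= F s t - F s t0.

Lemma two_mono s t0 t : tau - 1 <= s -> s <= t0 ->
  tau <= t0 -> t0 <= t -> t <= s + 1 -> t <= B ->
  (forall r, t0 <= r -> r <= t -> 0 <= F (r - 1) s) -> F s t0 <= F s t.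
Proof.
move=> h2 h3 h4 h5 h6 h7 h8.
have := F_lower h2 h3 h4 h5 h6 h7 (lexx 0) h8; lra.
Qed.

Lemma two_ge0 s t : tau - 1 <= s -> s <= t -> t <= s + 1 -> t <= B -> 0 <= F s t.
Proof.
suff H n : forall s t, tau - 1 <= s -> s <= t -> t <= s + 1 ->
    t <= B -> t <= tau + n%:R -> 0 <= F s t.
  move=> h1 h3 h4 h5; apply: (H (Num.truncn (t - tau)).+1) => //.
  by have := truncnS_gt (t - tau); lra.
elim: n => [|n IH] {}s {}t h1 h3 h4 h5 h6.
  by apply: F_init => //; move: h6; rewrite addr0.
have n0 : 0 <= n%:R :> R by [].
rewrite -natr1 in h6; pose tau' := tau + n%:R.
have tau'E : tau' = tau + n%:R by [].
have [tt'|t't] := leP t tau'; first exact: IH.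
have P1 s' t' : tau - 1 <= s' -> s' <= tau' -> tau' <= t' ->
    t' <= s' + 1 -> t' <= t -> 0 <= F s' t'.
  move=> k1 k3 k4 k5 k6.
  apply: le_trans (two_mono (t0 := tau') _ _ _ _ _ _ _) => //; try lra.
    by apply: IH => //; lra.
  by move=> r r1 r2; apply: IH; lra.
have [st'|t's] := leP s tau'; first by apply: P1 => //; lra.
apply: le_trans (two_mono (t0 := s) _ _ _ _ _ _ _) => //; try lra.
  by rewrite F_diag//; lra.
move=> r r1 r2; apply: P1; lra.
Qed.

Section Positivity.
Hypothesis F_open : forall s t, tau - 1 <= s -> s <= t -> t <= s + 1 ->
  t <= B -> 0 < F s t -> exists2 d, 0 < d & forall s' t',
  tau - 1 <= s' -> s' <= t' -> t' <= s' + 1 -> t' <= B ->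
  `|s' - s| < d -> `|t' - t| < d -> d <= F s' t'.

Lemma two_chain a b t : tau - 1 <= a -> a <= b -> b <= a + 1 ->
  0 < F a b -> a + 1 < t -> t <= b + 1 -> t <= B -> 0 < F b t.
Proof.
move=> h1 h2 h4 Fabc h5 h6 h7.
have [|||||d d0 dP] := @F_open a b => //; try lra.
pose t1 := Num.min t (a + 1 + d / 2).
have t1t : t1 <= t by rewrite ge_min lexx.
have t1a : a + 1 < t1 by rewrite lt_min h5 /=; lra.
have t1d : t1 <= a + 1 + d / 2 by rewrite ge_min lexx orbT.
have ge0 r : a + 1 <= r -> r <= t -> 0 <= F (r - 1) b.
  by move=> r1 r2; apply: two_ge0; lra.
have : F b t1 <= F b t.
  by apply: two_mono; try lra; move=> r r1 r2; apply: ge0; lra.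
have : b1 * d * (t1 - (a + 1)) <= F b t1 - F b (a + 1).
  apply: F_lower; try lra; move=> r r1 r2; apply: dP; try lra.
  - by rewrite ger0_norm; lra.
  - by rewrite subrr normr0.
have : 0 <= F b (a + 1) by apply: two_ge0; lra.
have : 0 < b1 * d * (t1 - (a + 1)) by rewrite !mulr_gt0//; lra.
lra.
Qed.

(** The chain from [(w, z)] runs through the pairs [(z + k, z + k + 1)]; its last step ends at [c],
    with [z + k < c <= z + k + 1]. *)
Lemma two_exists w z c : tau - 1 <= w -> w < z -> z <= tau ->
  0 < F w z -> tau + 1 <= c -> c <= B -> exists a,
  [/\ c - 1 <= a, a < c & 0 < F a c].
Proof.
move=> h1 h2 h4 Fwz yc cB.
have pat k : z + k%:R + 1 <= B -> 0 < F (z + k%:R) (z + k%:R + 1).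
  elim: k => [|k IH].
    by rewrite !addr0 => zB; apply: (two_chain (a := w)) => //; lra.
  rewrite -natr1 => zB; have k0 : 0 <= k%:R :> R by [].
  have F2 : 0 < F (z + k%:R) (z + k%:R + 1) by apply: IH; lra.
  by rewrite !addrA; apply: (two_chain (a := z + k%:R)) => //; lra.
have cz : 0 < c - z by lra.
have [k /andP[k1 k2]] := nat_floor_open cz.
have k0 : 0 <= k%:R :> R by [].
exists (z + k%:R); split; try lra.
case: k k1 k2 k0 => [|k] k1 k2 k0.
  by rewrite !addr0 in k1 k2 *; apply: (two_chain (a := w)) => //; lra.
rewrite -natr1 in k1 k2 k0 *; have k0' : 0 <= k%:R :> R by [].
have F2 : 0 < F (z + k%:R) (z + k%:R + 1) by apply: pat; lra.
rewrite !addrA; apply: (two_chain (a := z + k%:R)) => //; lra.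
Qed.

Lemma two_end s : tau + 2 <= s -> s <= B ->
  (forall c, tau + 1 <= c -> c <= B -> exists a,
    [/\ c - 1 <= a, a < c & 0 < F a c]) ->
  0 < F (s - 1) s.
Proof.
move=> h1 h2 ex; have [||a [k1 k2 Fa]] := ex (s - 1); try lra.
by apply: (two_chain (a := a)) => //; lra.
Qed.

End Positivity.

(** For [r] in [[s, s + d]] the delayed pair [(r - 1, s)] is close to [(s - 1, s)], where the value
    is at least [kappa]. Integrating over that part of [[s, t]] alone gives linear growth away from
    the diagonal. *)
Lemma two_lower_bound (kappa d : R) : 0 < kappa -> 0 < d -> d <= 1 ->
  (forall s h, tau + 2 <= s -> s <= B -> 0 <= h -> h <= d -> kappa <= F (s - 1 + h) s) ->
  forall s t, tau + 2 <= s -> t <= B -> t <= s + 1 -> s <= t ->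
    b1 * kappa * d * (t - s) <= F s t.
Proof.
move=> k0 d0 d1 kF s t h1 h2 h3 h4.
pose t1 := Num.min t (s + d).
have t1t : t1 <= t by rewrite ge_min lexx.
have t1s : s <= t1 by rewrite le_min h4 /=; lra.
have t1d : t1 <= s + d by rewrite ge_min lexx orbT.
(* Since [d <= 1] and [t - s <= 1], the truncated length is still a proportion [d] of the full
   one. *)
have dt : d * (t - s) <= t1 - s.
  rewrite lerBrDr le_min; apply/andP; split; last first.
    by rewrite addrC lerD2l ler_piMr//; [exact: ltW|lra].
  by rewrite -lerBrDr ler_piMl//; lra.
have : F s t1 <= F s t.
  by apply: two_mono; try lra; move=> r r1 r2; apply: two_ge0; lra.
have : b1 * kappa * (t1 - s) <= F s t1 - F s s.
  apply: F_lower; try lra; move=> r r1 r2.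
  have -> : r - 1 = s - 1 + (r - s) by ring.
  by apply: kF; lra.
rewrite F_diag ?subr0; [|lra..].
have : b1 * kappa * d * (t - s) <= b1 * kappa * (t1 - s).
  by rewrite -mulrA ler_wpM2l// mulr_ge0// ltW.
lra.
Qed.

Lemma two_upper_bound (b2 M : R) : 0 <= b2 -> 0 <= M ->
  (forall s t0 t c, tau - 1 <= s -> s <= t0 ->
    tau <= t0 -> t0 <= t -> t <= s + 1 -> t <= B -> 0 <= c ->
    (forall r, t0 <= r -> r <= t -> F (r - 1) s <= c) ->
    F s t - F s t0 <= b2 * c * (t - t0)) ->
  (forall s t, tau - 1 <= s -> s <= t -> t <= s + 1 -> t <= B -> F s t <= M) ->
  forall s t, tau + 2 <= s -> t <= B -> t <= s + 1 -> s <= t ->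
    F s t <= b2 * M * (t - s).
Proof.
move=> b20 M0 F_upper FM s t h1 h2 h3 h4.
have : F s t - F s s <= b2 * M * (t - s).
  by apply: F_upper; try lra; move=> r r1 r2; apply: FM; lra.
by rewrite F_diag ?subr0; lra.
Qed.

End TwoTimes.

(** * Two-sided bounds for the wedge process *)

Section AntiSymmetry.
Context {R : realType} {m : nat}.
Implicit Types (f : wedge R m) (t : cube R m).

Lemma wedge_swap f t (i j : 'I_m) : i != j ->
  f (fun k => t (tperm i j k)) = - f t.
Proof.
move=> ij; have /antisymP/(_ (tperm i j) t) := wedge_antisym f.
by rewrite odd_tperm ij expr1 mulN1r.
Qed.

Lemma wedge_diag f t (i j : 'I_m) : i != j -> t i = t j -> f t = 0.
Proof.
move=> ij tij; have := wedge_swap f t ij.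
have -> : (fun k => t (tperm i j k)) = t.
  by apply/funext => k; case: tpermP => [->|->|].
by move/eqP; rewrite -addr_eq0 -mulr2n mulrn_eq0 /= => /eqP.
Qed.

Lemma time_point_simplex (T : R) (v : 'I_m -> R) :
  (forall i j : 'I_m, (i <= j)%N -> v i <= v j) -> simplex m (time_point T v).
Proof.
move=> vv i j /vv vij; rewrite /time_point !val_seg_of /clamp.
by apply: le_max2 => //; apply: le_min2 => //; rewrite lerD2r.
Qed.

Definition vec (l : seq R) : 'I_m -> R := fun i => nth 0 l i.

End AntiSymmetry.

Lemma delay_constants (R : realType) (alpha beta : R -> R) (sigma a B : R) :
  loc_integrable alpha ->
  (forall t1 t2 : R, t1 <= t2 -> exists beta1 beta2 : R, 0 < beta1 /\
     {ae lebesgue_measure, forall t : R, t1 <= t <= t2 ->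
        beta1 <= sigma * beta t <= beta2}) ->
  a <= B -> exists (E : R -> R) (b1 b2 e1 e2 : R), [/\ gauge alpha a E, 0 < b1, b1 <= b2,
    {ae lebesgue_measure, forall t : R, a <= t <= B -> b1 <= sigma * beta t <= b2} &
    [/\ 0 < e1, e1 <= e2 & forall t, a <= t <= B -> e1 <= E t <= e2]].
Proof.
move=> la hb aB; have [E gE] := gauge_exists a la.
have [e1 [e2 eP]] := gauge_bounds gE B; have [b1 [b2 [b10 bP]]] := hb a B aB.
exists E, b1, (Num.max b1 b2), e1, e2; split=> //; first by rewrite le_max lexx.
  move: bP; apply: filterS; first exact: (ae_filter_ringOfSetsType lebesgue_measure).
  by move=> t bt /bt /andP[-> ?]; rewrite le_max; apply/orP; right.
case: eP => e10 eP; split=> //.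
by have /andP[+] := eP a (introT andP (conj (lexx a) aB)); exact: le_trans.
Qed.

(** * The wedge process in three times *)

Section ThreeWedge.
Context {R : realType} {alpha beta : R -> R}.
Context {U : R -> R -> Xsp R -> Xsp R} {W : R -> R -> wedge R 3 -> wedge R 3}.
Hypothesis pU : linear_process U.
Hypothesis genU : generated_by alpha beta U.
Hypothesis UW : forall t tau : R, tau <= t -> is_wedge_power (U t tau) (W t tau).

Let i0 : 'I_3 := ord0.
Let i1 : 'I_3 := lift ord0 ord0.
Let i2 : 'I_3 := lift ord0 (lift ord0 ord0).

Let ord3P (P : 'I_3 -> Prop) : P i0 -> P i1 -> P i2 -> forall i, P i.
Proof.
move=> P0 P1 P2 [[|[|[|//]]] h].
- by have -> : Ordinal h = i0 by apply/val_inj.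
- by have -> : Ordinal h = i1 by apply/val_inj.
- by have -> : Ordinal h = i2 by apply/val_inj.
Qed.

Let window3 (T p s t : R) : T - 1 <= p <= T -> T - 1 <= s <= T -> T - 1 <= t <= T ->
  window T (vec (m := 3) [:: p; s; t]).
Proof. by move=> h0 h1 h2; apply: ord3P. Qed.

Let updr3 (p s t r : R) : updr (vec [:: p; s; t]) i2 r = vec [:: p; s; r].
Proof. by apply/funext; apply: ord3P. Qed.

(* Any admissible window contains the same information, by [wval_window]; the one
   ending at [max t tau] is always admissible. *)
Definition w3 (tau : R) (u : wedge R 3) (p s t : R) : R :=
  wval (W := W) (tau := tau) (f := u) (Num.max t tau) (vec [:: p; s; t]).

Context {tau : R} {u : wedge R 3}.
Notation w := (w3 tau u).
Notation wv := (wval (W := W) (tau := tau) (f := u)).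

Let wvE (T p s t : R) : tau <= T -> tau - 1 <= p -> p <= s -> s <= t -> t <= p + 1 ->
  T - 1 <= p -> t <= T -> wv T (vec [:: p; s; t]) = w p s t.
Proof.
move=> h1 h2 h3 h4 h5 h6 h7; apply: (wval_window genU UW) => //.
- by rewrite le_max lexx orbT.
- by apply: window3; apply/andP; split; lra.
- have q1 : Num.max t tau - 1 <= p by rewrite lerBlDr ge_max; apply/andP; split; lra.
  have q2 : t <= Num.max t tau by rewrite le_max lexx.
  by apply: window3; apply/andP; split; lra.
Qed.

Lemma w3_wedge (T : R) (th : cube R 3) : tau <= T -> simplex 3 th ->
  W T tau u th = w (T + \val (th i0)) (T + \val (th i1)) (T + \val (th i2)).
Proof.
move=> tT sth; have h i := seg_bounds (th i).
have [/andP[h01 h02] /andP[h11 h12] /andP[h21 h22]] := And3 (h i0) (h i1) (h i2).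
have l01 : \val (th i0) <= \val (th i1) by exact: sth.
have l12 : \val (th i1) <= \val (th i2) by exact: sth.
rewrite -(@wvE T); try lra.
rewrite /wval; congr (csp_fun _ _); apply/funext => i.
rewrite /time_point -[LHS]seg_of_val; congr seg_of.
by move: i; apply: ord3P; rewrite /vec /= addrAC subrr add0r.
Qed.

(** The cycle is a product of two transpositions, so the two sign changes cancel. *)
Let wv_cycle (T p s r : R) : wv T (vec [:: p; s; r]) = wv T (vec [:: r; p; s]).
Proof.
pose th : cube R 3 := time_point T (vec [:: r; p; s]).
have := wedge_swap (W T tau u) (fun k => th (tperm i0 i1 k)) (isT : i1 != i2).
rewrite (wedge_swap (W T tau u) th (isT : i0 != i1)) opprK => h.
rewrite /wval -[RHS]h; congr (csp_fun _ _); apply/funext; apply: ord3P.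
- by rewrite (tpermD (x := i1) (y := i2))// tpermL.
- by rewrite tpermL (tpermD (x := i0) (y := i1)).
- by rewrite tpermR tpermR.
Qed.

Let w_diag1 (p s : R) : w p s s = 0.
Proof. by apply: (@wedge_diag _ _ _ _ i1 i2). Qed.

Section Bounds.
Context {a B b1 b2 e1 e2 : R} {E : R -> R}.
Hypotheses (gE : gauge alpha a E) (b10 : 0 < b1) (b12 : b1 <= b2) (e10 : 0 < e1) (e12 : e1 <= e2).
Hypothesis betab : {ae lebesgue_measure, forall t : R, a <= t <= B ->
  b1 <= (-1) * beta t <= b2}.
Hypothesis Eb : forall t : R, a <= t <= B -> e1 <= E t <= e2.
Hypothesis a_tau : a + 1 <= tau.

Definition g3 (p s t : R) : R := E p * E s * E t * w p s t.

Let sigma2 : (-1) * (-1) = 1 :> R. Proof. by rewrite mulrNN mulr1. Qed.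

Let Egt0 t : 0 < E t. Proof. exact: (gauge_gt0 gE). Qed.

(** The placeholder [0] is overwritten by [updr]. The window ending at [max s tau] contains the
    delayed time [r - 1], because its end is at most [t0 <= r]. The delayed triple is cycled into
    increasing order without a change of sign. *)
Let wv_inc (p s t0 t : R) : tau - 1 <= p -> p <= s -> s <= t0 ->
  tau <= t0 -> t0 <= t -> t <= p + 1 -> t <= B ->
  exists T', [/\ tau <= T',
    forall r, t0 <= r <= t -> window t (updr (vec (m := 3) [:: p; s; 0]) i2 r),
    forall r, t0 <= r <= t -> window T' (updr (vec (m := 3) [:: p; s; 0]) i2 (r - 1)),
    wv t (updr (vec [:: p; s; 0]) i2 t) = w p s t /\
    wv t (updr (vec [:: p; s; 0]) i2 t0) = w p s t0 &
    forall r, t0 <= r <= t -> - (-1) * (E (r - 1) * wv T' (updr (vec [:: p; s; 0]) i2 (r - 1))) =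
      E (r - 1) * w (r - 1) p s].
Proof.
move=> h1 h2 h3 h4 h5 h6 h7; exists (Num.max s tau); split.
- by rewrite le_max lexx orbT.
- by move=> r /andP[r1 r2]; rewrite updr3; apply: window3; apply/andP; split; lra.
- move=> r /andP[r1 r2]; rewrite updr3.
  have q1 : Num.max s tau <= t0 by rewrite ge_max h3 h4.
  have q2 : s <= Num.max s tau by rewrite le_max lexx.
  by apply: window3; apply/andP; split; lra.
- by rewrite !updr3; split; apply: wvE; lra.
- move=> r /andP[r1 r2]; rewrite updr3 opprK mul1r wv_cycle.
  by [].
Qed.

(** Only the last time varies, so [E p * E s] is a constant factor: the bound [c] is divided by it
    before the increment estimate and multiplied back afterwards. *)
Lemma g3_lower (p s t0 t c : R) : tau - 1 <= p -> p <= s -> s <= t0 ->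
  tau <= t0 -> t0 <= t -> t <= p + 1 -> t <= B -> 0 <= c ->
  (forall r, t0 <= r -> r <= t -> c <= g3 (r - 1) p s) ->
  b1 * (e1 / e2) * c * (t - t0) <= g3 p s t - g3 p s t0.
Proof.
move=> h1 h2 h3 h4 h5 h6 h7 c0 low.
have [T' [k1 k2 k3 [k4 k5] k6]] := wv_inc h1 h2 h3 h4 h5 h6 h7.
have Eps : 0 < E p * E s by rewrite mulr_gt0.
have c0' : 0 <= c / (E p * E s) by rewrite divr_ge0// ltW.
have := wval_increment_ge pU genU UW (f := u) gE sigma2 b10 b12 e10 betab Eb a_tau
  (le_trans h4 h5) k1 h4 h5 h7 k2 k3 c0'.
rewrite k4 k5 => inc.
have -> : g3 p s t - g3 p s t0 = E p * E s * (E t * w p s t - E t0 * w p s t0).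
  by rewrite /g3; ring.
have -> : b1 * (e1 / e2) * c * (t - t0) =
    E p * E s * (b1 * (e1 / e2) * (c / (E p * E s)) * (t - t0)).
  by rewrite -[c in LHS](divfK (lt0r_neq0 Eps)); ring.
rewrite ler_pM2l//; apply: inc => r tr; rewrite k6// ler_pdivrMr//.
have /andP[tr1 tr2] := tr.
by apply: le_trans (low _ tr1 tr2) _; rewrite /g3 le_eqVlt; apply/orP; left; apply/eqP; ring.
Qed.

Lemma g3_upper (p s t0 t c : R) : tau - 1 <= p -> p <= s -> s <= t0 ->
  tau <= t0 -> t0 <= t -> t <= p + 1 -> t <= B -> 0 <= c ->
  (forall r, t0 <= r -> r <= t -> g3 (r - 1) p s <= c) ->
  g3 p s t - g3 p s t0 <= b2 * (e2 / e1) * c * (t - t0).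
Proof.
move=> h1 h2 h3 h4 h5 h6 h7 c0 up.
have [T' [k1 k2 k3 [k4 k5] k6]] := wv_inc h1 h2 h3 h4 h5 h6 h7.
have Eps : 0 < E p * E s by rewrite mulr_gt0.
have c0' : 0 <= c / (E p * E s) by rewrite divr_ge0// ltW.
have := wval_increment_le pU genU UW (f := u) gE sigma2 b10 b12 e10 betab Eb a_tau
  (le_trans h4 h5) k1 h4 h5 h7 k2 k3 c0'.
rewrite k4 k5 => inc.
have -> : g3 p s t - g3 p s t0 = E p * E s * (E t * w p s t - E t0 * w p s t0).
  by rewrite /g3; ring.
have -> : b2 * (e2 / e1) * c * (t - t0) =
    E p * E s * (b2 * (e2 / e1) * (c / (E p * E s)) * (t - t0)).
  by rewrite -[c in LHS](divfK (lt0r_neq0 Eps)); ring.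
rewrite ler_pM2l//; apply: inc => r tr; rewrite k6// ler_pdivlMr//.
have /andP[tr1 tr2] := tr.
by apply: le_trans (up _ tr1 tr2); rewrite /g3 le_eqVlt; apply/orP; left; apply/eqP; ring.
Qed.

Lemma g3_diag (p s : R) : g3 p s s = 0.
Proof. by rewrite /g3 w_diag1 mulr0. Qed.

Lemma g3_init (p s t : R) : linear_process W -> Kcone 3 u ->
  tau - 1 <= p -> p <= s -> s <= t -> t <= tau -> 0 <= g3 p s t.
Proof.
move=> pW Ku h1 h2 h3 h4; apply: mulr_ge0; first by rewrite !mulr_ge0// ltW.
rewrite /w3 max_r// /wval (process_id pW); apply: (Ku (time_point tau _)).
apply: time_point_simplex.
apply: ord3P; apply: ord3P => //= _; rewrite /vec /=; lra.
Qed.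

Let pW : linear_process W := wedge_linear_process pU UW.

Lemma w3_continuous : continuous (fun z : R * R * R => w z.1.1 z.1.2 z.2).
Proof.
have cfst (A C : topologicalType) : continuous (fst : A * C -> A).
  by move=> z; exact: cvg_fst.
have csnd (A C : topologicalType) : continuous (snd : A * C -> C).
  by move=> z; exact: cvg_snd.
apply: (@wval_continuous R 3 W pW (R * R * R)%type u snd (cst tau)
  (fun z => vec [:: z.1.1; z.1.2; z.2])).
- exact: csnd.
- exact: cst_continuous.
- apply: ord3P => z /=.
  + exact: (continuous_comp (cfst _ _ z) (cfst _ _ z.1)).
  + exact: (continuous_comp (cfst _ _ z) (csnd _ _ z.1)).
  + exact: csnd.
Qed.

Let Ege (t : R) : tau - 1 <= t -> t <= B -> e1 <= E t.
Proof.
move: (a_tau) => h h1 h2; have /andP[//] : e1 <= E t <= e2.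
by apply: Eb; apply/andP; split; lra.
Qed.

Lemma g3_gt0E (p s t : R) : (0 < g3 p s t) = (0 < w p s t).
Proof. by rewrite /g3 pmulr_rgt0// !mulr_gt0. Qed.

Lemma g3_ge0E (p s t : R) : (0 <= g3 p s t) = (0 <= w p s t).
Proof. by rewrite /g3 pmulr_rge0// !mulr_gt0. Qed.

Lemma g3_ge (p s t k : R) : tau - 1 <= p -> p <= s -> s <= t -> t <= B ->
  0 <= k -> k <= w p s t -> e1 ^+ 3 * k <= g3 p s t.
Proof.
move=> h1 h2 h3 h4 k0 kw; have e0 := ltW e10.
have Ep : e1 <= E p by apply: Ege; lra.
have Es : e1 <= E s by apply: Ege; lra.
have Et : e1 <= E t by apply: Ege; lra.
by rewrite /g3 !exprS expr0 mulr1 mulrA; apply: ler_pM => //; rewrite ?mulr_ge0//;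
  apply: ler_pM => //; rewrite ?mulr_ge0//; apply: ler_pM.
Qed.

Lemma g3_open (p s t : R) : tau - 1 <= p -> p <= s -> s <= t -> t <= p + 1 ->
  t <= B -> 0 < g3 p s t -> exists2 d, 0 < d & forall p' s' t',
  tau - 1 <= p' -> p' <= s' -> s' <= t' -> t' <= p' + 1 -> t' <= B ->
  `|p' - p| < d -> `|s' - s| < d -> `|t' - t| < d -> d <= g3 p' s' t'.
Proof.
rewrite g3_gt0E => h1 h2 h3 h4 h5 w0.
have w2 : 0 < w p s t / 2 by rewrite divr_gt0.
have /cvgrPdist_le/(_ _ w2)/nbhs_ballP[r /= r0 rP] := @w3_continuous (p, s, t).
pose d := Num.min r (e1 ^+ 3 * (w p s t / 2)).
exists d; first by rewrite lt_min r0 mulr_gt0// exprn_gt0.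
have dr x y : `|y - x| < d -> ball x r y.
  rewrite lt_min => /andP[+ _]; by rewrite -ball_normE /= distrC.
move=> p' s' t' k1 k2 k3 k4 k5 /dr q1 /dr q2 /dr q3.
have := rP (p', s', t') (conj (conj q1 q2) q3) => /=.
rewrite ler_norml => /andP[_ wle].
apply: le_trans (_ : e1 ^+ 3 * (w p s t / 2) <= _).
  by rewrite ge_min lexx orbT.
by apply: g3_ge => //; [exact: ltW|lra].
Qed.

Hypothesis Ku : Kcone 3 u.

Let c1 : 0 < b1 * (e1 / e2).
Proof. by rewrite mulr_gt0 ?divr_gt0//; exact: lt_le_trans e12. Qed.

Lemma g3_ge0 (p s t : R) : tau - 1 <= p -> p <= s -> s <= t -> t <= p + 1 ->
  t <= B -> 0 <= g3 p s t.
Proof.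
apply: (three_ge0 (b1 := b1 * (e1 / e2))).
- by move=> *; exact: g3_init.
- by move=> *; exact: g3_diag.
- exact: g3_lower.
Qed.

Hypothesis u0 : u <> 0.

(** A nonzero cone element is nonzero, hence positive, at some point of the simplex, and the times
    there are distinct because it vanishes when two coincide. *)
Lemma g3_gt0_init : exists p s t, [/\ tau - 1 <= p, p < s, s < t, t <= tau & 0 < g3 p s t].
Proof.
have [th sth uth] : exists2 th, simplex 3 th & u th != 0.
  apply: contrapT => H; apply: u0; apply: wedge_eq0 => th sth.
  by apply/eqP; apply: contrapT => /negP h; apply: H; exists th.
pose v i := tau + \val (th i).
have thE : time_point tau v = th.
  by apply/funext => i; rewrite /time_point /v addrAC subrr add0r seg_of_val.
have vE : v = vec [:: v i0; v i1; v i2] by apply/funext; apply: ord3P.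
have vb i : tau - 1 <= v i <= tau.
  by have /andP[? ?] := seg_bounds (th i); apply/andP; split; rewrite /v; lra.
have /andP[v01 v02] := vb i0; have /andP[v11 v12] := vb i1.
have /andP[v21 v22] := vb i2.
have v_le (i j : 'I_3) : (i <= j)%N -> v i <= v j by move=> /sth; rewrite lerD2l.
have l01 : v i0 <= v i1 by exact: v_le.
have l12 : v i1 <= v i2 by exact: v_le.
have wu : w (v i0) (v i1) (v i2) = u th.
  by rewrite /w3 max_r// -vE /wval (process_id pW) thE.
have wne0 : w (v i0) (v i1) (v i2) != 0 by rewrite wu.
exists (v i0), (v i1), (v i2); split=> //.
- rewrite lt_neqAle l01 andbT; apply: contra_neq uth => v01E.
  apply: (@wedge_diag _ _ _ _ i0 i1) => //; apply/val_inj.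
  by move/addrI : v01E.
- rewrite lt_neqAle l12 andbT; apply: contra_neq uth => v12E.
  apply: (@wedge_diag _ _ _ _ i1 i2) => //; apply/val_inj.
  by move/addrI : v12E.
- by rewrite g3_gt0E lt_neqAle eq_sym wne0 /= wu; exact: Ku.
Qed.

Let g3_exists (c : R) : tau + 1 <= c -> c <= B ->
  exists p s, [/\ c - 1 <= p, p < s, s < c & 0 < g3 p s c].
Proof.
have [p [s [t [h1 h2 h3 h4 gt0]]]] := g3_gt0_init.
apply: (three_exists c1 _ _ _ _ h1 h2 h3 h4 gt0).
- by move=> *; exact: g3_init.
- by move=> *; exact: g3_diag.
- exact: g3_lower.
- exact: g3_open.
Qed.

Lemma w3_end (c s : R) : tau + 3 <= c -> c <= B -> c - 1 < s -> s < c ->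
  0 < w (c - 1) s c.
Proof.
move=> h1 h2 h3 h4; rewrite -g3_gt0E.
apply: (three_end c1 _ _ _ _ g3_exists h1 h2 h3 h4).
- by move=> *; exact: g3_init.
- by move=> *; exact: g3_diag.
- exact: g3_lower.
- exact: g3_open.
Qed.

Lemma w3_gt0 (p s t : R) : tau + 3 <= s -> s - 1 < p -> p < s -> s < t -> t <= p + 1 ->
  t <= B -> 0 < w p s t.
Proof.
move=> h1 h2 h3 h4 h5 h6; rewrite -g3_gt0E.
apply: (three_gt0 c1 _ _ _ _ g3_exists h1 h2 h3 h4 h5 h6).
- by move=> *; exact: g3_init.
- by move=> *; exact: g3_diag.
- exact: g3_lower.
- exact: g3_open.
Qed.

End Bounds.

End ThreeWedge.

(** * Uniform bounds by compactness *)

Lemma continuous_pair (X Y1 Y2 : topologicalType) (f : X -> Y1) (g : X -> Y2) :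
  continuous f -> continuous g -> continuous (fun x => (f x, g x)).
Proof. by move=> cf cg x; exact: (cvg_pair (cf x) (cg x)). Qed.

Lemma continuous_compT (X Y1 Y2 : topologicalType) (f : X -> Y1) (g : Y1 -> Y2) :
  continuous f -> continuous g -> continuous (fun x => g (f x)).
Proof. by move=> cf cg x; exact: (continuous_comp (cf x) (cg (f x))). Qed.

(** Positivity on the slice [h = 0] spreads to a slab, one [d] being both its thickness and the
    lower bound. It is used where positivity is known for tuples spanning exactly one unit of time
    and is needed for slightly shorter ones. *)
Lemma compact_thick (R : realType) (X : topologicalType) (K : set X) (f : X * R -> R) :
  compact K -> continuous f -> (forall x, K x -> 0 < f (x, 0)) ->
  exists2 d, 0 < d & forall x h, K x -> 0 <= h -> h <= d -> d <= f (x, h).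
Proof.
move=> cK cf f0.
have : \forall d \near (0 : R)^'+, K `<=` [set x | forall h, 0 <= h -> h <= d -> d <= f (x, h)].
  apply: (iffLR (compact_near_coveringP K) cK) => x Kx.
  have y2 : 0 < f (x, 0) / 2 by rewrite divr_gt0// f0.
  have /cvgrPdist_le/(_ _ y2)[[A C] /= [xA C0] AC] := cf (x, 0).
  have /nbhs_ballP[r /= r0 rC] := C0.
  near=> x' d.
  have Ax : A x' by near: x'.
  have dr : d < r by near: d; exact: nbhs_right_lt.
  have dy : d <= f (x, 0) / 2 by near: d; exact: nbhs_right_le.
  move=> h h0 hd /=.
  have Ch : C h.
    by apply: rC; rewrite -ball_normE /= sub0r normrN ger0_norm// (le_lt_trans hd).
  have := AC (x', h) (conj Ax Ch); rewrite /= ler_norml => /andP[_ fh].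
  by move: dy => /=; lra.
move=> [e /= e0 eP]; exists (e / 2); first by rewrite divr_gt0.
move=> x h Kx h0 hd; apply: (eP (e / 2)) => //=.
  by rewrite sub0r normrN gtr0_norm ?divr_gt0//; lra.
by rewrite divr_gt0.
Unshelve. all: by end_near. Qed.

Lemma compact_pos (R : realType) (X : topologicalType) (K : set X) (f : X -> R) :
  compact K -> continuous f -> (forall x, K x -> 0 < f x) ->
  exists2 d, 0 < d & forall x, K x -> d <= f x.
Proof.
move=> cK cf f0.
have [|//|d d0 dP] := @compact_thick R X K (fun z => f z.1) cK.
  move=> z; apply: (@continuous_comp (X * R)%type X R fst f); first exact: cvg_fst.
  exact: cf.
by exists d => // x Kx; apply: (dP x 0) => //; exact: ltW.
Qed.

Lemma compact_upper (R : realType) (X : topologicalType) (K : set X) (f : X -> R) :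
  compact K -> continuous f -> exists2 M, 0 <= M & forall x, K x -> f x <= M.
Proof.
move=> cK cf; have [->|/set0P K0] := eqVneq K set0; first by exists 0.
have [c _ cP] := compact_EVT_max K0 cK (continuous_subspaceT cf).
exists (Num.max 0 (f c)); first by rewrite le_max lexx.
by move=> x /mem_set /cP fx; rewrite le_max fx orbT.
Qed.

Lemma closed_le_fun (R : realType) (X : topologicalType) (f g : X -> R^o) :
  continuous f -> continuous g -> closed [set x | f x <= g x].
Proof.
move=> cf cg.
have -> : [set x | f x <= g x] = (fun x => g x - f x : R^o) @^-1` [set y | 0 <= y].
  by apply/seteqP; split => x /=; rewrite subr_ge0.
apply: preimage_closed; last exact: closed_ge.
by move=> x _; exact: csp_ctsB.
Qed.

Section Uniform3.
Context {R : realType} {alpha beta : R -> R}.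
Context {U : R -> R -> Xsp R -> Xsp R} {W : R -> R -> wedge R 3 -> wedge R 3}.
Hypothesis pU : linear_process U.
Hypothesis genU : generated_by alpha beta U.
Hypothesis UW : forall t tau : R, tau <= t -> is_wedge_power (U t tau) (W t tau).
Hypothesis intalpha : loc_integrable alpha.
Hypothesis beta_bounds : forall t1 t2 : R, t1 <= t2 -> exists beta1 beta2 : R,
  0 < beta1 /\ {ae lebesgue_measure, forall t : R, t1 <= t <= t2 ->
    beta1 <= (-1) * beta t <= beta2}.

Lemma w3_ge0 (tau : R) (u : wedge R 3) (p s t : R) : Kcone 3 u ->
  tau - 1 <= p -> p <= s -> s <= t -> t <= p + 1 -> 0 <= w3 (W := W) tau u p s t.
Proof.
move=> Ku h1 h2 h3 h4.
have aB : tau - 2 <= Num.max tau t by rewrite le_max; apply/orP; left; lra.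
have [E [b1 [b2 [e1 [e2 [gE b10 b12 bP [e10 e12 eP]]]]]]] :=
  delay_constants intalpha beta_bounds aB.
have a_tau : tau - 2 + 1 <= tau by lra.
rewrite -(g3_ge0E gE) (g3_ge0 pU genU UW gE b10 b12 e10 bP eP a_tau Ku)//.
by rewrite le_max lexx orbT.
Qed.

Let Z := (R * R * R * R)%type.
Let Phi (u : wedge R 3) (z : Z) : R := w3 (W := W) z.1.1.1 u z.1.1.2 z.1.2 z.2.

Let c1 (X1 X2 : topologicalType) : continuous (fst : X1 * X2 -> X1).
Proof. by move=> z; exact: cvg_fst. Qed.
Let c2 (X1 X2 : topologicalType) : continuous (snd : X1 * X2 -> X2).
Proof. by move=> z; exact: cvg_snd. Qed.

Let Phi_continuous u : continuous (Phi u).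
Proof.
have ct : continuous (fun z : Z => z.1.1.1).
  exact (continuous_compT (continuous_compT (@c1 _ _) (@c1 _ _)) (@c1 _ _)).
have cp : continuous (fun z : Z => z.1.1.2).
  exact (continuous_compT (continuous_compT (@c1 _ _) (@c1 _ _)) (@c2 _ _)).
have cs : continuous (fun z : Z => z.1.2).
  exact (continuous_compT (@c1 _ _) (@c2 _ _)).
have cz : continuous (fun z : Z => z.2) by exact: c2.
apply: (@wval_continuous R 3 W (wedge_linear_process pU UW) Z u snd (fun z => z.1.1.1)
  (fun z => vec [:: z.1.1.2; z.1.2; z.2])) => //.
move=> [[|[|[|//]]] h]; [exact: cp|exact: cs|exact: cz].
Qed.

Definition u3 (p s t : R) : R := (t - s) * (s - p) * (t - p) * (1 + p - s).

Lemma prod3_bounds (x y z l h : R) : 0 <= l -> l <= x <= h -> l <= y <= h ->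
  l <= z <= h -> l ^+ 3 <= x * y * z <= h ^+ 3.
Proof.
move=> l0 /andP[lx xh] /andP[ly yh] /andP[lz zh].
have [x0 y0 z0] := And3 (le_trans l0 lx) (le_trans l0 ly) (le_trans l0 lz).
have E3 r : r ^+ 3 = r * r * r :> R by rewrite !exprSr expr0 mul1r.
by rewrite !E3; apply/andP; split; apply: ler_pM => //;
  [exact: mulr_ge0|exact: ler_pM|exact: mulr_ge0|exact: ler_pM].
Qed.

Lemma w3_two_sided (u : wedge R 3) (tau1 tau2 B : R) : Kcone 3 u -> u <> 0 ->
  tau1 <= tau2 -> tau2 <= B ->
  exists C1 C2 : R, [/\ 0 < C1, 0 < C2 & forall tau p s t : R, tau1 <= tau -> tau <= tau2 ->
    tau + 4 <= p -> p <= s -> s <= t -> t <= p + 1 -> t <= B ->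
    C1 * u3 p s t <= w3 (W := W) tau u p s t <= C2 * u3 p s t].
Proof.
move=> Ku u0 t12 t2B.
have aB : tau1 - 2 <= B by lra.
have [E [b1 [b2 [e1 [e2 [gE b10 b12 bP [e10 e12 eP]]]]]]] :=
  delay_constants intalpha beta_bounds aB.
have e20 : 0 < e2 := lt_le_trans e10 e12.
have b20 : 0 < b2 := lt_le_trans b10 b12.
have a_tau tau : tau1 <= tau -> tau1 - 2 + 1 <= tau by move=> ?; lra.
have EB tau x : tau1 <= tau -> tau - 1 <= x -> x <= B -> e1 <= E x <= e2.
  by move=> ? ? ?; apply: eP; apply/andP; split; lra.
pose itv : set R := `[tau1 - 2, B]%classic.
have itvP x : tau1 - 2 <= x -> x <= B -> itv x by move=> ? ?; rewrite /itv/= in_itv/=; apply/andP.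
have itvt : compact (`[tau1, tau2]%classic : set R) by exact: segment_compact.
have citv : compact itv by exact: segment_compact.
(* Triples of length one with a central middle time, thickened to lengths down to [1 - d]. The
   starting time is a coordinate of the compact set, so [d] does not depend on it. *)
have [d d0 dP] : exists2 d, 0 < d & forall tau c s h : R, tau1 <= tau -> tau <= tau2 ->
    tau + 3 <= c -> c <= B -> c - 2 / 3 <= s -> s <= c - 1 / 3 -> 0 <= h -> h <= d ->
    d <= w3 (W := W) tau u (c - 1 + h) s c.
  pose K : set (R * R * R) := (`[tau1, tau2]%classic `*` itv `*` itv) `&`
    [set z | z.1.1 + 3 <= z.1.2] `&` [set z | z.1.2 - 2 / 3 <= z.2] `&`
    [set z | z.2 <= z.1.2 - 1 / 3].
  have q1 : continuous (fun z : R * R * R => z.1.1 : R^o).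
    exact (continuous_compT (@c1 _ _) (@c1 _ _)).
  have q2 : continuous (fun z : R * R * R => z.1.2 : R^o).
    exact (continuous_compT (@c1 _ _) (@c2 _ _)).
  have q3 : continuous (fun z : R * R * R => z.2 : R^o) by exact: c2.
  have cst (X : topologicalType) (x : R) : continuous (fun _ : X => x : R^o).
    exact: cst_continuous.
  have cK : compact K.
    have k1 := closed_le_fun (csp_ctsD q1 (cst _ 3)) q2.
    have k2 := closed_le_fun (csp_ctsB q2 (cst _ (2 / 3))) q3.
    have k3 := closed_le_fun q3 (csp_ctsB q2 (cst _ (1 / 3))).
    have k0 := compact_setX (compact_setX itvt citv) citv.
    exact (compact_closedI (compact_closedI (compact_closedI k0 k1) k2) k3).
  pose f (y : (R * R * R) * R) : R := Phi u (y.1.1.1, y.1.1.2 - 1 + y.2, y.1.2, y.1.1.2).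
  have cf : continuous f.
    have r1 : continuous (fun y : (R * R * R) * R => y.1.1.1 : R^o).
      exact (continuous_compT (@c1 _ _) q1).
    have r2 : continuous (fun y : (R * R * R) * R => y.1.1.2 : R^o).
      exact (continuous_compT (@c1 _ _) q2).
    have r3 : continuous (fun y : (R * R * R) * R => y.1.2 : R^o).
      exact (continuous_compT (@c1 _ _) q3).
    have r4 : continuous (fun y : (R * R * R) * R => y.2 : R^o) by exact: c2.
    have rr := continuous_pair (continuous_pair (continuous_pair r1
      (csp_ctsD (csp_ctsB r2 (cst _ 1)) r4)) r3) r2.
    exact (continuous_compT rr (@Phi_continuous u)).
  have [|d d0 dP] := compact_thick cK cf.
    move=> [[tau c] s] [[[[[/= h1 h2] h3] h4] h5] h6]; rewrite /f /Phi /= addr0.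
    move: h1 h2 h3; rewrite /itv /= !in_itv/= => /andP[h11 h12] /andP[h21 h22] /andP[h31 h32].
    by apply: (w3_end pU genU UW gE b10 b12 e10 e12 bP eP (a_tau _ h11) Ku u0) => //; lra.
  exists d => // tau c s h h1 h2 h3 h4 h5 h6 h7 h8.
  apply: (dP (tau, c, s) h) => //.
  have i1 : `[tau1, tau2]%classic tau by rewrite /= in_itv/= h1.
  have i2 : itv c by apply: itvP; lra.
  have i3 : itv s by apply: itvP; lra.
  by split; [split; [split|]|].
pose D := Num.min d (1 / 10).
have D0 : 0 < D by rewrite lt_min d0; lra.
have D1 : D <= 1 / 10 by rewrite ge_min lexx orbT.
have Dd : D <= d by rewrite ge_min lexx.
have q1 : continuous (fun z : Z => z.1.1.1 : R^o).
  exact (continuous_compT (continuous_compT (@c1 _ _) (@c1 _ _)) (@c1 _ _)).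
have q2 : continuous (fun z : Z => z.1.1.2 : R^o).
  exact (continuous_compT (continuous_compT (@c1 _ _) (@c1 _ _)) (@c2 _ _)).
have q3 : continuous (fun z : Z => z.1.2 : R^o).
  exact (continuous_compT (@c1 _ _) (@c2 _ _)).
have q4 : continuous (fun z : Z => z.2 : R^o) by exact: c2.
have cst (x : R) : continuous (fun _ : Z => x : R^o) by exact: cst_continuous.
pose box : set Z := `[tau1, tau2]%classic `*` itv `*` itv `*` itv.
have cbox : compact box.
  exact (compact_setX (compact_setX (compact_setX itvt citv) citv) citv).
have boxP tau p s t : tau1 <= tau -> tau <= tau2 -> tau1 - 2 <= p -> p <= B ->
    tau1 - 2 <= s -> s <= B -> tau1 - 2 <= t -> t <= B -> box (tau, p, s, t).
  move=> h1 h2 h3 h4 h5 h6 h7 h8; do 3 (split; last exact: itvP).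
  by rewrite /= in_itv/= h1.
(* Triples with gaps at least [D / 40] form a compact set on which positivity is strict. *)
have [k k0 kP] : exists2 k, 0 < k & forall tau p s t : R, tau1 <= tau -> tau <= tau2 ->
    tau + 3 <= s -> t - 1 <= p -> p + D / 40 <= s -> s + D / 40 <= t -> t <= B ->
    k <= w3 (W := W) tau u p s t.
  pose K : set Z := box `&`
    [set z | z.1.1.1 + 3 <= z.1.2] `&` [set z | z.2 - 1 <= z.1.1.2] `&`
    [set z | z.1.1.2 + D / 40 <= z.1.2] `&` [set z | z.1.2 + D / 40 <= z.2].
  have cK : compact K.
    have k1 := closed_le_fun (csp_ctsD q1 (cst 3)) q3.
    have k2 := closed_le_fun (csp_ctsB q4 (cst 1)) q2.
    have k3 := closed_le_fun (csp_ctsD q2 (cst (D / 40))) q3.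
    have k4 := closed_le_fun (csp_ctsD q3 (cst (D / 40))) q4.
    exact (compact_closedI (compact_closedI (compact_closedI
      (compact_closedI cbox k1) k2) k3) k4).
  have [|k k0 kP] := compact_pos cK (@Phi_continuous u).
    move=> [[[tau p] s] t] [[[[[[[/= h1 h2] h3] h4] h5] h6] h7] h8]; rewrite /Phi /=.
    move: h1 h4; rewrite /itv /= !in_itv/= => /andP[h11 h12] /andP[h41 h42].
    by apply: (w3_gt0 pU genU UW gE b10 b12 e10 e12 bP eP (a_tau _ h11) Ku u0) => //;
      clear -h11 h12 h41 h42 h2 h3 h5 h6 h7 h8 D0; lra.
  exists k => // tau p s t h1 h2 h3 h4 h5 h6 h7.
  apply: (kP (tau, p, s, t)).
  by split; [split; [split; [split|]|]|] => //=; apply: boxP;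
    clear -t12 t2B h1 h2 h3 h4 h5 h6 h7 D0; lra.
have [M M0 MP] := compact_upper cbox (@Phi_continuous u).
(* The three gauge factors turn a lower bound on [w3] into one on [g3] at the cost of [e1 ^+ 3];
   [Num.min d k] serves both kinds of triples. Below, the summand [1] in [CM] keeps the upper
   constant positive when [M = 0]. *)
pose kappa := e1 ^+ 3 * Num.min d k.
pose CM := (b2 * (e2 / e1)) ^+ 4 * (e2 ^+ 3 * M) + 1.
have pos : [/\ 0 < b1 * (e1 / e2), 0 < kappa, 0 <= b2 * (e2 / e1),
    0 <= e2 ^+ 3 * M & 0 < CM].
  have e23M : 0 <= e2 ^+ 3 * M by rewrite mulr_ge0// exprn_ge0// ltW.
  have b2'0 : 0 <= b2 * (e2 / e1) by rewrite ltW// mulr_gt0// divr_gt0.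
  split=> //.
  - by rewrite mulr_gt0// divr_gt0.
  - by rewrite mulr_gt0 ?exprn_gt0// lt_min d0.
  - by rewrite ltr_wpDl// mulr_ge0// exprn_ge0.
exists (three_const (b1 * (e1 / e2)) kappa / e2 ^+ 3), (CM / e1 ^+ 3).
split.
- by case: pos => b1'0 kappa0 _ _ _; rewrite divr_gt0 ?exprn_gt0 ?three_const_gt0.
- by case: pos => _ _ _ _ CM0; rewrite divr_gt0 ?exprn_gt0.
move=> tau p s t h1 h2 h3 h4 h5 h6 h7.
have at1 := a_tau _ h1.
have pos' : 0 <= u3 p s t /\ 0 <= w3 (W := W) tau u p s t.
  by split; [rewrite /u3 !mulr_ge0//|apply: w3_ge0 => //]; clear -t12 t2B h1 h2 h3 h4 h5 h6 h7; lra.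
have F_lower := g3_lower pU genU UW (u := u) gE b10 b12 e10 bP eP at1.
have F_upper := g3_upper pU genU UW (u := u) gE b10 b12 e10 bP eP at1.
have F_ge0 := g3_ge0 pU genU UW gE b10 b12 e10 bP eP at1 Ku.
have F_ge p' s' t' := @g3_ge R W tau u _ B e1 e2 E e10 eP at1 p' s' t'.
have Egt0 := gauge_gt0 gE.
have EEE p' s' t' : tau - 1 <= p' -> p' <= s' -> s' <= t' -> t' <= B ->
    e1 ^+ 3 <= E p' * E s' * E t' <= e2 ^+ 3.
  by move=> l1 l2 l3 l4; apply: prod3_bounds; [exact: ltW|..];
    apply: (EB _ _ h1); clear -t12 t2B h1 h2 h3 h4 h5 h6 h7 l1 l2 l3 l4; lra.
have Epst : e1 ^+ 3 <= E p * E s * E t <= e2 ^+ 3 by apply: EEE;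
  clear -t12 t2B h1 h2 h3 h4 h5 h6 h7; lra.
have lower : three_const (b1 * (e1 / e2)) kappa * u3 p s t <=
    g3 (W := W) (tau := tau) (u := u) (E := E) p s t.
  have [b1'0 kappa0 _ _ _] := pos.
  apply: (three_lower_bound b1'0 F_ge0 F_lower kappa0 D0 D1) => //; clear b1'0 kappa0.
  - move=> x y z l1 l2 l3 l4 l5.
    apply: F_ge; [..|by rewrite ltW// lt_min d0|]; try by
      clear -t12 t2B h1 h2 h3 h4 h5 h6 h7 D0 D1 Dd l1 l2 l3 l4 l5; lra.
    apply: (@le_trans _ _ k); first by rewrite ge_min lexx orbT.
    by apply: kP; clear -t12 t2B h1 h2 h3 h4 h5 h6 h7 D0 D1 Dd l1 l2 l3 l4 l5; lra.
  - move=> x y z l1 l2 l3 l4 l5 l6.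
    apply: F_ge; [..|by rewrite ltW// lt_min d0|]; try by
      clear -t12 t2B h1 h2 h3 h4 h5 h6 h7 D0 D1 Dd l1 l2 l3 l4 l5 l6; lra.
    apply: (@le_trans _ _ d); first by rewrite ge_min lexx.
    have -> : x = z - 1 + (x - (z - 1)) by ring.
    by apply: dP; clear -t12 t2B h1 h2 h3 h4 h5 h6 h7 D0 D1 Dd l1 l2 l3 l4 l5 l6; lra.
have {}upper : g3 (W := W) (tau := tau) (u := u) (E := E) p s t <=
    (b2 * (e2 / e1)) ^+ 4 * (e2 ^+ 3 * M) * u3 p s t.
  have [_ _ b2'0 e23M _] := pos; clear lower.
  apply: (three_upper_bound (tau := tau) (B := B)) => //; clear b2'0 e23M.
  - by move=> *; exact: g3_diag.
  - move=> x y z l1 l2 l3 l4 l5; rewrite /g3.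
    have wM : w3 (W := W) tau u x y z <= M.
      by apply: (MP (tau, x, y, z)); apply: boxP;
        clear -t12 t2B h1 h2 h3 h4 h5 h6 h7 l1 l2 l3 l4 l5; lra.
    have /andP[l6 l7] := EEE x y z l1 l2 l3 l5.
    have xyz0 : 0 <= E x * E y * E z by rewrite !mulr_ge0// ltW.
    by apply: ler_pM => //; apply: w3_ge0.
case: pos pos' Epst => _ _ _ _ CM0 [u30 w0] /andP[l1 l2].
have e13 : 0 < e1 ^+ 3 by rewrite exprn_gt0.
have e23 : 0 < e2 ^+ 3 by rewrite exprn_gt0.
rewrite [X in X <= _ <= _]mulrAC [X in _ <= _ <= X]mulrAC ler_pdivrMr// ler_pdivlMr//.
apply/andP; split.
  by apply: le_trans lower _; rewrite /g3 mulrC ler_wpM2l.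
apply: (@le_trans _ _ (g3 (W := W) (tau := tau) (u := u) (E := E) p s t)).
  by rewrite /g3 mulrC ler_wpM2r.
apply: le_trans upper _; rewrite ler_wpM2r// /CM lerDl//.
Qed.

End Uniform3.

Section TwoWedge.
Context {R : realType} {alpha beta : R -> R}.
Context {U : R -> R -> Xsp R -> Xsp R} {W : R -> R -> wedge R 2 -> wedge R 2}.
Hypothesis pU : linear_process U.
Hypothesis genU : generated_by alpha beta U.
Hypothesis UW : forall t tau : R, tau <= t -> is_wedge_power (U t tau) (W t tau).

Let i0 : 'I_2 := ord0.
Let i1 : 'I_2 := lift ord0 ord0.

Let ord2P (P : 'I_2 -> Prop) : P i0 -> P i1 -> forall i, P i.
Proof.
move=> P0 P1 [[|[|//]] h].
- by have -> : Ordinal h = i0 by apply/val_inj.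
- by have -> : Ordinal h = i1 by apply/val_inj.
Qed.

Let window2 (T s t : R) : T - 1 <= s <= T -> T - 1 <= t <= T ->
  window T (vec (m := 2) [:: s; t]).
Proof. by move=> h0 h1; apply: ord2P. Qed.

Let updr2 (s t r : R) : updr (vec [:: s; t]) i1 r = vec [:: s; r].
Proof. by apply/funext; apply: ord2P. Qed.

Definition w2 (tau : R) (u : wedge R 2) (s t : R) : R :=
  wval (W := W) (tau := tau) (f := u) (Num.max t tau) (vec [:: s; t]).

Context {tau : R} {u : wedge R 2}.
Notation w := (w2 tau u).
Notation wv := (wval (W := W) (tau := tau) (f := u)).

Let wvE (T s t : R) : tau <= T -> tau - 1 <= s -> s <= t -> t <= s + 1 ->
  T - 1 <= s -> t <= T -> wv T (vec [:: s; t]) = w s t.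
Proof.
move=> h1 h2 h4 h5 h6 h7; apply: (wval_window genU UW) => //.
- by rewrite le_max lexx orbT.
- by apply: window2; apply/andP; split; lra.
- have q1 : Num.max t tau - 1 <= s by rewrite lerBlDr ge_max; apply/andP; split; lra.
  have q2 : t <= Num.max t tau by rewrite le_max lexx.
  by apply: window2; apply/andP; split; lra.
Qed.

Lemma w2_wedge (T : R) (th : cube R 2) : tau <= T -> simplex 2 th ->
  W T tau u th = w (T + \val (th i0)) (T + \val (th i1)).
Proof.
move=> tT sth; have h i := seg_bounds (th i).
have /andP[h01 h02] := h i0; have /andP[h11 h12] := h i1.
have l01 : \val (th i0) <= \val (th i1) by exact: sth.
rewrite -(@wvE T); try lra.
rewrite /wval; congr (csp_fun _ _); apply/funext => i.
rewrite /time_point -[LHS]seg_of_val; congr seg_of.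
by move: i; apply: ord2P; rewrite /vec /= addrAC subrr add0r.
Qed.

(** For two times the delayed time moves to the front by one transposition, whose sign cancels that
    of [- beta]. *)
Let wv_swap (T s r : R) : wv T (vec [:: s; r]) = - wv T (vec [:: r; s]).
Proof.
rewrite /wval -(wedge_swap _ _ (isT : i0 != i1)); congr (csp_fun _ _).
apply/funext; apply: ord2P.
- by rewrite tpermL.
- by rewrite tpermR.
Qed.

Let w_diag (s : R) : w s s = 0.
Proof. by apply: (@wedge_diag _ _ _ _ i0 i1). Qed.

Section Bounds.
Context {a B b1 b2 e1 e2 : R} {E : R -> R}.
Hypotheses (gE : gauge alpha a E) (b10 : 0 < b1) (b12 : b1 <= b2) (e10 : 0 < e1)
  (e12 : e1 <= e2).
Hypothesis betab : {ae lebesgue_measure, forall t : R, a <= t <= B ->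
  b1 <= 1 * beta t <= b2}.
Hypothesis Eb : forall t : R, a <= t <= B -> e1 <= E t <= e2.
Hypothesis a_tau : a + 1 <= tau.

Definition g2 (s t : R) : R := E s * E t * w s t.

Let Egt0 t : 0 < E t. Proof. exact: (gauge_gt0 gE). Qed.

Let wv_inc (s t0 t : R) : tau - 1 <= s -> s <= t0 ->
  tau <= t0 -> t0 <= t -> t <= s + 1 -> t <= B ->
  exists T', [/\ tau <= T',
    forall r, t0 <= r <= t -> window t (updr (vec (m := 2) [:: s; 0]) i1 r),
    forall r, t0 <= r <= t -> window T' (updr (vec (m := 2) [:: s; 0]) i1 (r - 1)),
    wv t (updr (vec [:: s; 0]) i1 t) = w s t /\
    wv t (updr (vec [:: s; 0]) i1 t0) = w s t0 &
    forall r, t0 <= r <= t -> - 1 * (E (r - 1) * wv T' (updr (vec [:: s; 0]) i1 (r - 1))) =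
      E (r - 1) * w (r - 1) s].
Proof.
move=> h1 h3 h4 h5 h6 h7; exists (Num.max s tau); split.
- by rewrite le_max lexx orbT.
- by move=> r /andP[r1 r2]; rewrite updr2; apply: window2; apply/andP; split; lra.
- move=> r /andP[r1 r2]; rewrite updr2.
  have q1 : Num.max s tau <= t0 by rewrite ge_max h3 h4.
  have q2 : s <= Num.max s tau by rewrite le_max lexx.
  by apply: window2; apply/andP; split; lra.
- by rewrite !updr2; split; apply: wvE; lra.
- move=> r /andP[r1 r2]; rewrite updr2 wv_swap mulrN mulrNN mul1r.
  by [].
Qed.

Lemma g2_lower (s t0 t c : R) : tau - 1 <= s -> s <= t0 ->
  tau <= t0 -> t0 <= t -> t <= s + 1 -> t <= B -> 0 <= c ->
  (forall r, t0 <= r -> r <= t -> c <= g2 (r - 1) s) ->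
  b1 * (e1 / e2) * c * (t - t0) <= g2 s t - g2 s t0.
Proof.
move=> h2 h3 h4 h5 h6 h7 c0 low.
have [T' [k1 k2 k3 [k4 k5] k6]] := wv_inc h2 h3 h4 h5 h6 h7.
have Es := Egt0 s.
have c0' : 0 <= c / E s by rewrite divr_ge0// ltW.
have := wval_increment_ge pU genU UW (f := u) gE (mulr1 1) b10 b12 e10 betab Eb a_tau
  (le_trans h4 h5) k1 h4 h5 h7 k2 k3 c0'.
rewrite k4 k5 => inc.
have -> : g2 s t - g2 s t0 = E s * (E t * w s t - E t0 * w s t0).
  by rewrite /g2; ring.
have -> : b1 * (e1 / e2) * c * (t - t0) =
    E s * (b1 * (e1 / e2) * (c / E s) * (t - t0)).
  by rewrite -[c in LHS](divfK (lt0r_neq0 Es)); ring.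
rewrite ler_pM2l//; apply: inc => r tr; rewrite k6// ler_pdivrMr//.
have /andP[tr1 tr2] := tr.
by apply: le_trans (low _ tr1 tr2) _; rewrite /g2 le_eqVlt; apply/orP; left; apply/eqP; ring.
Qed.

Lemma g2_upper (s t0 t c : R) : tau - 1 <= s -> s <= t0 ->
  tau <= t0 -> t0 <= t -> t <= s + 1 -> t <= B -> 0 <= c ->
  (forall r, t0 <= r -> r <= t -> g2 (r - 1) s <= c) ->
  g2 s t - g2 s t0 <= b2 * (e2 / e1) * c * (t - t0).
Proof.
move=> h2 h3 h4 h5 h6 h7 c0 up.
have [T' [k1 k2 k3 [k4 k5] k6]] := wv_inc h2 h3 h4 h5 h6 h7.
have Es := Egt0 s.
have c0' : 0 <= c / E s by rewrite divr_ge0// ltW.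
have := wval_increment_le pU genU UW (f := u) gE (mulr1 1) b10 b12 e10 betab Eb a_tau
  (le_trans h4 h5) k1 h4 h5 h7 k2 k3 c0'.
rewrite k4 k5 => inc.
have -> : g2 s t - g2 s t0 = E s * (E t * w s t - E t0 * w s t0).
  by rewrite /g2; ring.
have -> : b2 * (e2 / e1) * c * (t - t0) =
    E s * (b2 * (e2 / e1) * (c / E s) * (t - t0)).
  by rewrite -[c in LHS](divfK (lt0r_neq0 Es)); ring.
rewrite ler_pM2l//; apply: inc => r tr; rewrite k6// ler_pdivlMr//.
have /andP[tr1 tr2] := tr.
by apply: le_trans (up _ tr1 tr2); rewrite /g2 le_eqVlt; apply/orP; left; apply/eqP; ring.
Qed.

Lemma g2_diag (s : R) : g2 s s = 0.
Proof. by rewrite /g2 w_diag mulr0. Qed.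

Lemma g2_init (s t : R) : linear_process W -> Kcone 2 u ->
  tau - 1 <= s -> s <= t -> t <= tau -> 0 <= g2 s t.
Proof.
move=> pW Ku h1 h3 h4; apply: mulr_ge0; first by rewrite !mulr_ge0// ltW.
rewrite /w2 max_r// /wval (process_id pW); apply: (Ku (time_point tau _)).
apply: time_point_simplex.
apply: ord2P; apply: ord2P => //= _; rewrite /vec /=; lra.
Qed.

Let pW : linear_process W := wedge_linear_process pU UW.

Lemma w2_continuous : continuous (fun z : R * R => w z.1 z.2).
Proof.
apply: (@wval_continuous R 2 W pW (R * R)%type u snd (cst tau)
  (fun z => vec [:: z.1; z.2])).
- by move=> z; exact: cvg_snd.
- exact: cst_continuous.
- by apply: ord2P => z /=; [exact: cvg_fst|exact: cvg_snd].
Qed.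

Let Ege (t : R) : tau - 1 <= t -> t <= B -> e1 <= E t.
Proof.
move: (a_tau) => h h1 h2; have /andP[//] : e1 <= E t <= e2.
by apply: Eb; apply/andP; split; lra.
Qed.

Lemma g2_gt0E (s t : R) : (0 < g2 s t) = (0 < w s t).
Proof. by rewrite /g2 pmulr_rgt0// !mulr_gt0. Qed.

Lemma g2_ge0E (s t : R) : (0 <= g2 s t) = (0 <= w s t).
Proof. by rewrite /g2 pmulr_rge0// !mulr_gt0. Qed.

Lemma g2_ge (s t k : R) : tau - 1 <= s -> s <= t -> t <= B ->
  0 <= k -> k <= w s t -> e1 ^+ 2 * k <= g2 s t.
Proof.
move=> h2 h3 h4 k0 kw; have e0 := ltW e10.
have Es : e1 <= E s by apply: Ege; lra.
have Et : e1 <= E t by apply: Ege; lra.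
by rewrite /g2 expr2; apply: ler_pM => //; rewrite ?mulr_ge0//; apply: ler_pM.
Qed.

Lemma g2_open (s t : R) : tau - 1 <= s -> s <= t -> t <= s + 1 ->
  t <= B -> 0 < g2 s t -> exists2 d, 0 < d & forall s' t',
  tau - 1 <= s' -> s' <= t' -> t' <= s' + 1 -> t' <= B ->
  `|s' - s| < d -> `|t' - t| < d -> d <= g2 s' t'.
Proof.
rewrite g2_gt0E => h1 h3 h4 h5 w0.
have w02 : 0 < w s t / 2 by rewrite divr_gt0.
have /cvgrPdist_le/(_ _ w02)/nbhs_ballP[r /= r0 rP] := @w2_continuous (s, t).
pose d := Num.min r (e1 ^+ 2 * (w s t / 2)).
exists d; first by rewrite lt_min r0 mulr_gt0// exprn_gt0.
have dr x y : `|y - x| < d -> ball x r y.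
  rewrite lt_min => /andP[+ _]; by rewrite -ball_normE /= distrC.
move=> s' t' k2 k3 k4 k5 /dr q2 /dr q3.
have := rP (s', t') (conj q2 q3) => /=.
rewrite ler_norml => /andP[_ wle].
apply: le_trans (_ : e1 ^+ 2 * (w s t / 2) <= _).
  by rewrite ge_min lexx orbT.
by apply: g2_ge => //; [exact: ltW|lra].
Qed.

Hypothesis Ku : Kcone 2 u.

Let c1 : 0 < b1 * (e1 / e2).
Proof. by rewrite mulr_gt0 ?divr_gt0//; exact: lt_le_trans e12. Qed.

Lemma g2_ge0 (s t : R) : tau - 1 <= s -> s <= t -> t <= s + 1 ->
  t <= B -> 0 <= g2 s t.
Proof.
apply: (two_ge0 (b1 := b1 * (e1 / e2))).
- by move=> *; exact: g2_init.
- by move=> *; exact: g2_diag.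
- exact: g2_lower.
Qed.

Hypothesis u0 : u <> 0.

Lemma g2_gt0_init : exists s t, [/\ tau - 1 <= s, s < t, t <= tau & 0 < g2 s t].
Proof.
have [th sth uth] : exists2 th, simplex 2 th & u th != 0.
  apply: contrapT => H; apply: u0; apply: wedge_eq0 => th sth.
  by apply/eqP; apply: contrapT => /negP h; apply: H; exists th.
pose v i := tau + \val (th i).
have thE : time_point tau v = th.
  by apply/funext => i; rewrite /time_point /v addrAC subrr add0r seg_of_val.
have vE : v = vec [:: v i0; v i1] by apply/funext; apply: ord2P.
have vb i : tau - 1 <= v i <= tau.
  by have /andP[? ?] := seg_bounds (th i); apply/andP; split; rewrite /v; lra.
have /andP[v01 v02] := vb i0; have /andP[v11 v12] := vb i1.
have l01 : v i0 <= v i1 by rewrite lerD2l; exact: sth.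
have wu : w (v i0) (v i1) = u th.
  by rewrite /w2 max_r// -vE /wval (process_id pW) thE.
have wne0 : w (v i0) (v i1) != 0 by rewrite wu.
exists (v i0), (v i1); split=> //.
- rewrite lt_neqAle l01 andbT; apply: contra_neq uth => v01E.
  apply: (@wedge_diag _ _ _ _ i0 i1) => //; apply/val_inj.
  by move/addrI : v01E.
- by rewrite g2_gt0E lt_neqAle eq_sym wne0 /= wu; exact: Ku.
Qed.

Let g2_exists (c : R) : tau + 1 <= c -> c <= B ->
  exists s, [/\ c - 1 <= s, s < c & 0 < g2 s c].
Proof.
have [s [t [h1 h3 h4 gt0]]] := g2_gt0_init.
apply: (two_exists c1 _ _ _ _ h1 h3 h4 gt0).
- by move=> *; exact: g2_init.
- by move=> *; exact: g2_diag.
- exact: g2_lower.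
- exact: g2_open.
Qed.

Lemma w2_end (c : R) : tau + 2 <= c -> c <= B -> 0 < w (c - 1) c.
Proof.
move=> h1 h2; rewrite -g2_gt0E.
apply: (two_end c1 _ _ _ _ h1 h2 g2_exists).
- by move=> *; exact: g2_init.
- by move=> *; exact: g2_diag.
- exact: g2_lower.
- exact: g2_open.
Qed.

End Bounds.

End TwoWedge.

Section Uniform2.
Context {R : realType} {alpha beta : R -> R}.
Context {U : R -> R -> Xsp R -> Xsp R} {W : R -> R -> wedge R 2 -> wedge R 2}.
Hypothesis pU : linear_process U.
Hypothesis genU : generated_by alpha beta U.
Hypothesis UW : forall t tau : R, tau <= t -> is_wedge_power (U t tau) (W t tau).
Hypothesis intalpha : loc_integrable alpha.
Hypothesis beta_bounds : forall t1 t2 : R, t1 <= t2 -> exists beta1 beta2 : R,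
  0 < beta1 /\ {ae lebesgue_measure, forall t : R, t1 <= t <= t2 ->
    beta1 <= 1 * beta t <= beta2}.

Lemma w2_ge0 (tau : R) (u : wedge R 2) (s t : R) : Kcone 2 u ->
  tau - 1 <= s -> s <= t -> t <= s + 1 -> 0 <= w2 (W := W) tau u s t.
Proof.
move=> Ku h1 h3 h4.
have aB : tau - 2 <= Num.max tau t by rewrite le_max; apply/orP; left; lra.
have [E [b1 [b2 [e1 [e2 [gE b10 b12 bP [e10 e12 eP]]]]]]] :=
  delay_constants intalpha beta_bounds aB.
have a_tau : tau - 2 + 1 <= tau by lra.
rewrite -(g2_ge0E gE) (g2_ge0 pU genU UW gE b10 b12 e10 bP eP a_tau Ku)//.
by rewrite le_max lexx orbT.
Qed.

Let Z := (R * R * R)%type.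
Let Phi (u : wedge R 2) (z : Z) : R := w2 (W := W) z.1.1 u z.1.2 z.2.

Let c1 (X1 X2 : topologicalType) : continuous (fst : X1 * X2 -> X1).
Proof. by move=> z; exact: cvg_fst. Qed.
Let c2 (X1 X2 : topologicalType) : continuous (snd : X1 * X2 -> X2).
Proof. by move=> z; exact: cvg_snd. Qed.

Let Phi_continuous u : continuous (Phi u).
Proof.
have ct : continuous (fun z : Z => z.1.1).
  exact (continuous_compT (@c1 _ _) (@c1 _ _)).
have cs : continuous (fun z : Z => z.1.2).
  exact (continuous_compT (@c1 _ _) (@c2 _ _)).
have cz : continuous (fun z : Z => z.2) by exact: c2.
apply: (@wval_continuous R 2 W (wedge_linear_process pU UW) Z u snd (fun z => z.1.1)
  (fun z => vec [:: z.1.2; z.2])) => //.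
move=> [[|[|//]] h]; [exact: cs|exact: cz].
Qed.

Lemma w2_two_sided (u : wedge R 2) (tau1 tau2 B : R) : Kcone 2 u -> u <> 0 ->
  tau1 <= tau2 -> tau2 <= B ->
  exists C1 C2 : R, [/\ 0 < C1, 0 < C2 & forall tau s t : R, tau1 <= tau -> tau <= tau2 ->
    tau + 2 <= s -> s <= t -> t <= s + 1 -> t <= B ->
    C1 * (t - s) <= w2 (W := W) tau u s t <= C2 * (t - s)].
Proof.
move=> Ku u0 t12 t2B.
have aB : tau1 - 2 <= B by lra.
have [E [b1 [b2 [e1 [e2 [gE b10 b12 bP [e10 e12 eP]]]]]]] :=
  delay_constants intalpha beta_bounds aB.
have e20 : 0 < e2 := lt_le_trans e10 e12.
have b20 : 0 < b2 := lt_le_trans b10 b12.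
have a_tau tau : tau1 <= tau -> tau1 - 2 + 1 <= tau by move=> ?; lra.
have EB tau x : tau1 <= tau -> tau - 1 <= x -> x <= B -> e1 <= E x <= e2.
  by move=> ? ? ?; apply: eP; apply/andP; split; lra.
pose itv : set R := `[tau1 - 2, B]%classic.
have itvP x : tau1 - 2 <= x -> x <= B -> itv x by move=> ? ?; rewrite /itv/= in_itv/=; apply/andP.
have itvt : compact (`[tau1, tau2]%classic : set R) by exact: segment_compact.
have citv : compact itv by exact: segment_compact.
(* Pairs [(c - 1, c)] are positive from [tau + 2] on; thickening gives the range of [h] required by
   [two_lower_bound]. *)
have [d d0 dP] : exists2 d, 0 < d & forall tau c h : R, tau1 <= tau -> tau <= tau2 ->
    tau + 2 <= c -> c <= B -> 0 <= h -> h <= d ->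
    d <= w2 (W := W) tau u (c - 1 + h) c.
  pose K : set (R * R) := (`[tau1, tau2]%classic `*` itv) `&` [set z | z.1 + 2 <= z.2].
  have q1 : continuous (fun z : R * R => z.1 : R^o) by exact: c1.
  have q2 : continuous (fun z : R * R => z.2 : R^o) by exact: c2.
  have cst (X : topologicalType) (x : R) : continuous (fun _ : X => x : R^o).
    exact: cst_continuous.
  have cK : compact K.
    have k1 := closed_le_fun (csp_ctsD q1 (cst _ 2)) q2.
    exact (compact_closedI (compact_setX itvt citv) k1).
  pose f (y : (R * R) * R) : R := Phi u (y.1.1, y.1.2 - 1 + y.2, y.1.2).
  have cf : continuous f.
    have r1 : continuous (fun y : (R * R) * R => y.1.1 : R^o).
      exact (continuous_compT (@c1 _ _) q1).
    have r2 : continuous (fun y : (R * R) * R => y.1.2 : R^o).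
      exact (continuous_compT (@c1 _ _) q2).
    have r4 : continuous (fun y : (R * R) * R => y.2 : R^o) by exact: c2.
    have rr := continuous_pair (continuous_pair r1
      (csp_ctsD (csp_ctsB r2 (cst _ 1)) r4)) r2.
    exact (continuous_compT rr (@Phi_continuous u)).
  have [|d d0 dP] := compact_thick cK cf.
    move=> [tau c] [[/= h1 h2] h4]; rewrite /f /Phi /= addr0.
    move: h1 h2; rewrite /itv /= !in_itv/= => /andP[h11 h12] /andP[h21 h22].
    by apply: (w2_end pU genU UW gE b10 b12 e10 e12 bP eP (a_tau _ h11) Ku u0).
  exists d => // tau c h h1 h2 h3 h4 h7 h8.
  apply: (dP (tau, c) h) => //.
  have i1 : `[tau1, tau2]%classic tau by rewrite /= in_itv/= h1.
  have i2 : itv c by apply: itvP; lra.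
  by split.
pose D := Num.min d 1.
have D0 : 0 < D by rewrite lt_min d0 ltr01.
have D1 : D <= 1 by rewrite ge_min lexx orbT.
have Dd : D <= d by rewrite ge_min lexx.
pose box : set Z := `[tau1, tau2]%classic `*` itv `*` itv.
have cbox : compact box.
  exact (compact_setX (compact_setX itvt citv) citv).
have [M M0 MP] := compact_upper cbox (@Phi_continuous u).
pose kappa := e1 ^+ 2 * d.
pose CM := b2 * (e2 / e1) * (e2 ^+ 2 * M) + 1.
have pos : [/\ 0 < b1 * (e1 / e2), 0 < kappa, 0 <= b2 * (e2 / e1),
    0 <= e2 ^+ 2 * M & 0 < CM].
  have e23M : 0 <= e2 ^+ 2 * M by rewrite mulr_ge0// exprn_ge0// ltW.
  have b2'0 : 0 <= b2 * (e2 / e1) by rewrite ltW// mulr_gt0// divr_gt0.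
  split=> //.
  - by rewrite mulr_gt0// divr_gt0.
  - by rewrite mulr_gt0 ?exprn_gt0.
  - by rewrite ltr_wpDl// mulr_ge0.
exists (b1 * (e1 / e2) * kappa * D / e2 ^+ 2), (CM / e1 ^+ 2).
split.
- case: pos => b1'0 kappa0 _ _ _; apply: divr_gt0; last exact: exprn_gt0.
  by apply: mulr_gt0 => //; exact: mulr_gt0.
- by case: pos => _ _ _ _ CM0; rewrite divr_gt0 ?exprn_gt0.
move=> tau s t h1 h2 h3 h5 h6 h7.
have at1 := a_tau _ h1.
have pos' : 0 <= t - s /\ 0 <= w2 (W := W) tau u s t.
  by split; [rewrite subr_ge0|apply: w2_ge0 => //; lra].
have F_lower := g2_lower pU genU UW (u := u) gE b10 b12 e10 bP eP at1.
have F_upper := g2_upper pU genU UW (u := u) gE b10 b12 e10 bP eP at1.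
have F_ge0 := g2_ge0 pU genU UW gE b10 b12 e10 bP eP at1 Ku.
have F_ge s' t' := @g2_ge R W tau u _ B e1 e2 E e10 eP at1 s' t'.
have Egt0 := gauge_gt0 gE.
have EEE s' t' : tau - 1 <= s' -> s' <= t' -> t' <= B ->
    e1 ^+ 2 <= E s' * E t' <= e2 ^+ 2.
  move=> l2 l3 l4; have e1' := ltW e10.
  have /andP[m1 m2] : e1 <= E s' <= e2 by apply: (EB _ _ h1); lra.
  have /andP[m3 m4] : e1 <= E t' <= e2 by apply: (EB _ _ h1); lra.
  have E' x := ltW (Egt0 x).
  by rewrite !expr2; apply/andP; split; apply: ler_pM.
have Est : e1 ^+ 2 <= E s * E t <= e2 ^+ 2 by apply: EEE; lra.
have lower : b1 * (e1 / e2) * kappa * D * (t - s) <=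
    g2 (W := W) (tau := tau) (u := u) (E := E) s t.
  have [b1'0 kappa0 _ _ _] := pos.
  apply: (two_lower_bound (tau := tau) (B := B)) => //; clear b1'0 kappa0.
  - by move=> *; exact: (g2_init gE (wedge_linear_process pU UW)).
  - by move=> *; exact: g2_diag.
  - move=> x y l1 l2 l3 l4; apply: F_ge; [lra|lra|lra|exact: ltW|].
    by apply: dP; lra.
have upper : g2 (W := W) (tau := tau) (u := u) (E := E) s t <=
    b2 * (e2 / e1) * (e2 ^+ 2 * M) * (t - s).
  have [_ _ b2'0 e23M _] := pos; clear lower.
  apply: (two_upper_bound (tau := tau) (B := B)) => //; clear b2'0 e23M.
  - by move=> *; exact: g2_diag.
  - move=> y z l1 l3 l4 l5; rewrite /g2.
    have wM : w2 (W := W) tau u y z <= M.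
      have i1 : `[tau1, tau2]%classic tau by rewrite /= in_itv/= h1.
      have i2 : itv y by apply: itvP; lra.
      have i3 : itv z by apply: itvP; lra.
      exact: (MP (tau, y, z)).
    have /andP[l6 l7] := EEE y z l1 l3 l5.
    have yz0 : 0 <= E y * E z by rewrite !mulr_ge0// ltW.
    by apply: ler_pM => //; apply: w2_ge0.
case: pos pos' Est => _ _ _ _ CM0 [u20 w0] /andP[l1 l2].
have e13 : 0 < e1 ^+ 2 by rewrite exprn_gt0.
have e23 : 0 < e2 ^+ 2 by rewrite exprn_gt0.
rewrite [X in X <= _ <= _]mulrAC [X in _ <= _ <= X]mulrAC ler_pdivrMr// ler_pdivlMr//.
apply/andP; split.
  by apply: le_trans lower _; rewrite /g2 mulrC ler_wpM2l.
apply: (@le_trans _ _ (g2 (W := W) (tau := tau) (u := u) (E := E) s t)).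
  by rewrite /g2 mulrC ler_wpM2r.
by apply: le_trans upper _; rewrite ler_wpM2r// /CM lerDl.
Qed.

End Uniform2.

(** * The weights for two and three times, and the theorem *)

Section Um.
Context {R : realType}.

Lemma um2E (t : cube R 2) : simplex 2 t ->
  um 2 t = \val (t (lift ord0 ord0)) - \val (t ord0).
Proof.
move=> st; rewrite umE//; last by left.
rewrite /um_on_simplex; under eq_bigr => i _ do rewrite big_mkcond.
under [X in _ * X]eq_bigr => i _ do rewrite big_mkcond.
by rewrite !big_ord_recl !big_ord0 /= !mulr1 ?mul1r.
Qed.

Lemma um3E (t : cube R 3) : simplex 3 t ->
  um 3 t = u3 (\val (t ord0)) (\val (t (lift ord0 ord0)))
    (\val (t (lift ord0 (lift ord0 ord0)))).
Proof.
move=> st; rewrite umE//; last by right.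
rewrite /um_on_simplex; under eq_bigr => i _ do rewrite big_mkcond.
under [X in _ * X]eq_bigr => i _ do rewrite big_mkcond.
by rewrite !big_ord_recl !big_ord0 /= /u3; ring.
Qed.

Lemma seg_of_sorted_simplex (m : nat) (v : 'I_m -> R) :
  (forall i j : 'I_m, (i <= j)%N -> v i <= v j) ->
  simplex m (fun i => seg_of (v i)).
Proof.
move=> vv; have := time_point_simplex 0 vv.
by congr (simplex m); apply/funext => i; rewrite /time_point subr0.
Qed.

Lemma um2_Kcone : Kcone 2 (um 2 : wedge R 2) /\ (um 2 : wedge R 2) <> 0.
Proof.
split=> [t st|um0]; first by rewrite um2E// subr_ge0; exact: st.
pose v (i : 'I_2) : R := nth 0 [:: -1; 0] i.
have sv : simplex 2 (fun i => seg_of (v i)).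
  apply: seg_of_sorted_simplex => -[[|[|//]] hi] [[|[|//]] hj] //= _.
  rewrite /v /=; lra.
have := um2E sv; rewrite um0 /= /v /= !clamp_id; [|apply/andP; split; lra..].
by rewrite opprK add0r => /esym/eqP; rewrite oner_eq0.
Qed.

Lemma um3_Kcone : Kcone 3 (um 3 : wedge R 3) /\ (um 3 : wedge R 3) <> 0.
Proof.
split=> [t st|um0].
  have h i := seg_bounds (t i).
  have /andP[? ?] := h ord0; have /andP[? ?] := h (lift ord0 ord0).
  have /andP[? ?] := h (lift ord0 (lift ord0 ord0)).
  have l01 : \val (t ord0) <= \val (t (lift ord0 ord0)) by exact: st.
  have l12 : \val (t (lift ord0 ord0)) <= \val (t (lift ord0 (lift ord0 ord0))).
    by exact: st.
  by rewrite um3E// /u3 !mulr_ge0//; lra.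
(* At these equidistant points the four factors of the weight are [1 / 2], [1 / 2], [1] and
   [1 / 2]. *)
pose v (i : 'I_3) : R := nth 0 [:: -1; - (1 / 2); 0] i.
have sv : simplex 3 (fun i => seg_of (v i)).
  apply: seg_of_sorted_simplex => -[[|[|[|//]]] hi] [[|[|[|//]]] hj] //= _;
    rewrite /v /=; lra.
have := um3E sv; rewrite um0 /= /v /= !clamp_id; [|apply/andP; split; lra..].
have -> : u3 (-1) (- (1 / 2)) 0 = 8^-1 :> R by rewrite /u3; field.
by move=> /esym/eqP; rewrite invr_eq0 pnatr_eq0.
Qed.

End Um.

Theorem theorem7p1 (R : realType) (m : nat) (alpha beta : R -> R)
    (U : R -> R -> Xsp R -> Xsp R) (W : R -> R -> wedge R m -> wedge R m) :
  m = 2%N \/ m = 3%N ->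
  loc_integrable alpha ->
  loc_integrable beta ->
  (forall t1 t2 : R, t1 <= t2 -> exists beta1 beta2 : R, 0 < beta1 /\
     {ae lebesgue_measure, forall t : R, t1 <= t <= t2 ->
        beta1 <= (-1) ^+ m * beta t <= beta2}) ->
  linear_process U ->
  generated_by alpha beta U ->
  (forall t tau : R, tau <= t -> is_wedge_power (U t tau) (W t tau)) ->
  u0_positive (Kcone m) (um m) W /\
  u0_positive_from (Kcone m) (um m) W (if m == 2%N then 3 else 5).
Proof.
move=> m23 intalpha _ hb pU genU UW.
have pW := wedge_linear_process pU UW.
suff [pos Wum from] : [/\ forall t tau u, tau <= t -> Kcone m u -> Kcone m (W t tau u),
    Kcone m (um m : wedge R m) /\ (um m : wedge R m) <> 0 &
    u0_positive_from (Kcone m) (um m) W (if m == 2%N then 3 else 5)].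
  split=> //; split=> //; first exact: Kcone_is_cone.
  by exists (if m == 2%N then 3 else 5) => //; case: ifP.
case: m23 => mE; subst m => /=.
- rewrite sqrrN expr1n in hb.
  split; [|exact: um2_Kcone|].
    move=> t tau u tt Ku th sth; rewrite (w2_wedge genU UW)//.
    have h i := seg_bounds (th i).
    have /andP[? ?] := h ord0; have /andP[? ?] := h (lift ord0 ord0).
    have l01 : \val (th ord0) <= \val (th (lift ord0 ord0)) by exact: sth.
    by apply: (w2_ge0 pU genU UW intalpha hb) => //; lra.
  move=> u tau1 tau2 eta1 Ku u0 t12 h3.
  (* [tau2 + eta1] bounds every end time [tau + eta]. For [eta >= 3] the window of length one lies
     past [tau + 2], where the two-sided bound holds. *)
  have t2B : tau2 <= tau2 + eta1 by lra.
  have [C1 [C2 [C10 C20 CP]]] :=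
    w2_two_sided pU genU UW intalpha hb Ku u0 t12 t2B.
  exists C1, C2; split=> // tau eta /andP[ta1 ta2] /andP[et1 et2].
  have key th : simplex 2 th ->
      C1 * um 2 th <= W (tau + eta) tau u th <= C2 * um 2 th.
    move=> sth; have tt : tau <= tau + eta by lra.
    rewrite (w2_wedge genU UW tt sth) um2E//.
    have h i := seg_bounds (th i).
    have /andP[? ?] := h ord0; have /andP[? ?] := h (lift ord0 ord0).
    have l01 : \val (th ord0) <= \val (th (lift ord0 ord0)) by exact: sth.
    have -> : \val (th (lift ord0 ord0)) - \val (th ord0) =
        tau + eta + \val (th (lift ord0 ord0)) - (tau + eta + \val (th ord0)) by ring.
    by apply: CP; lra.
  by split=> th /key /andP[k1 k2]; [change (0 <= W (tau + eta) tau u th - C1 * um 2 th)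
    | change (0 <= C2 * um 2 th - W (tau + eta) tau u th)]; rewrite subr_ge0.
- rewrite exprS sqrrN expr1n mulr1 in hb.
  split; [|exact: um3_Kcone|].
    move=> t tau u tt Ku th sth; rewrite (w3_wedge genU UW)//.
    have h i := seg_bounds (th i).
    have /andP[? ?] := h ord0; have /andP[? ?] := h (lift ord0 ord0).
    have /andP[? ?] := h (lift ord0 (lift ord0 ord0)).
    have l01 : \val (th ord0) <= \val (th (lift ord0 ord0)) by exact: sth.
    have l12 : \val (th (lift ord0 ord0)) <= \val (th (lift ord0 (lift ord0 ord0))).
      by exact: sth.
    by apply: (w3_ge0 pU genU UW intalpha hb) => //; lra.
  move=> u tau1 tau2 eta1 Ku u0 t12 h3.
  (* For [eta >= 5] the window lies past [tau + 4], as the bound in three times requires. *)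
  have t2B : tau2 <= tau2 + eta1 by lra.
  have [C1 [C2 [C10 C20 CP]]] :=
    w3_two_sided pU genU UW intalpha hb Ku u0 t12 t2B.
  exists C1, C2; split=> // tau eta /andP[ta1 ta2] /andP[et1 et2].
  have key th : simplex 3 th ->
      C1 * um 3 th <= W (tau + eta) tau u th <= C2 * um 3 th.
    move=> sth; have tt : tau <= tau + eta by lra.
    rewrite (w3_wedge genU UW tt sth) um3E//.
    have h i := seg_bounds (th i).
    have /andP[? ?] := h ord0; have /andP[? ?] := h (lift ord0 ord0).
    have /andP[? ?] := h (lift ord0 (lift ord0 ord0)).
    have l01 : \val (th ord0) <= \val (th (lift ord0 ord0)) by exact: sth.
    have l12 : \val (th (lift ord0 ord0)) <= \val (th (lift ord0 (lift ord0 ord0))).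
      by exact: sth.
    have -> : u3 (\val (th ord0)) (\val (th (lift ord0 ord0)))
        (\val (th (lift ord0 (lift ord0 ord0)))) =
      u3 (tau + eta + \val (th ord0)) (tau + eta + \val (th (lift ord0 ord0)))
        (tau + eta + \val (th (lift ord0 (lift ord0 ord0)))) by rewrite /u3; ring.
    by apply: CP; lra.
  by split=> th /key /andP[k1 k2]; [change (0 <= W (tau + eta) tau u th - C1 * um 3 th)
    | change (0 <= C2 * um 3 th - W (tau + eta) tau u th)]; rewrite subr_ge0.
Qed.
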